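(* Let $\omega$ be a weight function satisfying $$(\epsilon)_0\quad \int_0^\infty \omega(t)e^{-\mu t}\,dt<\infty\ \text{ for all }\mu>0,\qquad (\delta)\quad 2\omega(t)\le\omega(Ht)+\log A,\ t\ge0,\ \text{ for some }A,H\ge1.$$ Then the sequence $$0\longrightarrow\mathcal{P}_{(\omega)}\longrightarrow\mathcal{O}_{(\omega)}\xrightarrow{\ \operatorname{bv}\ }\mathcal{U}'_{(\omega)}(\mathbb{C})\longrightarrow 0$$ is exact (as a sequence of vector spaces), where the first non-zero map is restriction.
   Context: A weight function is a non-decreasing function $\omega:[0,\infty)\to[0,\infty)$, always assumed to satisfy $\lim_{t\to\infty}\omega(t)/\log t=\infty$; it is extended to $\mathbb{R}$ by $\omega(t)=\omega(|t|)$. Write $z=x+iy$, $T^h=\mathbb{R}+i(-h,h)$, and, for $0<b<R$, $T^{b,R}=T^R\setminus\overline{T^b}$. $\mathcal{U}_{(\omega)}(\mathbb{C})$ is the space of entire functions $\varphi$ with $\|\varphi\|^{h,\lambda}:=\sup_{z\in T^h}|\varphi(z)|e^{\omega(\lambda x)}<\infty$ for all $h,\lambda>0$, topologized by the norms $\|\cdot\|^{h,\lambda}$; $\mathcal{U}'_{(\omega)}(\mathbb{C})$ is its topological dual (ultrahyperfunctions of $(\omega)$-type). $\mathcal{O}_{(\omega)}$ is the space of functions $F$ for which there are $b,\lambda>0$ such that $F$ is analytic on $\mathbb{C}\setminus\overline{T^b}$ and $\sup_{z\in T^{b,R}}|F(z)|e^{-\omega(\lambda x)}<\infty$ for every $R>b$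 (functions which agree on the complement of some larger closed strip $\overline{T^{c}}$ being identified). That is, $\mathcal{O}_{(\omega)}=\bigcup_{h>0}\bigcup_{\lambda>0}\bigcup_{b<h}\bigcap_{R>b}\mathcal{O}^{b,R,\lambda}_\omega$, where $\mathcal{O}^{b,R,\lambda}_\omega$ is the space of $F$ analytic on $T^{b,R}$ with $\sup_{z\in T^{b,R}}|F(z)|e^{-\omega(\lambda x)}<\infty$. $\mathcal{P}_{(\omega)}$ is the space of entire functions $P$ for which there is $\lambda>0$ such that $\sup_{z\in T^R}|P(z)|e^{-\omega(\lambda x)}<\infty$ for every $R>0$. The boundary value mapping is $\langle\operatorname{bv}(F),\varphi\rangle=-\int_{\Gamma_k}F(z)\varphi(z)\,dz$, $\varphi\in\mathcal{U}_{(\omega)}(\mathbb{C})$, where $F\in\mathcal{O}_{(\omega)}$ is analytic on $\mathbb{C}\setminus\overline{T^b}$ and, for some $\lambda>0$, satisfies $\sup_{z\in T^{b,R}}|F(z)|e^{-\omega(\lambda x)}<\infty$ for every $R>b$, $k>b$, and $\Gamma_k$ is the counterclockwise oriented boundary of $T^k$; it does not depend on $k$. *)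

(* Defs.v *)
From HB Require Import structures.
From mathcomp Require Import all_boot all_order all_algebra.
From mathcomp Require Import generic_quotient ring_quotient complex.
From mathcomp Require Import all_classical all_reals all_analysis.

Set Implicit Arguments.
Unset Strict Implicit.
Unset Printing Implicit Defensive.

Import Order.TTheory GRing.Theory Num.Theory.
Import numFieldNormedType.Exports.
Import ComplexField.Normc.

Local Open Scope classical_set_scope.
Local Open Scope ring_scope.

(* The complex numbers over [R], as a normed module over themselves: the alias
   [^o] is what gives access to the topology and to [derivable]. *)
Notation cplx R := ((complex R)^o).

(** * Weight functions *)

(* Only the values of [weight_fun] on [0, +oo[ matter. *)
Record weight (R : realType) := Weight {
  weight_fun : R -> R ;
  weight_ge0 : forall t, 0 <= t -> 0 <= weight_fun t ;
  weight_homo : forall s t, 0 <= s -> s <= t -> weight_fun s <= weight_fun t ;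
  weight_log : weight_fun t / ln t @[t --> +oo] --> +oo }.

(* The even extension of a weight function to the whole line. *)
Definition weight_ext (R : realType) (w : weight R) (t : R) : R :=
  weight_fun w `|t|.
Coercion weight_ext : weight >-> Funclass.

Definition cond_epsilon0 (R : realType) (w : weight R) : Prop :=
  forall mu : R, 0 < mu ->
  (\int[lebesgue_measure]_(t in `[0%R, +oo[) (w t * expR (- (mu * t)))%:E
     < +oo)%E.

Definition cond_delta (R : realType) (w : weight R) : Prop :=
  exists A H : R, [/\ 1 <= A, 1 <= H &
    forall t, 0 <= t -> 2 * w t <= w (H * t) + ln A].

(** * Strips, analytic functions and weighted suprema *)

Definition strip (R : realType) (h : R) : set (cplx R) :=
  [set z | - h < complex.Im z < h].

Definition strip2 (R : realType) (b r : R) : set (cplx R) :=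
  strip r `\` closure (strip b).

Definition analytic_on (R : realType) (A : set (cplx R))
    (F : cplx R -> cplx R) : Prop :=
  forall z, A z -> derivable F z 1.

Definition wsup (R : realType) (A : set (cplx R)) (v : R -> R)
    (F : cplx R -> cplx R) : \bar R :=
  ereal_sup [set (normc (F z) * v (complex.Re z))%:E | z in A].

(* The norm ||.||^{h,lambda}. *)
Definition test_norm (R : realType) (w : weight R) (h lam : R) :=
  wsup (strip h) (fun x => expR (w (lam * x))).

(* The supremum over [A] of |F(z)| e^{-w(lambda x)}. *)
Definition growth_sup (R : realType) (w : weight R) (lam : R)
    (A : set (cplx R)) :=
  wsup A (fun x => expR (- w (lam * x))).

Section Wsup.
Context {R : realType}.
Implicit Types (A B : set (cplx R)) (v : R -> R) (F G : cplx R -> cplx R).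

Lemma wsup_ltyP A v F : (wsup A v F < +oo)%E <->
  exists M : R, forall z, A z -> normc (F z) * v (complex.Re z) <= M.
Proof.
split=> [lty|[M leM]]; last first.
  apply: (@le_lt_trans _ _ M%:E); last exact: ltry.
  by apply: ge_ereal_sup => _ [z Az <-]; rewrite lee_fin leM.
have ub z : A z -> ((normc (F z) * v (complex.Re z))%:E <= wsup A v F)%E.
  by move=> Az; apply: ereal_sup_ubound; exists z.
case E: (wsup A v F) lty ub => [M| |] // _ ub.
  by exists M => z /ub; rewrite lee_fin.
by exists 0 => z /ub; rewrite leeNy_eq.
Qed.

Lemma wsup0_lty A v : (wsup A v 0%R < +oo)%E.
Proof. by apply/wsup_ltyP; exists 0 => z _; rewrite normc0 mul0r. Qed.

Lemma wsup_lin_lty A v (a : R[i]) F G : (forall x, 0 <= v x) ->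
  (wsup A v F < +oo)%E -> (wsup A v G < +oo)%E ->
  (wsup A v (a *: F + G)%R < +oo)%E.
Proof.
move=> v0 /wsup_ltyP[M FM] /wsup_ltyP[N GN]; apply/wsup_ltyP.
exists (normc a * M + N) => z Az.
have na : 0 <= normc a by case: (a) => ? ?; apply: sqrtr_ge0.
apply: le_trans (ler_wpM2r (v0 _) (le_normcD _ _)) _.
rewrite mulrDl lerD ?GN// normcM -mulrA ler_wpM2l// FM//.
Qed.

Lemma wsup_le_lty A B v v' F : B `<=` A -> (forall x, v' x <= v x) ->
  (wsup A v F < +oo)%E -> (wsup B v' F < +oo)%E.
Proof.
move=> BA vv /wsup_ltyP[M FM]; apply/wsup_ltyP; exists M => z /BA Az.
apply: le_trans (FM z Az); rewrite ler_wpM2l//.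
by case: (F z) => ? ?; apply: sqrtr_ge0.
Qed.

Lemma le_weight_ext (w : weight R) (l m x : R) :
  0 <= l -> l <= m -> w (l * x) <= w (m * x).
Proof.
move=> l0 lm; apply: weight_homo => //.
by rewrite !normrM ler_wpM2r// !ger0_norm// (le_trans l0).
Qed.

Lemma analytic_on0 A : analytic_on A 0.
Proof. by move=> z _; apply: derivable_cst. Qed.

Lemma analytic_on_lin A (a : R[i]) F G :
  analytic_on A F -> analytic_on A G -> analytic_on A (a *: F + G).
Proof.
by move=> hF hG z Az; apply: derivableD; [apply: derivableZ; apply: hF|apply: hG].
Qed.

Lemma analytic_onS A B F : B `<=` A -> analytic_on A F -> analytic_on B F.
Proof. by move=> BA hF z /BA; apply: hF. Qed.

Lemma strip_subset (b c : R) : b <= c -> strip b `<=` strip c.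
Proof.
move=> bc z /andP[h1 h2]; apply/andP; split; last exact: lt_le_trans bc.
by apply: le_lt_trans h1; rewrite lerN2.
Qed.

End Wsup.

(** * The test function space *)

Section TestSpace.
Context {R : realType} (w : weight R).
Local Notation C := (cplx R).

Definition is_test (phi : C -> C) : Prop :=
  analytic_on setT phi /\
  forall h lam : R, 0 < h -> 0 < lam -> (test_norm w h lam phi < +oo)%E.

Definition test_pred : {pred C -> C} := fun phi => `[< is_test phi >].

Lemma test_pred_closed : subsemimod_closed test_pred.
Proof.
apply: (@GRing.submod_closed_semi _ _ _ _); split=> [|a F G].
  apply/asboolP; split; first exact: analytic_on0.
  by move=> *; apply: wsup0_lty.
move=> /asboolP[aF nF] /asboolP[aG nG]; apply/asboolP; split.
  exact: analytic_on_lin.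
by move=> h l h0 l0; apply: wsup_lin_lty; [move=> *; apply: expR_ge0|apply: nF|apply: nG].
Qed.

HB.instance Definition _ :=
  GRing.isSubmodClosed.Build R[i] (C -> C) test_pred test_pred_closed.

Definition test_space := {phi : C -> C | phi \in test_pred}.
HB.instance Definition _ := SubChoice.on test_space.
HB.instance Definition _ := [SubChoice_isSubLmodule of test_space by <:].

(* The topology generated by the balls of all the norms ||.||^{h,lambda}; a
   ball is given by its centre and by h, lambda and its radius. *)
Definition test_ball (i : test_space * (R * R * R)) : set test_space :=
  let: (phi, (h, lam, e)) := i in
  [set psi | (test_norm w h lam (\val psi - \val phi)%R < e%:E)%E].

Definition test_ball_index : set (test_space * (R * R * R)) :=
  [set i | [/\ 0 < i.2.1.1, 0 < i.2.1.2 & 0 < i.2.2]].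

HB.instance Definition _ := isPointed.Build test_space 0.
HB.instance Definition _ :=
  isSubBaseTopological.Build test_space test_ball_index test_ball.

End TestSpace.

(** * Ultrahyperfunctions: the topological dual *)

Section Dual.
Context {R : realType} (w : weight R).
Local Notation C := (cplx R).
Local Notation U := (test_space w).

Definition is_dual (f : U -> C) : Prop := linear f /\ continuous f.

Definition dual_pred : {pred U -> C} := fun f => `[< is_dual f >].

Lemma dual_pred_closed : subsemimod_closed dual_pred.
Proof.
apply: (@GRing.submod_closed_semi _ _ _ _); split=> [|a f g].
  apply/asboolP; split; first exact: (linearP (\0 : U -> C)).
  by move=> phi; apply: (@cst_continuous U C 0).
move=> /asboolP[lf cf] /asboolP[lg cg]; apply/asboolP; split.
  move=> c phi psi.
  change (a *: f (c *: phi + psi) + g (c *: phi + psi) =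
    c *: (a *: f phi + g phi) + (a *: f psi + g psi) :> C).
  rewrite lf lg !scalerDr !scalerA [c * a]mulrC -!addrA; congr (_ + _).
  by rewrite addrCA.
change (continuous (fun x : U => a *: f x + g x : C)).
move=> phi; have cphi := nbhs_filter phi.
exact: (cvgD (F := nbhs phi) (cvgZl_tmp (k := a) (cf phi)) (cg phi)).
Qed.

HB.instance Definition _ :=
  GRing.isSubmodClosed.Build R[i] (U -> C) dual_pred dual_pred_closed.

Definition dual_space := {f : U -> C | f \in dual_pred}.
HB.instance Definition _ := SubChoice.on dual_space.
HB.instance Definition _ := [SubChoice_isSubLmodule of dual_space by <:].

End Dual.

(** * Entire functions of omega-growth on strips *)

Section EntireSpace.
Context {R : realType} (w : weight R).
Local Notation C := (cplx R).

Definition is_entire (P : C -> C) : Prop :=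
  analytic_on setT P /\ exists2 lam : R, 0 < lam &
    forall r : R, 0 < r -> (growth_sup w lam (strip r) P < +oo)%E.

Definition entire_pred : {pred C -> C} := fun P => `[< is_entire P >].

Lemma growth_le (l m : R) (A B : set C) F : 0 <= l -> l <= m -> B `<=` A ->
  (growth_sup w l A F < +oo)%E -> (growth_sup w m B F < +oo)%E.
Proof.
move=> l0 lm BA; apply: wsup_le_lty => // x.
by rewrite ler_expR lerN2 le_weight_ext.
Qed.

Lemma entire_pred_closed : subsemimod_closed entire_pred.
Proof.
apply: (@GRing.submod_closed_semi _ _ _ _); split=> [|a F G].
  apply/asboolP; split; first exact: analytic_on0.
  by exists 1 => // *; apply: wsup0_lty.
move=> /asboolP[aF [l l0 nF]] /asboolP[aG [m m0 nG]]; apply/asboolP; split.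
  exact: analytic_on_lin.
exists (Num.max l m); first by rewrite lt_max l0.
move=> r r0; apply: wsup_lin_lty => [x||]; first exact: expR_ge0.
  by apply: (growth_le (ltW l0) _ _ (nF r r0)); rewrite ?le_max ?lexx.
by apply: (growth_le (ltW m0) _ _ (nG r r0)); rewrite ?le_max ?lexx ?orbT.
Qed.

HB.instance Definition _ :=
  GRing.isSubmodClosed.Build R[i] (C -> C) entire_pred entire_pred_closed.

Definition entire_space := {P : C -> C | P \in entire_pred}.
HB.instance Definition _ := SubChoice.on entire_space.
HB.instance Definition _ := [SubChoice_isSubLmodule of entire_space by <:].

End EntireSpace.

(** * Functions analytic off a strip, modulo equality off a larger strip *)

Section GermSpace.
Context {R : realType} (w : weight R).
Local Notation C := (cplx R).

(* The condition on a representative [F], whose values on the closed strip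
   [closure (strip b)] are irrelevant. *)
Definition analytic_off (b lam : R) (F : C -> C) : Prop :=
  [/\ 0 < b, 0 < lam, analytic_on (~` closure (strip b)) F &
    forall r : R, b < r -> (growth_sup w lam (strip2 b r) F < +oo)%E].

Definition prerep_pred : {pred C -> C} :=
  fun F => `[< exists b lam : R, analytic_off b lam F >].

Lemma strip2_subset (b c r s : R) : b <= c -> r <= s ->
  strip2 c r `<=` strip2 b s.
Proof.
move=> bc rs z [zr zc]; split; first exact: strip_subset zr.
by apply: contra_not zc; apply: closure_subset; apply: strip_subset.
Qed.

Lemma analytic_offW (b c l m : R) F : b <= c -> l <= m ->
  analytic_off b l F -> analytic_off c m F.
Proof.
move=> bc lm [b0 l0 aF nF]; split.
- exact: lt_le_trans bc.
- exact: lt_le_trans lm.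
- apply: analytic_onS aF => z; apply: contra_not.
  by apply: closure_subset; apply: strip_subset.
- move=> r cr; apply: (growth_le (ltW l0) lm _ (nF r (le_lt_trans bc cr))).
  exact: strip2_subset.
Qed.

Lemma analytic_off_lin (b l : R) (a : R[i]) F G :
  analytic_off b l F -> analytic_off b l G -> analytic_off b l (a *: F + G).
Proof.
move=> [b0 l0 aF nF] [_ _ aG nG]; split; [exact: b0|exact: l0|exact: analytic_on_lin|].
move=> r br; apply: wsup_lin_lty => [x||]; first exact: expR_ge0.
- exact: nF.
- exact: nG.
Qed.

Lemma prerep_pred_closed : subsemimod_closed prerep_pred.
Proof.
apply: (@GRing.submod_closed_semi _ _ _ _); split=> [|a F G].
  apply/asboolP; exists 1, 1; split; [exact: ltr01|exact: ltr01|exact: analytic_on0|].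
  by move=> *; apply: wsup0_lty.
move=> /asboolP[b [l hF]] /asboolP[c [m hG]]; apply/asboolP.
exists (Num.max b c), (Num.max l m); apply: analytic_off_lin.
  by apply: analytic_offW hF; rewrite le_max lexx.
by apply: analytic_offW hG; rewrite le_max lexx orbT.
Qed.

HB.instance Definition _ :=
  GRing.isSubmodClosed.Build R[i] (C -> C) prerep_pred prerep_pred_closed.

Definition prerep := {F : C -> C | F \in prerep_pred}.
HB.instance Definition _ := SubChoice.on prerep.
HB.instance Definition _ := [SubChoice_isSubLmodule of prerep by <:].

(* Two representatives are identified when their difference vanishes off some
   closed strip. *)
Definition vanish_pred : {pred prerep} :=
  fun F => `[< exists2 c : R, 0 < c &
               forall z, ~ closure (strip c) z -> \val F z = 0 >].

Lemma vanish_pred_closed : subsemimod_closed vanish_pred.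
Proof.
apply: (@GRing.submod_closed_semi _ _ _ _); split=> [|a F G].
  by apply/asboolP; exists 1.
move=> /asboolP[b b0 hF] /asboolP[c c0 hG]; apply/asboolP.
exists (Num.max b c); first by rewrite lt_max b0.
move=> z nz; have [nb nc] : ~ closure (strip b) z /\ ~ closure (strip c) z.
  by split; apply: contra_not nz; apply: closure_subset; apply: strip_subset;
    rewrite le_max lexx ?orbT.
have -> : \val (a *: F + G) z = a *: \val F z + \val G z by [].
by rewrite hF// hG// scaler0 addr0.
Qed.

HB.instance Definition _ :=
  GRing.isSubmodClosed.Build R[i] prerep vanish_pred vanish_pred_closed.

Definition germ_space := Quotient.quot vanish_pred.
HB.instance Definition _ := GRing.Zmodule.on germ_space.

Definition germ (F : prerep) : germ_space := (\pi_(germ_space) F)%qT.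

Lemma germ_eqP F G : germ F = germ G <->
  exists2 c : R, 0 < c & forall z, ~ closure (strip c) z -> \val F z = \val G z.
Proof.
have -> : (germ F = germ G) <-> (F - G \in vanish_pred).
  by rewrite Quotient.idealrBE; split=> /eqP.
split=> [/asboolP[c c0 h]|[c c0 h]]; [|apply/asboolP]; exists c => // z /h/eqP.
  by rewrite subr_eq0 => /eqP.
by move=> /eqP e; apply/eqP; rewrite subr_eq0; apply/eqP.
Qed.

Lemma germ_surj (x : germ_space) : exists F, germ F = x.
Proof. by exists (repr x); rewrite /germ reprK. Qed.

Lemma germB F G : germ (F - G) = germ F - germ G.
Proof. by rewrite /germ !piE. Qed.

Definition germ_scale (a : R[i]) (x : germ_space) : germ_space :=
  germ (a *: repr x).

Lemma germ_scaleE a F : germ_scale a (germ F) = germ (a *: F).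
Proof.
have [G eG] : exists G, G = repr (germ F) by eexists.
have /germ_eqP[c c0 h] : germ G = germ F by rewrite eG /germ reprK.
rewrite /germ_scale -eG; apply/germ_eqP; exists c => // z /h e.
by change (a *: \val G z = a *: \val F z :> C); rewrite e.
Qed.

Lemma germD F G : germ (F + G) = germ F + germ G.
Proof. by rewrite /germ !piE. Qed.

Lemma germ_scaleA a b x : germ_scale a (germ_scale b x) = germ_scale (a * b) x.
Proof. by have [F <-] := germ_surj x; rewrite !germ_scaleE scalerA. Qed.

Lemma germ_scale1 : left_id 1 germ_scale.
Proof. by move=> x; have [F <-] := germ_surj x; rewrite germ_scaleE scale1r. Qed.

Lemma germ_scaleDr : right_distributive germ_scale +%R.
Proof.
move=> a x y; have [F <-] := germ_surj x; have [G <-] := germ_surj y.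
by rewrite -germD !germ_scaleE scalerDr germD.
Qed.

Lemma germ_scaleDl x : {morph germ_scale^~ x : a b / a + b}.
Proof.
by move=> a b; have [F <-] := germ_surj x; rewrite !germ_scaleE scalerDl germD.
Qed.

HB.instance Definition _ := GRing.Zmodule_isLmodule.Build R[i] germ_space
  germ_scaleA germ_scale1 germ_scaleDr germ_scaleDl.

Lemma germZ a F : germ (a *: F) = a *: germ F.
Proof. by rewrite -germ_scaleE. Qed.

(** * The maps of the exact sequence *)

Lemma entire_prerep (P : entire_space w) : \val P \in prerep_pred.
Proof.
case: P => P /= /asboolP[aP [l l0 nP]]; apply/asboolP; exists 1, l.
split; [exact: ltr01|exact: l0|exact: analytic_onS aP|].
move=> r r1; apply: (growth_le (ltW l0) (lexx l) _ (nP r (lt_trans ltr01 r1))).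
by move=> z [].
Qed.

Definition restriction (P : entire_space w) : germ_space :=
  germ (exist _ (\val P) (entire_prerep P)).

Lemma restriction_is_linear : linear restriction.
Proof.
move=> a P Q; rewrite /restriction -germZ -germD; congr germ.
exact: val_inj.
Qed.

HB.instance Definition _ := GRing.isLinear.Build R[i] (entire_space w)
  germ_space *:%R restriction restriction_is_linear.

Definition cintegral (f : R -> C) : C :=
  Complex (\int[lebesgue_measure]_x complex.Re (f x))
          (\int[lebesgue_measure]_x complex.Im (f x)).

(* The integral along the counterclockwise boundary of [strip k]: the lower line
   is run from left to right and the upper one from right to left. *)
Definition strip_contour (k : R) (f : C -> C) : C :=
  cintegral (fun x => f (Complex x (- k))) - cintegral (fun x => f (Complex x k)).

(* The defining formula is imposed for every representative and every contour,
   so it contains the independence of these choices; by the next lemma it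
   determines [bv]. *)
Definition is_boundary_value (bv : germ_space -> dual_space w) : Prop :=
  forall (F : prerep) (b lam k : R), analytic_off b lam (\val F) -> b < k ->
  forall phi : test_space w,
    \val (bv (germ F)) phi = - strip_contour k (fun z => \val F z * \val phi z).

Lemma is_boundary_value_unique (bv bv' : germ_space -> dual_space w) :
  is_boundary_value bv -> is_boundary_value bv' -> bv =1 bv'.
Proof.
move=> h h' x; have [F <-] := germ_surj x.
have /asboolP[b [lam hF]] := valP F.
apply: val_inj; apply/funext => phi.
by rewrite (h F b lam (b + 1))// ?(h' F b lam (b + 1))// ltrDl ltr01.
Qed.

End GermSpace.

(* Exactness of 0 -> A -> B -> C -> 0. *)
Definition short_exact (K : pzRingType) (A B C : lmodType K)
    (f : {linear A -> B}) (g : {linear B -> C}) : Prop :=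
  [/\ injective f, range f = g @^-1` [set 0] & range g = [set: C]].

(* Main.v *)
Require Import Defs.
From HB Require Import structures.
From mathcomp Require Import all_boot all_order all_algebra.
From mathcomp Require Import complex ring lra zify finmap.
From mathcomp Require Import all_classical all_reals all_analysis measurable_realfun.

(** The boundary value map is inverted by a Cauchy transform whose kernel decays.

By (epsilon)_0 there is an entire function [phi], a test function, with
[phi 0 = 1] ([test_function]): it is exp (G(0) - G) for a series G of powers of
1 + z^2/4^j whose real part dominates every w(l x) on every strip. Cutting the
Cauchy kernel off by [phi] gives K_z(zeta) = phi(zeta - z)/(zeta - z)
([cut_kernel]), which has the same pole and residue but decays like a test
function. By (delta) a function of growth e^{w(l x)} times one of decay
e^{-w(m x)}, with m large, is a multiple of (1 + x^2)^-2 ([weight_gain]); so all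
integrals over horizontal lines converge absolutely, lines may be moved within
the domain of holomorphy ([strip_shift]) and Cauchy's formula holds on strips
([strip_cauchy]). In particular bv is well defined and continuous
([boundary_value_exists]).

Restriction is injective: on a wide strip, an entire function of the class that
vanishes off some strip is given by Cauchy's formula with kernel K_z over a
contour on which it is zero ([restriction_inj]).

If bv F = 0, then F is orthogonal on its contours to every K_z with z outside
the contour, because such a K_z is a limit of test functions in each seminorm of
the strip inside: replace 1/u by (1 - e^{isu})/u and let s tend to infinity with
the right sign ([cut_kernel_approx], [null_cut_kernel]). Hence in Cauchy's formula
for F between two contours only the outer one contributes, and its integral
defines the entire extension of F ([null_extends]). Conversely the two lines of a
contour cancel for an entire F ([entire_contour]).

A continuous functional f is bounded by one seminorm, so it extends to the K_z
with z off a strip, and F(z) = f(K_z)/(2 pi i) is the preimage. All that is used of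
the extension is one inequality ([represent]): if a finite combination of kernels
is close to a test function in the seminorm, then the same combination of values of
2 pi i F is close to the value of f. For a difference of difference quotients it
gives holomorphy, for a single kernel the growth, and for the Riemann sums of the
integral of psi(z) K_z over a contour, which tend to - 2 pi i psi, it gives
bv F = f ([represent_contour]). *)

Set Implicit Arguments.
Unset Strict Implicit.
Unset Printing Implicit Defensive.

Import Order.TTheory GRing.Theory Num.Theory.
Import numFieldNormedType.Exports.
Import ComplexField.Normc.

Local Open Scope classical_set_scope.
Local Open Scope ring_scope.

Local Notation Re := (@complex.Re _).
Local Notation Im := (@complex.Im _).

(** * Complex differentiability *)

(** Complex differentiability at a point; locked, because comparing two
    instances by unfolding the filters behind [derivable] is very slow. *)
HB.lock Definition hol (R : realType) (F : cplx R -> cplx R) (z : cplx R) : Prop :=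
  derivable F z 1.

Section Cplx.
Context {R : realType}.
Local Notation C := (cplx R).
Implicit Types (z u : C) (f F : C -> C).

Lemma normc_ge0 z : 0 <= normc z.
Proof. by case: z => ? ?; apply: sqrtr_ge0. Qed.

Lemma normE z : `|z| = (real_complex R (normc z)) :> R[i].
Proof. by []. Qed.

Lemma cReD z u : Re (z + u) = Re z + Re u.
Proof. by case: z u => [? ?] [? ?]. Qed.
Lemma cImD z u : Im (z + u) = Im z + Im u.
Proof. by case: z u => [? ?] [? ?]. Qed.
Lemma cReN z : Re (- z) = - Re z.
Proof. by case: z => [? ?]. Qed.
Lemma cImN z : Im (- z) = - Im z.
Proof. by case: z => [? ?]. Qed.
Lemma cReM z u : Re (z * u) = Re z * Re u - Im z * Im u.
Proof. by case: z u => [? ?] [? ?]. Qed.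
Lemma cImM z u : Im (z * u) = Re z * Im u + Im z * Re u.
Proof. by case: z u => [? ?] [? ?]. Qed.

Lemma normc_Re z : `|Re z| <= normc z.
Proof.
case: z => x y /=; rewrite -sqrtr_sqr ler_sqrt ?sqrr_ge0// ?lerDl ?sqr_ge0//.
by rewrite addr_ge0 ?sqr_ge0.
Qed.

Lemma normc_Im z : `|Im z| <= normc z.
Proof.
case: z => x y /=; rewrite -sqrtr_sqr ler_sqrt ?sqrr_ge0// ?lerDr ?sqr_ge0//.
by rewrite addr_ge0 ?sqr_ge0.
Qed.

Lemma normc_ReIm z : normc z <= `|Re z| + `|Im z|.
Proof.
case: z => x y /=.
rewrite -[leRHS]ger0_norm ?addr_ge0// -sqrtr_sqr ler_sqrt ?sqr_ge0//.
rewrite sqrrD !real_normK ?num_real// lerD2r lerDl.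
by rewrite mulrn_wge0// mulr_ge0.
Qed.

Lemma normc_real (x : R) : normc (Complex x 0) = `|x|.
Proof. by rewrite /= expr0n/= addr0 sqrtr_sqr. Qed.

Lemma normc_gt0 z : (0 < normc z) = (z != 0).
Proof.
rewrite lt_neqAle normc_ge0 andbT eq_sym; congr (~~ _).
by apply/eqP/eqP => [/eq0_normc//|->]; exact: normc0.
Qed.

Lemma normcB z u : normc (z - u) = normc (u - z).
Proof. by rewrite -normcN opprB. Qed.

Lemma ler_normcB z u : normc (z - u) <= normc z + normc u.
Proof. by rewrite (le_trans (le_normcD _ _))// normcN. Qed.

Lemma derivable_eps F z : derivable F z 1 <-> exists d : C,
  forall e : R, 0 < e -> exists2 del : R, 0 < del &
   forall h : C, h != 0 -> normc h < del -> normc ((F (z + h) - F z) / h - d) < e.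
Proof.
rewrite /derivable; split => [/cvg_ex[d hd]|[d hd]].
- exists d => e e0.
  have e0' : 0 < real_complex R e :> R[i] by rewrite ltcR.
  move/cvgrPdist_lt : hd => /(_ _ e0') [/= eps eps0 H].
  have [er er0] : exists er : R, eps = real_complex R er :> R[i].
    by apply/complex_realP; rewrite realE ltW.
  subst eps; rewrite /= ltcR in eps0.
  exists er => // h h0 hlt.
  have := H h; rewrite /ball_/= sub0r normrN normE ltcR => /(_ hlt h0).
  rewrite normE ltcR normcB [h%:A]mulr1 [h + z]addrC.
  rewrite (_ : h^-1 *: (F (z + h) - F z) = (F (z + h) - F z) / h)//.
  by rewrite mulrC.
- apply/cvg_ex; exists d; apply/cvgrPdist_lt => e e0.
  have [er er0] : exists er : R, e = real_complex R er :> R[i].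
    by apply/complex_realP; rewrite realE ltW.
  subst e; rewrite /= ltcR in e0; have [del del0 H] := hd _ e0.
  exists (real_complex R del); first by rewrite /= ltcR.
  move=> h /=; rewrite sub0r normrN normE ltcR => hlt h0.
  rewrite normE ltcR normcB [h%:A]mulr1 [h + z]addrC.
  rewrite (_ : h^-1 *: (F (z + h) - F z) = (F (z + h) - F z) / h)//; first exact: H.
  by rewrite mulrC.
Qed.

Lemma hol_cst (c : C) z : hol (fun=> c : C) z.
Proof. by rewrite hol.unlock; exact: derivable_cst. Qed.

Lemma hol_id z : hol (fun w : C => w) z.
Proof. by rewrite hol.unlock; exact: derivable_id. Qed.

Lemma analytic_onE A F : analytic_on A F <-> forall z, A z -> hol F z.
Proof. by rewrite hol.unlock. Qed.

Lemma holD F G z : hol F z -> hol G z ->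
  hol (fun w => F w + G w) z.
Proof. by rewrite hol.unlock => dF dG; exact: (derivableD dF dG). Qed.

Lemma holB F G z : hol F z -> hol G z ->
  hol (fun w => F w - G w) z.
Proof. by rewrite hol.unlock => dF dG; exact: (derivableB dF dG). Qed.

Lemma holM F G z : hol F z -> hol G z ->
  hol (fun w => F w * G w : C) z.
Proof. by rewrite hol.unlock => dF dG; exact: (derivableM dF dG). Qed.

Lemma holV F z : F z != 0 -> hol F z ->
  hol (fun w => (F w)^-1 : C) z.
Proof.
by rewrite hol.unlock => F0 /derivable1_diffP dF; apply/derivable1_diffP; exact: differentiableV.
Qed.

Lemma hol_comp F G z : hol F z -> hol G (F z) ->
  hol (fun w => G (F w) : C) z.
Proof.
rewrite hol.unlock => /derivable1_diffP dF /derivable1_diffP dG; apply/derivable1_diffP.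
exact: (@differentiable_comp _ _ _ _ F G z dF dG).
Qed.

Lemma hol_sum n (F : nat -> C -> C) z : (forall i, hol (F i) z) ->
  hol (fun w => \sum_(i < n) F i w) z.
Proof.
move=> dF; elim: n => [|n IH].
  have -> : (fun w => \sum_(i < 0) F i w) = (fun=> 0 : C).
    by apply/funext => w; rewrite big_ord0.
  exact: hol_cst.
have -> : (fun w => \sum_(i < n.+1) F i w) = (fun w => \sum_(i < n) F i w + F n w).
  by apply/funext => w; rewrite big_ord_recr.
exact: (holD IH (dF n)).
Qed.

Lemma holX F n z : hol F z -> hol (fun w => F w ^+ n : C) z.
Proof.
move=> dF; elim: n => [|n IH].
  have -> : (fun w => F w ^+ 0 : C) = (fun=> 1 : C).
    by apply/funext => w; rewrite expr0.
  exact: hol_cst.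
have -> : (fun w => F w ^+ n.+1 : C) = (fun w => F w * F w ^+ n).
  by apply/funext => w; rewrite exprS.
exact: holM.
Qed.

Lemma hol_lin_approx F z : hol F z -> exists d : C,
  forall e : R, 0 < e -> exists2 del : R, 0 < del &
   forall w : C, normc (w - z) < del ->
     normc (F w - F z - d * (w - z)) <= e * normc (w - z).
Proof.
rewrite hol.unlock => /derivable_eps[d hd]; exists d => e e0; have [del del0 H] := hd _ e0.
exists del => // w wz; have [->|wzn] := eqVneq w z.
  by rewrite !subrr mulr0 subr0 normc0 mulr0.
have wz0 : w - z != 0 by rewrite subr_eq0.
have := H _ wz0 wz; rewrite (addrC z) subrK => /ltW.
have -> : F w - F z - d * (w - z) = ((F w - F z) / (w - z) - d) * (w - z).
  by rewrite mulrBl divfK.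
by rewrite normcM => le; rewrite ler_wpM2r// normc_ge0.
Qed.

Lemma hol_continuous F z : hol F z ->
  forall e : R, 0 < e -> exists2 del : R, 0 < del &
   forall w : C, normc (w - z) < del -> normc (F w - F z) < e.
Proof.
move=> /hol_lin_approx[d hd] e e0; have [del del0 H] := hd 1 ltr01.
have p : 0 < normc d + 1 by rewrite ltr_wpDl// normc_ge0.
exists (Num.min del (e / (normc d + 1))); first by rewrite lt_min del0 divr_gt0.
move=> w; rewrite lt_min => /andP[/H wz wze].
have -> : F w - F z = (F w - F z - d * (w - z)) + d * (w - z) by rewrite subrK.
apply: (le_lt_trans (le_normcD _ _)); rewrite normcM.
move: wze; rewrite ltr_pdivlMr// => /(le_lt_trans _); apply.
lra.
Qed.

(** Completeness, in a form that needs no sequences: values that are pairwise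
    close up to errors attached to the indices have a common limit. *)
Lemma approx_limit_real (T : Type) (A : set T) (q m : T -> R) : A !=set0 ->
  (forall s t, A s -> A t -> `|q s - q t| <= m s + m t) ->
  exists d, forall s, A s -> `|q s - d| <= m s.
Proof.
move=> [s0 As0] H; pose E := [set q s - m s | s in A].
have ubE t : A t -> ubound E (q t + m t).
  move=> At _ [s As <-]; have := H _ _ As At; rewrite ler_norml => /andP[_].
  lra.
have supE : has_sup E by split; [exists (q s0 - m s0), s0|exists (q s0 + m s0); exact: ubE].
exists (sup E) => s As; rewrite ler_norml.
have h1 : q s - m s <= sup E by apply: (ub_le_sup supE.2); exists s.
have h2 : sup E <= q s + m s by apply: (ge_sup supE.1); exact: ubE.
by apply/andP; split; lra.
Qed.

Lemma approx_limit (T : Type) (A : set T) (q : T -> C) (m : T -> R) : A !=set0 ->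
  (forall s t, A s -> A t -> normc (q s - q t) <= m s + m t) ->
  exists d, forall s, A s -> normc (q s - d) <= 2 * m s.
Proof.
move=> A0 H.
have [s t As At|a ha] := approx_limit_real (q := Re \o q) (m := m) A0.
  apply: le_trans (H _ _ As At); rewrite /= -cReN -cReD; exact: normc_Re.
have [s t As At|b hb] := approx_limit_real (q := Im \o q) (m := m) A0.
  apply: le_trans (H _ _ As At); rewrite /= -cImN -cImD; exact: normc_Im.
exists (Complex a b) => s As; apply: (le_trans (normc_ReIm _)).
rewrite cReD cReN cImD cImN /= mulr2n mulrDl mul1r.
by apply: lerD; [exact: ha|exact: hb].
Qed.

(** Differentiability without a candidate for the derivative, for functions that
    are only known through estimates. *)
Lemma hol_of_quotients F z (r B : R) : 0 < r -> 0 <= B ->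
  (forall h k : C, h != 0 -> k != 0 -> normc h < r -> normc k < r ->
    normc ((F (z + h) - F z) / h - (F (z + k) - F z) / k) <= B * (normc h + normc k)) ->
  hol F z.
Proof.
move=> r0 B0 H; rewrite hol.unlock; apply/derivable_eps.
have [||d hd] := @approx_limit C [set h | h != 0 /\ normc h < r]
   (fun h => (F (z + h) - F z) / h) (fun h => B * normc h).
- exists (Complex (r / 2) 0); split.
    by rewrite eq_complex /= negb_and gt_eqF// divr_gt0.
  by rewrite normc_real ger0_norm; lra.
- by move=> s t [s0 sr] [t0 tr]; rewrite -mulrDr; exact: H.
exists d => e e0; have p : 0 < 2 * B + 1 by lra.
exists (Num.min r (e / (2 * B + 1))); first by rewrite lt_min r0 divr_gt0.
move=> h h0; rewrite lt_min => /andP[hr]; rewrite ltr_pdivlMr// => he.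
apply: le_lt_trans (hd h (conj h0 hr)) _; apply: le_lt_trans he.
have := normc_ge0 h; nra.
Qed.

End Cplx.

(** * Integrals of complex functions of a real variable *)

Section LineIntegrals.
Context {R : realType}.
Local Notation C := (cplx R).
Local Notation mu := (@lebesgue_measure R).
Local Notation meas D := (measurable (D : set (measurableTypeR R))).
Implicit Types (f g : R -> C) (D : set R).

Definition cint D f : C :=
  Complex (\int[mu]_(x in D) Re (f x)) (\int[mu]_(x in D) Im (f x)).

Definition cintegrable D f :=
  mu.-integrable D (EFin \o (fun x => Re (f x))) /\
  mu.-integrable D (EFin \o (fun x => Im (f x))).

Definition pcont f (x : R) := forall e : R, 0 < e -> exists2 del : R, 0 < del &
  forall y, `|y - x| < del -> normc (f y - f x) < e.

Lemma eq_cint D f g : (forall x, D x -> f x = g x) -> cint D f = cint D g.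
Proof.
by move=> fg; congr Complex; apply: eq_Rintegral => x; rewrite inE => /fg ->.
Qed.

Lemma cintegrableD D f g : meas D -> cintegrable D f -> cintegrable D g ->
  cintegrable D (fun x => f x + g x).
Proof.
move=> mD [fR fI] [gR gI]; split.
  have := integrableD mD fR gR; apply: eq_integrable => // x _ /=.
  by rewrite cReD EFinD.
have := integrableD mD fI gI; apply: eq_integrable => // x _ /=.
by rewrite cImD EFinD.
Qed.

Lemma cintegrableZ D (c : C) f : meas D -> cintegrable D f ->
  cintegrable D (fun x => c * f x).
Proof.
move=> mD [fR fI]; split.
  have := integrableB mD (integrableZl mD (Re c) fR) (integrableZl mD (Im c) fI).
  by apply: eq_integrable => // x _ /=; rewrite cReM EFinB !EFinM.
have := integrableD mD (integrableZl mD (Re c) fI) (integrableZl mD (Im c) fR).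
by apply: eq_integrable => // x _ /=; rewrite cImM EFinD !EFinM.
Qed.

Lemma cintegrableS D E f : meas D -> meas E -> E `<=` D ->
  cintegrable D f -> cintegrable E f.
Proof. by move=> mD mE ED [fR fI]; split; [exact: integrableS fR|exact: integrableS fI]. Qed.

Lemma cintD D f g : meas D -> cintegrable D f -> cintegrable D g ->
  cint D (fun x => f x + g x) = cint D f + cint D g.
Proof.
move=> mD [fR fI] [gR gI]; rewrite /cint -[RHS]/(Complex (_ + _) (_ + _)).
by rewrite -!RintegralD//; congr Complex; apply: eq_Rintegral => x _; rewrite ?cReD ?cImD.
Qed.

Lemma cintZ D (c : C) f : meas D -> cintegrable D f ->
  cint D (fun x => c * f x) = c * cint D f.
Proof.
move=> mD [fR fI]; case: c => a b.
rewrite /cint -[RHS]/(Complex (_ - _) (_ + _)).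
have iR r : mu.-integrable D (EFin \o (fun x => r * Re (f x))).
  by have := integrableZl mD r fR; apply: eq_integrable => // x _ /=; rewrite EFinM.
have iI r : mu.-integrable D (EFin \o (fun x => r * Im (f x))).
  by have := integrableZl mD r fI; apply: eq_integrable => // x _ /=; rewrite EFinM.
rewrite -!RintegralZl// -RintegralB// -RintegralD//.
congr Complex; apply: eq_Rintegral => x _; first by rewrite cReM.
by rewrite cImM.
Qed.

Lemma cintegrableN D f : meas D -> cintegrable D f ->
  cintegrable D (fun x => - f x).
Proof.
move=> mD fi; have := cintegrableZ (-1) mD fi.
by congr cintegrable; apply/funext => x; rewrite mulN1r.
Qed.

Lemma cintN D f : meas D -> cintegrable D f ->
  cint D (fun x => - f x) = - cint D f.
Proof.
move=> mD fi; rewrite -mulN1r -cintZ//.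
by apply: eq_cint => x _; rewrite mulN1r.
Qed.

Lemma cintegrableB D f g : meas D -> cintegrable D f -> cintegrable D g ->
  cintegrable D (fun x => f x - g x).
Proof. by move=> mD fi gi; apply: cintegrableD => //; exact: cintegrableN. Qed.

Lemma cintB D f g : meas D -> cintegrable D f -> cintegrable D g ->
  cint D (fun x => f x - g x) = cint D f - cint D g.
Proof.
move=> mD fi gi; rewrite cintD//; last exact: cintegrableN.
by rewrite cintN.
Qed.

Lemma normc_cint D f (g : R -> R) : meas D -> cintegrable D f ->
  mu.-integrable D (EFin \o g) -> (forall x, D x -> normc (f x) <= g x) ->
  normc (cint D f) <= 2 * \int[mu]_(x in D) g x.
Proof.
move=> mD [fR fI] gi fg; apply: (le_trans (normc_ReIm _)).
have H (q : R -> R) : mu.-integrable D (EFin \o q) ->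
    (forall x, D x -> `|q x| <= g x) -> `|\int[mu]_(x in D) q x| <= \int[mu]_(x in D) g x.
  move=> qi qg; apply: le_trans (le_normr_Rintegral mD qi) _.
  apply: le_Rintegral => //.
  exact: (integrable_norm qi).
rewrite mulr2n mulrDl mul1r; apply: lerD; apply: H => // x Dx.
  exact: le_trans (normc_Re _) (fg _ Dx).
exact: le_trans (normc_Im _) (fg _ Dx).
Qed.

Lemma pcont_continuous f (p : C -> R) (x : R) :
  (forall z w, `|p z - p w| <= normc (z - w)) -> pcont f x ->
  {for x, continuous (fun y : R => p (f y))}.
Proof.
move=> pl cf; apply/cvgrPdist_lt => e e0; have [del del0 h] := cf _ e0.
apply/nbhs_normP; exists del => // y /= yx.
by apply: le_lt_trans (pl _ _) _; rewrite normcB; apply: h; rewrite distrC.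
Qed.

Lemma pcont_integrable (a b : R) f : (forall x, a <= x <= b -> pcont f x) ->
  cintegrable `[a, b] f.
Proof.
move=> cf; have H (p : C -> R) : (forall z w, `|p z - p w| <= normc (z - w)) ->
    mu.-integrable `[a, b] (EFin \o (fun x => p (f x))).
  move=> pl; apply: continuous_compact_integrable; first exact: segment_compact.
  apply: continuous_in_subspaceT => x; rewrite inE/= in_itv/= => xab.
  exact: (pcont_continuous pl (cf _ xab)).
split; apply: H => z w.
  by rewrite -cReN -cReD normc_Re.
by rewrite -cImN -cImD normc_Im.
Qed.

Lemma cint_bound (a b M : R) f : a <= b -> (forall x, a <= x <= b -> pcont f x) ->
  (forall x, a <= x <= b -> normc (f x) <= M) ->
  normc (cint `[a, b] f) <= 2 * (M * (b - a)).
Proof.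
move=> ab cf fM; have mab : measurable (`[a, b]%classic : set (measurableTypeR R)) by exact: measurable_itv.
apply: le_trans (@normc_cint _ _ (fun=> M) mab (pcont_integrable cf) _ _) _.
- by apply: continuous_compact_integrable; [exact: segment_compact|move=> ?; exact: cvg_cst].
- by move=> x /=; rewrite in_itv/=; exact: fM.
have mE : fine (mu `[a, b]) = b - a.
  rewrite lebesgue_measure_itv/= lte_fin.
  by move: ab; rewrite le_eqVlt => /predU1P[->|ltab]; rewrite ?ltxx ?ltab//= subrr.
by rewrite Rintegral_cst// mE.
Qed.

Lemma cint_point (a : R) f : cint `[a, a] f = 0.
Proof. by rewrite /cint set_itv1 !Rintegral_set1. Qed.

Lemma cint_split (a b c : R) f : a <= b -> b <= c -> cintegrable `[a, c] f ->
  cint `[a, c] f = cint `[a, b] f + cint `[b, c] f.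
Proof.
move=> ab bc [fR fI]; rewrite /cint -[RHS]/(Complex (_ + _) (_ + _)).
have H (q : R -> R) : mu.-integrable `[a, c] (EFin \o q) ->
    \int[mu]_(x in `[a, c]) q x = \int[mu]_(x in `[a, b]) q x + \int[mu]_(x in `[b, c]) q x.
  move=> qi; have := @Rintegral_itvB _ q (BLeft a) (BRight c) b qi.
  rewrite !bnd_simp => /(_ ab bc) /eqP; rewrite subr_eq => /eqP ->.
  rewrite addrC Rintegral_itv_obnd_cbnd//.
  by apply: integrableS qi => //; apply: subset_itvr; rewrite bnd_simp.
by rewrite !H.
Qed.

Lemma integrable_oneDsqrV : mu.-integrable setT (EFin \o (fun x : R => (1 + x ^+ 2)^-1)).
Proof.
apply/integrableP; split.
  apply/measurable_EFinP; apply: continuous_measurable_fun.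
  exact: continuous_oneDsqrV.
under eq_integral => x _ do rewrite /= ger0_norm ?invr_ge0 ?addr_ge0 ?sqr_ge0//.
rewrite (@ge0_symfun_integralT _ (fun x : R => (1 + x ^+ 2)^-1)).
- rewrite (_ : [set x | _] = `[0, +oo[%classic); last first.
    by apply/seteqP; split => x/=; rewrite in_itv/= andbT.
  by rewrite integral0y_oneDsqr -EFinM ltry.
- by move=> x; rewrite invr_ge0 addr_ge0 ?sqr_ge0.
- exact: continuous_oneDsqrV.
- by move=> x /=; rewrite sqrrN.
Qed.

Lemma cintegrable_dominated (f : R -> C) (B : R) :
  (forall x, pcont f x) -> (forall x, normc (f x) <= B * (1 + x ^+ 2)^-1) ->
  cintegrable setT f.
Proof.
move=> cf fB; have H (p : C -> R) : (forall z w, `|p z - p w| <= normc (z - w)) ->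
    (forall z, `|p z| <= normc z) ->
    mu.-integrable setT (EFin \o (fun x => p (f x))).
  move=> pl pn; have mT := @measurableT _ (measurableTypeR R).
  have := @integrableZl _ _ _ mu _ mT B _ integrable_oneDsqrV.
  apply: le_integrable => //.
    apply/measurable_EFinP; apply: continuous_measurable_fun.
    by move=> x; exact: (pcont_continuous pl (cf x)).
  move=> x _ /=; rewrite lee_fin; apply: le_trans (pn _) _.
  by apply: le_trans (fB x) _; rewrite ler_norm.
split; apply: H => z //.
- by move=> w; rewrite -cReN -cReD normc_Re.
- exact: normc_Re.
- by move=> w; rewrite -cImN -cImD normc_Im.
- exact: normc_Im.
Qed.

Definition inv_sqr_int : R := \int[mu]_x (1 + x ^+ 2)^-1.

(** Beyond [n] one of the two factors 1/(1 + x^2) is at most 1/(1 + n^2), and the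
    other one is integrable. *)
Lemma cint_tail (f : R -> C) (B n : R) : 0 <= n ->
  (forall x, pcont f x) -> (forall x, normc (f x) <= B * ((1 + x ^+ 2)^-1) ^+ 2) ->
  normc (cint setT f - cint `[- n, n] f) <= 2 * (B * inv_sqr_int / (1 + n ^+ 2)).
Proof.
move=> n0 cf fB.
have p2 x : 0 < (1 + x ^+ 2 : R) by rewrite ltr_pwDl ?sqr_ge0.
have B0 : 0 <= B.
  by have := le_trans (normc_ge0 _) (fB 0); rewrite expr0n addr0 invr1 expr1n mulr1.
have mT := @measurableT _ (measurableTypeR R).
have fi : cintegrable setT f.
  apply: (cintegrable_dominated (B := B)) => // x; apply: le_trans (fB x) _.
  rewrite ler_wpM2l// expr2 -[leRHS]mulr1 ler_wpM2l ?invr_ge0 ?(ltW (p2 _))//.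
  by rewrite invf_le1// lerDl sqr_ge0.
pose g (x : R) := if x \in `[- n, n] then 0 else f x.
have mn : measurable (`[- n, n]%classic : set (measurableTypeR R)) by exact: measurable_itv.
have fni := cintegrableS mT mn (@subsetT _ _) fi.
have gE : cint setT f - cint `[- n, n] f = cint (~` `[- n, n]) f.
  have mC := measurableC mn; have [fR fI] := fi.
  rewrite /cint -[LHS]/(Complex (_ - _) (_ - _)).
  have H (q : R -> R) : mu.-integrable setT (EFin \o q) ->
    \int[mu]_x q x - \int[mu]_(x in `[- n, n]) q x = \int[mu]_(x in ~` `[- n, n]) q x.
    move=> qi; rewrite -(setUv `[- n, n]) Rintegral_setU//.
    - by rewrite addrC addKr.
    - by rewrite setUv.
    - by apply/disj_setPS => x [].
  by rewrite !H.
have p1 : 0 < 1 + n ^+ 2 by [].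
have ci : mu.-integrable setT (EFin \o (fun x : R => (B / (1 + n ^+ 2)) * (1 + x ^+ 2)^-1)).
  have := @integrableZl _ _ _ mu _ mT (B / (1 + n ^+ 2)) _ integrable_oneDsqrV.
  by apply: eq_integrable => // x _ /=; rewrite EFinM.
have mC := measurableC mn.
rewrite gE; apply: le_trans (@normc_cint _ _ (fun x => (B / (1 + n ^+ 2)) * (1 + x ^+ 2)^-1) mC _ _ _) _.
- exact: cintegrableS fi.
- exact: integrableS ci.
- move=> x /= /negP; rewrite in_itv/= => xn; apply: le_trans (fB x) _.
  rewrite -mulrA ler_wpM2l// expr2 ler_wpM2r ?invr_ge0 ?(ltW (p2 _))//.
  rewrite lef_pV2 ?posrE// lerD2l -[leRHS]real_normK ?num_real// lerXn2r ?nnegrE//.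
  by rewrite leNgt; apply/negP => xn'; move: xn; rewrite -ler_norml (ltW xn').
rewrite ler_wpM2l// [leRHS]mulrAC /inv_sqr_int -RintegralZl//; last exact: integrable_oneDsqrV.
rewrite /Rintegral; apply: fine_le; [|exact: integrable_fin_num|].
  by apply: integrable_fin_num => //; exact: integrableS ci.
apply: ge0_subset_integral => //; first by case/integrableP : ci.
by move=> x _; rewrite lee_fin mulr_ge0 ?divr_ge0 ?invr_ge0 ?(ltW (p2 _)).
Qed.

End LineIntegrals.

(** * Goursat's lemma *)

Section Rectangles.
Context {R : realType}.
Local Notation C := (cplx R).
Local Notation mu := (@lebesgue_measure R).
Implicit Types (F G : C -> C) (a b c d : R).

Definition ccont F (z : C) := forall e : R, 0 < e -> exists2 del : R, 0 < del &
  forall w : C, normc (w - z) < del -> normc (F w - F z) < e.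

Lemma pcont_h F (x y : R) : ccont F (Complex x y) -> pcont (fun t => F (Complex t y)) x.
Proof.
move=> cF e e0; have [del del0 h] := cF e e0; exists del => // t tx; apply: h.
rewrite (_ : _ - _ = Complex (t - x) 0) ?normc_real//.
by congr Complex; rewrite subrr.
Qed.

Lemma pcont_v F (x y : R) : ccont F (Complex x y) -> pcont (fun t => F (Complex x t)) y.
Proof.
move=> cF e e0; have [del del0 h] := cF e e0; exists del => // t tx; apply: h.
apply: le_lt_trans (normc_ReIm _) _; rewrite cReD cReN cImD cImN /= subrr normr0 add0r.
exact: tx.
Qed.

(** The integral of [F] along the counterclockwise boundary of the rectangle
    [a, b] x [c, d]. *)
Definition rint F a b c d : C :=
  cint `[a, b] (fun t => F (Complex t c)) - cint `[a, b] (fun t => F (Complex t d))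
  + 'i%C * (cint `[c, d] (fun t => F (Complex b t)) - cint `[c, d] (fun t => F (Complex a t))).

Definition inrect a b c d (z : C) := (a <= Re z <= b) && (c <= Im z <= d).

Lemma inrect_sub a b c d a' b' c' d' z : inrect a' b' c' d' z ->
  a <= a' -> b' <= b -> c <= c' -> d' <= d -> inrect a b c d z.
Proof.
move=> /andP[/andP[z1 z2] /andP[z3 z4]] h1 h2 h3 h4; rewrite /inrect.
by rewrite (le_trans h1 z1) (le_trans z2 h2) (le_trans h3 z3) (le_trans z4 h4).
Qed.

Lemma itv_dist a b x y : a <= x <= b -> a <= y <= b -> `|x - y| <= b - a.
Proof. by move=> /andP[? ?] /andP[? ?]; rewrite ler_norml; apply/andP; split; lra. Qed.

Lemma cont_hside F a b y : (forall z : C, a <= Re z <= b -> Im z = y -> ccont F z) ->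
  forall x, a <= x <= b -> pcont (fun t => F (Complex t y)) x.
Proof. by move=> cF x xab; apply: pcont_h; apply: cF. Qed.

Lemma cont_vside F c d x : (forall z : C, c <= Im z <= d -> Re z = x -> ccont F z) ->
  forall y, c <= y <= d -> pcont (fun t => F (Complex x t)) y.
Proof. by move=> cF y ycd; apply: pcont_v; apply: cF. Qed.

Lemma rint_splitx F a m b c d : a <= m <= b ->
  (forall z : C, a <= Re z <= b -> Im z = c -> ccont F z) ->
  (forall z : C, a <= Re z <= b -> Im z = d -> ccont F z) ->
  rint F a b c d = rint F a m c d + rint F m b c d.
Proof.
move=> /andP[am mb] cc cd; rewrite /rint.
rewrite (cint_split am mb (pcont_integrable (cont_hside cc))).
rewrite (cint_split am mb (pcont_integrable (cont_hside cd))).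
ring.
Qed.

Lemma rint_splity F a b c m d : c <= m <= d ->
  (forall z : C, c <= Im z <= d -> Re z = a -> ccont F z) ->
  (forall z : C, c <= Im z <= d -> Re z = b -> ccont F z) ->
  rint F a b c d = rint F a b c m + rint F a b m d.
Proof.
move=> /andP[cm md] ca cb; rewrite /rint.
rewrite (cint_split cm md (pcont_integrable (cont_vside ca))).
rewrite (cint_split cm md (pcont_integrable (cont_vside cb))).
ring.
Qed.

Section OnRect.
Variables (a b c d : R).
Hypotheses (ab : a <= b) (cd : c <= d).

Definition bdry (z : C) := inrect a b c d z && [|| Re z == a, Re z == b, Im z == c | Im z == d].

Lemma bdry_b x : a <= x <= b -> bdry (Complex x c).
Proof. by move=> h; rewrite /bdry /inrect /= h lexx cd eqxx !orbT. Qed.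
Lemma bdry_t x : a <= x <= b -> bdry (Complex x d).
Proof. by move=> h; rewrite /bdry /inrect /= h lexx cd eqxx !orbT. Qed.
Lemma bdry_l y : c <= y <= d -> bdry (Complex a y).
Proof. by move=> h; rewrite /bdry /inrect /= h lexx ab eqxx. Qed.
Lemma bdry_r y : c <= y <= d -> bdry (Complex b y).
Proof. by move=> h; rewrite /bdry /inrect /= h lexx ab eqxx !orbT. Qed.

Lemma side_int F : (forall z, bdry z -> ccont F z) ->
  [/\ cintegrable `[a, b] (fun t => F (Complex t c)),
      cintegrable `[a, b] (fun t => F (Complex t d)),
      cintegrable `[c, d] (fun t => F (Complex a t)) &
      cintegrable `[c, d] (fun t => F (Complex b t))].
Proof.
move=> cF; split; apply: pcont_integrable => x xab.
- by apply: pcont_h; apply: cF; exact: bdry_b.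
- by apply: pcont_h; apply: cF; exact: bdry_t.
- by apply: pcont_v; apply: cF; exact: bdry_l.
- by apply: pcont_v; apply: cF; exact: bdry_r.
Qed.

Lemma rint_bound F M : (forall z, bdry z -> ccont F z) ->
  (forall z, bdry z -> normc (F z) <= M) ->
  normc (rint F a b c d) <= 4 * M * ((b - a) + (d - c)).
Proof.
move=> cF FM.
have [h1 h2] : normc (cint `[a, b] (fun t => F (Complex t c))) <= 2 * (M * (b - a)) /\
  normc (cint `[a, b] (fun t => F (Complex t d))) <= 2 * (M * (b - a)).
  split; apply: cint_bound => // x xab.
  - by apply: pcont_h; apply: cF; exact: bdry_b.
  - by apply: FM; exact: bdry_b.
  - by apply: pcont_h; apply: cF; exact: bdry_t.
  - by apply: FM; exact: bdry_t.
have [h3 h4] : normc (cint `[c, d] (fun t => F (Complex a t))) <= 2 * (M * (d - c)) /\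
  normc (cint `[c, d] (fun t => F (Complex b t))) <= 2 * (M * (d - c)).
  split; apply: cint_bound => // x xab.
  - by apply: pcont_v; apply: cF; exact: bdry_l.
  - by apply: FM; exact: bdry_l.
  - by apply: pcont_v; apply: cF; exact: bdry_r.
  - by apply: FM; exact: bdry_r.
rewrite /rint; apply: le_trans (le_normcD _ _) _; rewrite normcM.
have -> : normc ('i%C : C) = 1 by rewrite /= expr0n/= expr1n add0r sqrtr1.
rewrite mul1r; have := ler_normcB (cint `[a, b] (fun t => F (Complex t c))) (cint `[a, b] (fun t => F (Complex t d))).
have := ler_normcB (cint `[c, d] (fun t => F (Complex b t))) (cint `[c, d] (fun t => F (Complex a t))).
lra.
Qed.

Lemma rintZ F (k : C) : (forall z, bdry z -> ccont F z) ->
  rint (fun z => k * F z) a b c d = k * rint F a b c d.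
Proof.
move=> /side_int[h1 h2 h3 h4]; rewrite /rint !cintZ//; try exact: measurable_itv.
ring.
Qed.

Lemma rintD F G : (forall z, bdry z -> ccont F z) -> (forall z, bdry z -> ccont G z) ->
  rint (fun z => F z + G z) a b c d = rint F a b c d + rint G a b c d.
Proof.
move=> /side_int[h1 h2 h3 h4] /side_int[g1 g2 g3 g4].
rewrite /rint !cintD//; try exact: measurable_itv.
ring.
Qed.

Lemma rintB F G : (forall z, bdry z -> ccont F z) -> (forall z, bdry z -> ccont G z) ->
  rint (fun z => F z - G z) a b c d = rint F a b c d - rint G a b c d.
Proof.
move=> /side_int[h1 h2 h3 h4] /side_int[g1 g2 g3 g4].
rewrite /rint !cintB//; try exact: measurable_itv.
ring.
Qed.

Lemma eq_rint F G : (forall z, bdry z -> F z = G z) -> rint F a b c d = rint G a b c d.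
Proof.
move=> FG; rewrite /rint; congr (_ - _ + _ * (_ - _)); apply: eq_cint => x;
  rewrite /= in_itv/= => h; apply: FG.
- exact: bdry_b.
- exact: bdry_t.
- exact: bdry_r.
- exact: bdry_l.
Qed.

End OnRect.

Lemma cint_cst a b (k : C) : a <= b -> cint `[a, b] (fun=> k) = k * Complex (b - a) 0.
Proof.
move=> ab; have mE : fine (mu `[a, b]) = b - a.
  rewrite lebesgue_measure_itv/= lte_fin.
  by move: ab; rewrite le_eqVlt => /predU1P[->|ltab]; rewrite ?ltxx ?ltab//= subrr.
have mab : measurable (`[a, b]%classic : set (measurableTypeR R)) by exact: measurable_itv.
rewrite /cint !Rintegral_cst// mE; case: k => x y.
by rewrite -[RHS]/(Complex (_ - _) (_ + _)) /= !mulr0 subr0 add0r.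
Qed.

Lemma rint_affine F a b c d (z0 k l : C) : a <= b -> c <= d ->
  (forall z, F z = k + l * (z - z0)) -> rint F a b c d = 0.
Proof.
move=> ab cd FE.
have cF z : ccont F z.
  apply: hol_continuous.
  have -> : F = (fun w => k + l * (w - z0)) by apply/funext.
  apply: holD; first exact: hol_cst.
  apply: holM; first exact: hol_cst.
  by apply: holB; [exact: hol_id|exact: hol_cst].
have [h1 h2 h3 h4] := side_int ab cd (fun z _ => cF z).
rewrite /rint -!cintB//; try exact: measurable_itv.
rewrite (@eq_cint _ _ _ (fun=> l * Complex 0 (c - d))); last first.
  move=> x _; rewrite !FE.
  rewrite (_ : Complex 0 (c - d) = Complex x c - Complex x d) ?[LHS]/=; last first.
    by congr Complex; rewrite /= subrr.
  ring.
rewrite (@eq_cint _ `[c, d] _ (fun=> l * Complex (b - a) 0)); last first.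
  move=> x _; rewrite !FE.
  rewrite (_ : Complex (b - a) 0 = Complex b x - Complex a x); last first.
    by congr Complex; rewrite /= subrr.
  ring.
rewrite !cint_cst//.
have -> : Complex 0 (c - d) = - 'i%C * Complex (d - c) 0 :> C.
  by apply/eqP; rewrite eq_complex /=; apply/andP; split; apply/eqP; ring.
ring.
Qed.

Lemma nested_point (a b : nat -> R) : (forall n, a n <= a n.+1) ->
  (forall n, b n.+1 <= b n) -> (forall n, a n <= b n) ->
  exists p, forall n, a n <= p <= b n.
Proof.
move=> ai bd ab.
have am n m : (n <= m)%N -> a n <= a m.
  by move=> /subnK <-; elim: (m - n)%N => // k IH; rewrite addSn (le_trans IH).
have bm n m : (n <= m)%N -> b m <= b n.
  by move=> /subnK <-; elim: (m - n)%N => // k IH; rewrite addSn (le_trans _ IH).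
have abm n m : a n <= b m.
  have [nm|/ltnW mn] := leqP n m; first exact: le_trans (am _ _ nm) (ab _).
  exact: le_trans (ab _) (bm _ _ mn).
pose E := range a; have ubE m : ubound E (b m) by move=> _ [n _ <-]; exact: abm.
have supE : has_sup E by split; [exists (a 0%N), 0%N|exists (b 0%N); exact: ubE].
exists (sup E) => n; rewrite (ub_le_sup supE.2)/=; last by exists n.
by apply: (ge_sup supE.1); exact: ubE.
Qed.

Section Goursat.
Variable F : C -> C.

Let q := (R * R * R * R)%type.
Let J (x : q) := let: (a, b, c, d) := x in normc (rint F a b c d).
(* [hx] bisects the rectangle in the first coordinate and keeps a half that carries
   at least half of the integral; [hy] does so in the second one. *)
Let hx (x : q) : q := let: (a, b, c, d) := x in let m := (a + b) / 2 in
  if J x <= 2 * J (a, m, c, d) then (a, m, c, d) else (m, b, c, d).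
Let hy (x : q) : q := let: (a, b, c, d) := x in let m := (c + d) / 2 in
  if J x <= 2 * J (a, b, c, m) then (a, b, c, m) else (a, b, m, d).

Definition ccont_on a b c d := forall z, inrect a b c d z -> ccont F z.

Let hxP a b c d : a <= b -> c <= d -> ccont_on a b c d ->
  exists a' b', [/\ hx (a, b, c, d) = (a', b', c, d), a <= a' <= b', b' <= b,
    b' - a' = (b - a) / 2 & J (a, b, c, d) <= 2 * J (a', b', c, d)].
Proof.
move=> ab cd cF; rewrite /hx; set m := (a + b) / 2.
have am : a <= m by rewrite /m; lra.
have mb : m <= b by rewrite /m; lra.
case: ifPn => [le|]; first by exists a, m; split => //; rewrite ?lexx ?am// /m; lra.
rewrite -ltNge => lt; exists m, b; split => //; rewrite ?am ?lexx//; first by rewrite /m; lra.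
have := @rint_splitx F a m b c d; rewrite am mb => /(_ isT) H.
move: lt; rewrite /J H; last 2 first.
- by move=> z zab zc; apply: cF; rewrite /inrect zab zc lexx cd.
- by move=> z zab zc; apply: cF; rewrite /inrect zab zc lexx cd.
have := le_normcD (rint F a m c d) (rint F m b c d); lra.
Qed.

Let hyP a b c d : a <= b -> c <= d -> ccont_on a b c d ->
  exists c' d', [/\ hy (a, b, c, d) = (a, b, c', d'), c <= c' <= d', d' <= d,
    d' - c' = (d - c) / 2 & J (a, b, c, d) <= 2 * J (a, b, c', d')].
Proof.
move=> ab cd cF; rewrite /hy; set m := (c + d) / 2.
have am : c <= m by rewrite /m; lra.
have mb : m <= d by rewrite /m; lra.
case: ifPn => [le|]; first by exists c, m; split => //; rewrite ?lexx ?am// /m; lra.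
rewrite -ltNge => lt; exists m, d; split => //; rewrite ?am ?lexx//; first by rewrite /m; lra.
have := @rint_splity F a b c m d; rewrite am mb => /(_ isT) H.
move: lt; rewrite /J H; last 2 first.
- by move=> z zab zc; apply: cF; rewrite /inrect zab zc lexx ab.
- by move=> z zab zc; apply: cF; rewrite /inrect zab zc lexx ab.
have := le_normcD (rint F a b c m) (rint F a b m d); lra.
Qed.

(** Goursat's lemma: only differentiability at each point is assumed, so the
    rectangle is bisected down to a point where [F] is nearly affine. *)
Lemma goursat a b c d : a <= b -> c <= d ->
  (forall z, inrect a b c d z -> hol F z) -> rint F a b c d = 0.
Proof.
move=> ab cd hF.
have cF : ccont_on a b c d by move=> z /hF; exact: hol_continuous.
pose Q n := iter n (hy \o hx) (a, b, c, d).
pose qa n := (Q n).1.1.1; pose qb n := (Q n).1.1.2.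
pose qc n := (Q n).1.2; pose qd n := (Q n).2.
have QE n : Q n = (qa n, qb n, qc n, qd n) by rewrite /qa /qb /qc /qd; case: (Q n) => [[[]]].
have inv n : [/\ a <= qa n <= qb n, qb n <= b, c <= qc n <= qd n & qd n <= d] /\
   [/\ qb n - qa n = (b - a) / 2 ^+ n, qd n - qc n = (d - c) / 2 ^+ n &
    J (a, b, c, d) <= 4 ^+ n * J (Q n)] /\
   [/\ qa n <= qa n.+1, qb n.+1 <= qb n, qc n <= qc n.+1 & qd n.+1 <= qd n].
  have step k : [/\ a <= qa k <= qb k, qb k <= b, c <= qc k <= qd k & qd k <= d] ->
    [/\ qa k <= qa k.+1 <= qb k.+1, qb k.+1 <= qb k, qc k <= qc k.+1 <= qd k.+1 & qd k.+1 <= qd k]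
    /\ [/\ qb k.+1 - qa k.+1 = (qb k - qa k) / 2, qd k.+1 - qc k.+1 = (qd k - qc k) / 2 &
        J (Q k) <= 4 * J (Q k.+1)].
    move=> [/andP[h1 h2] h3 /andP[h4 h5] h6].
    have cFk : ccont_on (qa k) (qb k) (qc k) (qd k).
      by move=> z zr; apply: cF; exact: (inrect_sub zr).
    have [a' [b' [e1 /andP[e2 e2'] e3 e4 e5]]] := hxP h2 h5 cFk.
    have cFk' : ccont_on a' b' (qc k) (qd k).
      by move=> z zr; apply: cFk; exact: (inrect_sub zr).
    have [c' [d' [g1 /andP[g2 g2'] g3 g4 g5]]] := hyP e2' h5 cFk'.
    have QS : Q k.+1 = (a', b', c', d') by rewrite /Q iterS -/(Q k) /= QE e1 g1.
    have t3 : J (Q k) <= 4 * J (Q k.+1).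
      rewrite QE QS; move: e5 g5; move: (J _) (J _) (J _) => u v w; lra.
    have [Ea Eb Ec Ed] : [/\ qa k.+1 = a', qb k.+1 = b', qc k.+1 = c' & qd k.+1 = d'].
      by rewrite /qa /qb /qc /qd QS.
    rewrite Ea Eb Ec Ed; split; split => //; by apply/andP; split.
  elim: n => [|n [[h1 h2 h3 h4] [[l1 l2 l3] _]]].
    have i0 : [/\ a <= qa 0 <= qb 0, qb 0 <= b, c <= qc 0 <= qd 0 & qd 0 <= d].
      by rewrite /qa /qb /qc /qd /=; split; rewrite ?lexx ?ab ?cd.
    have [[/andP[s1 _] s2 /andP[s3 _] s4] _] := step _ i0.
    split; first exact: i0.
    split; last by split.
    split; first by rewrite expr0 divr1.
      by rewrite expr0 divr1.
    by rewrite expr0 mul1r.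
  have [[/andP[s1 s1'] s2 /andP[s3 s3'] s4] [t1 t2 t3]] := step _ (And4 h1 h2 h3 h4).
  have i1 : [/\ a <= qa n.+1 <= qb n.+1, qb n.+1 <= b, c <= qc n.+1 <= qd n.+1 & qd n.+1 <= d].
    move/andP: h1 => [h1 _]; move/andP: h3 => [h3 _]; split; rewrite ?s1' ?s3' ?andbT.
    - exact: le_trans h1 s1.
    - exact: le_trans s2 h2.
    - exact: le_trans h3 s3.
    - exact: le_trans s4 h4.
  have [[/andP[r1 _] r2 /andP[r3 _] r4] _] := step _ i1.
  split; first exact: i1.
  split; split => //.
  - by rewrite t1 l1 exprS invfM; ring.
  - by rewrite t2 l2 exprS invfM; ring.
  - apply: (le_trans l3); rewrite exprSr -mulrA ler_wpM2l ?exprn_ge0//.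
have [p1 hp1] : exists p, forall n, qa n <= p <= qb n.
  by apply: nested_point => n; have [[/andP[_ h1] h2 h3 h4] [_ [s1 s2 s3 s4]]] := inv n.
have [p2 hp2] : exists p, forall n, qc n <= p <= qd n.
  by apply: nested_point => n; have [[h1 h2 /andP[_ h3] h4] [_ [s1 s2 s3 s4]]] := inv n.
have hp : hol F (Complex p1 p2).
  apply: hF; rewrite /inrect /=; have := hp1 0%N; have := hp2 0%N.
  by rewrite /qa /qb /qc /qd /= => -> ->.
have [l hl] := hol_lin_approx hp.
pose L := (b - a) + (d - c); have L0 : 0 <= L by rewrite /L; lra.
apply/eqP; rewrite -[_ == _]negbK -normc_gt0 -leNgt; apply/ler_addgt0Pr => e e0; rewrite add0r.
pose eps := e / (4 * L ^+ 2 + 1).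
have den : 0 < 4 * L ^+ 2 + 1 by have := sqr_ge0 L; lra.
have eps0 : 0 < eps by rewrite divr_gt0.
have [del del0 hdel] := hl _ eps0.
have [n hn] : exists n, L / 2 ^+ n < del.
  have q0 : 0 <= L / del by rewrite divr_ge0// ltW.
  exists (Num.bound (L / del)); set n := Num.bound _.
  rewrite ltr_pdivrMr ?exprn_gt0// mulrC -ltr_pdivrMr//.
  apply: lt_le_trans (archi_boundP q0) _.
  by rewrite -natrX ler_nat ltnW// ltn_expl.
have [[/andP[i1 i2] i3 /andP[i4 i5] i6] [[i7 i8 i9] _]] := inv n.
apply: le_trans i9 _; rewrite QE /J.
pose r (z : C) : C := F z - F (Complex p1 p2) - l * (z - Complex p1 p2).
pose A (z : C) : C := F (Complex p1 p2) + l * (z - Complex p1 p2).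
have cFn z : bdry (qa n) (qb n) (qc n) (qd n) z -> ccont F z.
  by move=> /andP[zr _]; apply: cF; exact: (inrect_sub zr).
have hA z : hol A z.
  apply: holD; first exact: hol_cst.
  apply: holM; first exact: hol_cst.
  by apply: holB; [exact: hol_id|exact: hol_cst].
have cA z : ccont A z by apply: hol_continuous; exact: hA.
have rE : rint F (qa n) (qb n) (qc n) (qd n) = rint r (qa n) (qb n) (qc n) (qd n).
  have -> : r = (fun z => F z - A z) by apply/funext => z; rewrite /r /A opprD addrA.
  rewrite rintB//.
  by rewrite (@rint_affine A _ _ _ _ (Complex p1 p2) (F (Complex p1 p2)) l)// subr0.
have small z : bdry (qa n) (qb n) (qc n) (qd n) z -> normc (z - Complex p1 p2) <= L / 2 ^+ n.
  move=> /andP[/andP[/andP[z1 z2] /andP[z3 z4]] _].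
  apply: le_trans (normc_ReIm _) _; rewrite cReD cReN cImD cImN /=.
  have -> : L / 2 ^+ n = (qb n - qa n) + (qd n - qc n) by rewrite i7 i8 -mulrDl.
  by apply: lerD; apply: itv_dist => //; apply/andP.
rewrite rE; apply: le_trans (@ler_wpM2l _ (4 ^+ n) _ _ _ (rint_bound i2 i5 (M := eps * (L / 2 ^+ n)) _ _)) _.
- by rewrite exprn_ge0.
- move=> z zb.
  have -> : r = (fun z => F z - A z) by apply/funext => w; rewrite /r /A opprD addrA.
  apply: hol_continuous; apply: (@holB _ F A) => //; apply: hF.
  by move: zb => /andP[zr _]; exact: (inrect_sub zr).
- move=> z zb; apply: le_trans (hdel _ (le_lt_trans (small _ zb) hn)) _.
  by rewrite ler_pM2l// small.
rewrite i7 i8 -mulrDl -/L.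
have -> : 4 ^+ n = 2 ^+ n * 2 ^+ n :> R by rewrite -exprMn -natrM.
have u : 2 ^+ n != 0 :> R by rewrite expf_neq0.
have -> : 2 ^+ n * 2 ^+ n * (4 * (eps * (L / 2 ^+ n)) * (L / 2 ^+ n)) = eps * (4 * L ^+ 2).
  by field.
rewrite /eps mulrAC ler_pdivrMr// ler_wpM2l ?(ltW e0)//; lra.
Qed.

End Goursat.
End Rectangles.

(** * Cauchy's formula for rectangles *)

Section Cauchy.
Context {R : realType}.
Local Notation C := (cplx R).
Local Notation mu := (@lebesgue_measure R).
Implicit Types (F G : C -> C) (a b c d : R).

Local Ltac on_cut side :=
  let z := fresh in let h1 := fresh in let h1' := fresh in let h2 := fresh in
  move=> z /andP[h1 h1'] h2; apply: side; rewrite ?h2 ?eqxx ?orbT//; apply/andP; split; lra.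

(** The inner rectangle is reached by four cuts, each of which splits off a rectangle
    on which Goursat's lemma applies. *)
Lemma rint_shrink F a a' b' b c c' d' d : a <= a' <= b' -> b' <= b ->
  c <= c' <= d' -> d' <= d ->
  (forall z : C, inrect a b c d z -> ~~ ((a' < Re z < b') && (c' < Im z < d')) ->
     hol F z) ->
  rint F a b c d = rint F a' b' c' d'.
Proof.
move=> /andP[aa ab] bb /andP[cc cd] dd hF.
have cF (z : C) : inrect a b c d z -> ~~ ((a' < Re z < b') && (c' < Im z < d')) -> ccont F z.
  by move=> h1 h2; apply: hol_continuous; exact: hF.
have zero a1 b1 c1 d1 : a <= a1 -> a1 <= b1 -> b1 <= b -> c <= c1 -> c1 <= d1 -> d1 <= d ->
    [|| b1 <= a', b' <= a1, d1 <= c' | d' <= c1] -> rint F a1 b1 c1 d1 = 0.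
  move=> h1 h2 h3 h4 h5 h6 h7; apply: goursat => // z /andP[/andP[z1 z2] /andP[z3 z4]].
  apply: hF; first by rewrite /inrect; apply/andP; split; apply/andP; split; lra.
  apply/negP => /andP[/andP[z5 z6] /andP[z7 z8]].
  by move: h7 => /or4P[] h7; lra.
have side (z : C) : a <= Re z <= b -> c <= Im z <= d ->
    [|| Re z == a', Re z == b', Im z == c, Im z == d, Im z == c' | Im z == d'] -> ccont F z.
  move=> zab zcd H; apply: cF; first by rewrite /inrect zab zcd.
  apply/negP => /andP[/andP[z5 z6] /andP[z7 z8]].
  by move: H => /orP[/eqP|/orP[/eqP|/or4P[]/eqP]] H; lra.
rewrite (@rint_splitx _ F a a' b); [|by apply/andP; split; lra|..]; first last.
- on_cut side.
- on_cut side.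
rewrite (@rint_splitx _ F a' b' b); [|by apply/andP; split; lra|..]; first last.
- on_cut side.
- on_cut side.
rewrite (@rint_splity _ F a' b' c c' d); [|by apply/andP; split; lra|..]; first last.
- on_cut side.
- on_cut side.
rewrite (@rint_splity _ F a' b' c' d' d); [|by apply/andP; split; lra|..]; first last.
- on_cut side.
- on_cut side.
have -> : rint F a a' c d = 0 by apply: zero; rewrite ?lexx ?orbT//; lra.
have -> : rint F b' b c d = 0 by apply: zero; rewrite ?lexx ?orbT//; lra.
have -> : rint F a' b' c c' = 0 by apply: zero; rewrite ?lexx ?orbT//; lra.
have -> : rint F a' b' d' d = 0 by apply: zero; rewrite ?lexx ?orbT//; lra.
by rewrite !add0r !addr0.
Qed.

(** The value 2 pi i, known only through what is needed of it: it is the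
    integral of 1/z around the origin and it is not zero. *)
Definition two_pi_i : C := rint (fun w : C => w^-1) (-1) 1 (-1) 1.

Lemma hol_inv (z w : C) : w != z -> hol (fun w : C => (w - z)^-1 : C) w.
Proof.
move=> wz; apply: (@holV _ (fun w => w - z)); first by rewrite subr_eq0.
by apply: holB; [exact: hol_id|exact: hol_cst].
Qed.

(** Each pair of opposite sides contributes the integral of 2i/(1 + t^2). *)
Lemma two_pi_i_neq0 : two_pi_i != 0.
Proof.
have N11 : (-1 : R) <= 1 by lra.
have cF (z : C) : bdry (-1) 1 (-1) 1 z -> ccont (fun w : C => w^-1) z.
  move=> /andP[_ zb]; apply: hol_continuous.
  apply: (@holV _ (fun w => w)); last exact: hol_id.
  apply/eqP => z0; move: zb; rewrite z0 /= ![0 == _]eq_sym !oppr_eq0 oner_eq0 //.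
have [h1 h2 h3 h4] := side_int N11 N11 cF.
have mI := @measurable_itv R (Interval (BLeft (-1)) (BRight 1)).
pose g (t : R) : C := Complex 0 (2 / (1 + t ^+ 2)).
have p t : 1 + t ^+ 2 != 0 :> R by rewrite gt_eqF// ltr_pwDl// sqr_ge0.
have E1 : cint `[-1, 1] (fun t => (Complex t (-1))^-1 : C) - cint `[-1, 1] (fun t => (Complex t 1)^-1 : C) = cint `[-1, 1] g.
  rewrite -cintB//; apply: eq_cint => t _.
  rewrite /g; apply/eqP; rewrite eq_complex /=; apply/andP; split; apply/eqP;
   rewrite !expr2 !mulrNN !mulr1 ?[t * t + 1]addrC -?expr2; move: (p t) => ?; field => //.
have E2 : 'i%C * (cint `[-1, 1] (fun t => (Complex 1 t)^-1 : C) - cint `[-1, 1] (fun t => (Complex (-1) t)^-1 : C)) = cint `[-1, 1] g.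
  rewrite -cintB// -cintZ//; last exact: cintegrableB.
  apply: eq_cint => t _.
  rewrite /g; apply/eqP; rewrite eq_complex /=; apply/andP; split; apply/eqP;
   rewrite !expr2 !mulrNN !mulr1 -?expr2; move: (p t) => ?; field => //.
have -> : two_pi_i = cint `[-1, 1] g + cint `[-1, 1] g by rewrite /two_pi_i /rint E1 E2.
have gi : cintegrable `[-1, 1] g.
  have := cintegrableB mI h1 h2; congr cintegrable; apply/funext => t.
  rewrite /g; apply/eqP; rewrite eq_complex /=; apply/andP; split; apply/eqP;
   rewrite !expr2 !mulrNN !mulr1 ?[t * t + 1]addrC -?expr2; move: (p t) => ?; field => //.
apply/eqP => /(congr1 Im); rewrite cImD /= => /eqP.
have : 1 * (1 - (-1)) <= \int[mu]_(x in `[-1, 1]) (2 / (1 + x ^+ 2)).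
  have mE : fine (mu `[-1, 1]) = 1 - (-1) by rewrite lebesgue_measure_itv/= lte_fin ifT//; lra.
  rewrite -mE -Rintegral_cst//; apply: le_Rintegral => //.
  - by apply: continuous_compact_integrable; [exact: segment_compact|move=> ?; exact: cvg_cst].
  - by case: gi.
  - move=> x /=; rewrite in_itv/= => /andP[x1 x2].
    by rewrite ler_pdivlMr ?ltr_pwDl ?sqr_ge0//; nra.
move: (\int[mu]_(x in `[-1, 1]) (2 / (1 + x ^+ 2))) => I h /eqP I2; clear -h I2; lra.
Qed.

(** Both integrals may be taken over the same huge square of size [L], where the
    integrands differ by O(1/L^2). *)
Lemma rint_inv a b c d (z : C) : a < Re z < b -> c < Im z < d ->
  rint (fun w => (w - z)^-1 : C) a b c d = two_pi_i.
Proof.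
have nest a' b' c' d' L (u : C) : a' < Re u < b' -> c' < Im u < d' ->
    - L <= a' -> b' <= L -> - L <= c' -> d' <= L ->
    rint (fun w => (w - u)^-1 : C) (- L) L (- L) L = rint (fun w => (w - u)^-1 : C) a' b' c' d'.
  move=> /andP[h1 h2] /andP[h3 h4] h5 h6 h7 h8; apply: rint_shrink => //; try by apply/andP; split; lra.
  move=> w _ wn; apply: hol_inv; apply: contraNneq wn => ->.
  by rewrite h1 h2 h3 h4.
move=> zab zcd.
apply/eqP; rewrite -subr_eq0 -[_ == _]negbK -normc_gt0 -leNgt.
apply/ler_addgt0Pr => e e0; rewrite add0r.
pose L := 1 + `|a| + `|b| + `|c| + `|d| + 2 * normc z + 32 * normc z / e.
have nz := normc_ge0 z; have q0 : 0 <= 32 * normc z / e by rewrite divr_ge0 ?mulr_ge0// ltW.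
have [Na Nb Nc Nd] := And4 (normr_ge0 a) (normr_ge0 b) (normr_ge0 c) (normr_ge0 d).
have L1 : 1 <= L by rewrite /L; lra.
have Lz : 2 * normc z <= L by rewrite /L; lra.
rewrite -(nest a b c d L z zab zcd); last 4 first.
- have := ler_norm (- a); rewrite normrN /L; lra.
- have := ler_norm b; rewrite /L; lra.
- have := ler_norm (- c); rewrite normrN /L; lra.
- have := ler_norm d; rewrite /L; lra.
have -> : two_pi_i = rint (fun w => w^-1 : C) (- L) L (- L) L.
  have := nest (-1) 1 (-1) 1 L 0.
  have -> : (fun w : C => (w - 0)^-1 : C) = (fun w => w^-1) by apply/funext => w; rewrite subr0.
  by move=> -> //=; try (apply/andP; split); lra.
have NL : - L <= L by lra.
have far (w : C) : bdry (- L) L (- L) L w -> L <= normc w.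
  by move=> /andP[_ /or4P[]/eqP E];
    [apply: le_trans (normc_Re w)|apply: le_trans (normc_Re w)|
     apply: le_trans (normc_Im w)|apply: le_trans (normc_Im w)];
    rewrite E ?normrN ger0_norm//; lra.
have far2 (w : C) : bdry (- L) L (- L) L w -> L / 2 <= normc (w - z).
  move=> /far wL; have := le_normcD (w - z) z; rewrite subrK; lra.
have w0 (w : C) : bdry (- L) L (- L) L w -> w != 0 /\ w - z != 0.
  by move=> wb; have := far w wb; have := far2 w wb; rewrite -!normc_gt0; split; lra.
rewrite -rintB//.
- apply: le_trans (rint_bound NL NL (M := 2 * normc z / (L * L)) _ _) _.
  + move=> w /w0[w1 w2]; apply: hol_continuous; apply: holB.
      by apply: hol_inv; rewrite -subr_eq0.
    by apply: (@holV _ (fun w => w)) => //; exact: hol_id.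
  + move=> w wb; have [w1 w2] := w0 _ wb.
    have -> : (w - z)^-1 - w^-1 = z * (w * (w - z))^-1.
      by field; rewrite w1 w2.
    rewrite normcM normcV normcM.
    have f1 := far _ wb; have f2 := far2 _ wb.
    rewrite [2 * _]mulrC -[leRHS]mulrA ler_wpM2l//.
    have -> : 2 / (L * L) = (L * (L / 2))^-1 by field; lra.
    rewrite lef_pV2 ?posrE; [|by rewrite mulr_gt0 ?normc_gt0|by rewrite mulr_gt0//; lra].
    by apply: ler_pM => //; lra.
  + have -> : 4 * (2 * normc z / (L * L)) * (L - - L + (L - - L)) = 32 * normc z / L by field; lra.
    rewrite ler_pdivrMr; last lra.
    rewrite [e * L]mulrC -ler_pdivrMr// /L; lra.
- by move=> w /w0[w1 w2]; apply: hol_continuous; apply: hol_inv; rewrite -subr_eq0.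
- move=> w /w0[w1 w2]; apply: hol_continuous.
  by apply: (@holV _ (fun w => w)) => //; exact: hol_id.
Qed.

(** Cauchy's integral formula for a rectangle: the difference quotient at [z] is
    bounded near [z], so its integral over small squares tends to zero. *)
Lemma cauchy_rect F a b c d (z : C) : a < Re z < b -> c < Im z < d ->
  (forall w, inrect a b c d w -> hol F w) ->
  rint (fun w => F w / (w - z)) a b c d = two_pi_i * F z.
Proof.
move=> /andP[az zb] /andP[cz zd] hF.
have ab : a <= b by lra. have cd : c <= d by lra.
pose g (w : C) : C := (F w - F z) / (w - z).
have hg w : inrect a b c d w -> w != z -> hol g w.
  move=> wr wz; apply: holM; last exact: hol_inv.
  by apply: holB; [exact: hF|exact: hol_cst].
have bz w : bdry a b c d w -> inrect a b c d w /\ w != z.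
  move=> /andP[wr wb]; split => //; apply: contraTneq wb => ->.
  by apply/negP => /or4P[]/eqP; lra.
have g0 : rint g a b c d = 0.
  apply/eqP; rewrite -[_ == _]negbK -normc_gt0 -leNgt.
  apply/ler_addgt0Pr => e e0; rewrite add0r.
  have [|l hl] := @hol_lin_approx _ F z.
    by apply: hF; rewrite /inrect; apply/andP; split; apply/andP; split; lra.
  have [del del0 H] := hl 1 ltr01.
  have nl := normc_ge0 l.
  have D0 : 0 < 16 * (normc l + 1) by lra.
  pose s := Num.min (del / 3) (Num.min (e / (16 * (normc l + 1)))
     (Num.min (Num.min (Re z - a) (b - Re z)) (Num.min (Im z - c) (d - Im z)))).
  have [t1 t2] : 0 < del / 3 /\ 0 < e / (16 * (normc l + 1)) by split; exact: divr_gt0.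
  have s0 : 0 < s by rewrite !lt_min t1 t2 !subr_gt0 az zb cz zd.
  have [s1 s2 s3] : [/\ s <= del / 3, s <= e / (16 * (normc l + 1)) &
     [/\ s <= Re z - a, s <= b - Re z, s <= Im z - c & s <= d - Im z]].
    by rewrite /s !ge_min !lexx ?orbT; split => //; split; rewrite ?orbT.
  clearbody s.
  have [A1 A2 A3 A4] : [/\ a <= Re z - s, Re z + s <= b, c <= Im z - s & Im z + s <= d].
    by case: s3; clear; split; lra.
  have [B1 B2 B3 B4] : [/\ Re z - s < Re z, Re z < Re z + s, Im z - s < Im z & Im z < Im z + s].
    by move: s0; clear; split; lra.
  rewrite (@rint_shrink g a (Re z - s) (Re z + s) b c (Im z - s) (Im z + s) d);
    rewrite ?A1 ?A3 ?(ltW (lt_trans B1 B2)) ?(ltW (lt_trans B3 B4))//; last first.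
    move=> w wr wn; apply: hg => //; apply: contraNneq wn => ->.
    by rewrite B1 B2 B3 B4.
  have near (w : C) : bdry (Re z - s) (Re z + s) (Im z - s) (Im z + s) w ->
     [/\ inrect a b c d w, w != z & normc (w - z) < del].
    move=> /andP[wr wb]; split; first exact: (inrect_sub wr).
    - by apply: contraTneq wb => ->; rewrite (gt_eqF B1) (lt_eqF B2) (gt_eqF B3) (lt_eqF B4).
    - apply: le_lt_trans (normc_ReIm _) _; rewrite cReD cReN cImD cImN.
      case/andP: wr => /andP[w1 w2] /andP[w3 w4].
      have u1 : `|Re w - Re z| <= s by rewrite ler_distl w1 w2.
      have u2 : `|Im w - Im z| <= s by rewrite ler_distl w3 w4.
      by move: u1 u2 s1 del0; clear; lra.
  apply: le_trans (@rint_bound _ _ _ _ _ _ _ _ (normc l + 1) _ _) _.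
  + exact: ltW (lt_trans B1 B2).
  + exact: ltW (lt_trans B3 B4).
  + by move=> w /near[w1 w2 _]; apply: hol_continuous; exact: hg.
  + move=> w /near[w1 w2 w3]; rewrite /g.
    have wz0 : w - z != 0 by rewrite subr_eq0.
    have -> : F w - F z = (F w - F z - l * (w - z)) + l * (w - z) by rewrite subrK.
    rewrite normcM normcV ler_pdivrMr ?normc_gt0//; apply: le_trans (le_normcD _ _) _.
    rewrite normcM; have := H _ w3; lra.
  + by move: s2; rewrite ler_pdivlMr//; lra.
rewrite (@eq_rint _ a b c d ab cd _ (fun w => g w + F z * (w - z)^-1)); last first.
  by move=> w _; rewrite /g mulrBl subrK.
rewrite rintD//; first last.
- move=> w /bz[w1 w2]; apply: hol_continuous; apply: holM; first exact: hol_cst.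
  exact: hol_inv.
- by move=> w /bz[w1 w2]; apply: hol_continuous; exact: hg.
rewrite g0 add0r rintZ//; first by rewrite rint_inv ?az ?cz// mulrC.
by move=> w /bz[w1 w2]; apply: hol_continuous; exact: hol_inv.
Qed.

End Cauchy.

(** * Cauchy estimates and removable singularities *)

Section DividedDifferences.
Context {R : realType}.
Local Notation C := (cplx R).
Implicit Types (F G : C -> C) (rho M : R) (u h k z w : C).

Definition sqint F u rho := rint F (Re u - rho) (Re u + rho) (Im u - rho) (Im u + rho).
Definition insq u rho w := inrect (Re u - rho) (Re u + rho) (Im u - rho) (Im u + rho) w.
Definition sqbd u rho w := bdry (Re u - rho) (Re u + rho) (Im u - rho) (Im u + rho) w.

Lemma insqP u rho w : reflect (`|Re (w - u)| <= rho /\ `|Im (w - u)| <= rho) (insq u rho w).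
Proof.
rewrite cReD cReN cImD cImN !ler_norml /insq /inrect.
apply: (iffP andP) => -[/andP[? ?] /andP[? ?]]; split; apply/andP; split; lra.
Qed.

Lemma sqbd_insq u rho w : sqbd u rho w -> insq u rho w.
Proof. by case/andP. Qed.

Lemma sqbd_far u rho w : 0 < rho -> sqbd u rho w -> rho <= normc (w - u).
Proof.
move=> r0 /andP[_ /or4P[]/eqP E];
 [apply: le_trans (normc_Re _)|apply: le_trans (normc_Re _)|
  apply: le_trans (normc_Im _)|apply: le_trans (normc_Im _)];
 rewrite ?cReD ?cReN ?cImD ?cImN E addrAC subrr add0r ?normrN ger0_norm// ltW//.
Qed.

Lemma sqbd_far2 u rho w h : 0 < rho -> sqbd u rho w -> normc h <= rho / 2 ->
  rho / 2 <= normc (w - (u + h)).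
Proof.
move=> r0 /(sqbd_far r0) wu hr.
have := le_normcD (w - (u + h)) h; rewrite opprD addrA subrK; lra.
Qed.

Lemma neq_of_far (z : C) (r : R) : 0 < r -> r <= normc z -> z != 0.
Proof. by move=> r0 rz; rewrite -normc_gt0; lra. Qed.

Lemma normc_inv_le (z : C) (r : R) : 0 < r -> r <= normc z -> normc z^-1 <= r^-1.
Proof.
by move=> r0 rz; rewrite normcV lef_pV2// posrE//; lra.
Qed.

(** The Cauchy integral of a density [g] on the boundary of a square; its difference
    quotients are bounded by those of the kernel and a bound for the density. *)
Definition kint g u rho z := sqint (fun w => g w / (w - z)) u rho.

Section Kernel.
Variables (u : C) (rho M : R) (g : C -> C).
Hypotheses (rho0 : 0 < rho) (hg : forall w, sqbd u rho w -> hol g w)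
  (gM : forall w, sqbd u rho w -> normc (g w) <= M).

Lemma ccont_hol F z : hol F z -> ccont F z.
Proof. exact: hol_continuous. Qed.

Let M0 : 0 <= M.
Proof.
apply: le_trans (gM (w := Complex (Re u - rho) (Im u)) _); first exact: normc_ge0.
have r0 := rho0; rewrite /sqbd /bdry /inrect /= eqxx !andbT lexx/=.
by apply/andP; split; first lra; apply/andP; split; lra.
Qed.

Let w0 w : sqbd u rho w -> w - u != 0.
Proof. by move=> wb; apply: (neq_of_far rho0); exact: sqbd_far. Qed.

Let wh w h : normc h <= rho / 2 -> sqbd u rho w -> w - (u + h) != 0.
Proof.
have r0 := rho0.
by move=> hr wb; apply: (@neq_of_far _ (rho / 2)); [lra|exact: sqbd_far2].
Qed.

Let h0 w : sqbd u rho w -> hol (fun w => (w - u)^-1) w.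
Proof. by move=> /w0; rewrite subr_eq0 => wu; exact: hol_inv. Qed.

Let hh w h : normc h <= rho / 2 -> sqbd u rho w -> hol (fun w => (w - (u + h))^-1) w.
Proof. by move=> hr /(wh hr); rewrite subr_eq0 => wu; exact: hol_inv. Qed.

Let hgM G w : sqbd u rho w -> hol G w -> hol (fun w => g w * G w) w.
Proof. by move=> /hg gw Gw; exact: holM. Qed.

Let ab : Re u - rho <= Re u + rho. Proof. by have := rho0; lra. Qed.
Let cd : Im u - rho <= Im u + rho. Proof. by have := rho0; lra. Qed.

Lemma kernel_lip h : normc h <= rho / 2 ->
  normc (kint g u rho (u + h) - kint g u rho u)
    <= 32 / rho * M * normc h.
Proof.
move=> hr; have r0 := rho0; rewrite /kint /sqint -rintB//; first last.
- by move=> w wb; apply: ccont_hol; apply: hgM => //; exact: h0.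
- by move=> w wb; apply: ccont_hol; apply: hgM => //; exact: hh.
have E w : sqbd u rho w -> g w / (w - (u + h)) - g w / (w - u) =
    h * (g w * ((w - u)^-1 * (w - (u + h))^-1)).
  move=> wb; have := w0 wb; have := wh hr wb => n1 n2; field.
  by rewrite n1 n2.
rewrite (eq_rint ab cd E) rintZ//; last first.
  move=> w wb; apply: ccont_hol; apply: hgM => //.
  by apply: holM; [exact: h0|exact: hh].
rewrite normcM mulrC ler_wpM2r ?normc_ge0//.
apply: le_trans (@rint_bound _ _ _ _ _ _ _ _ (M * (2 / rho ^+ 2)) _ _) _ => //.
- move=> w wb; apply: ccont_hol; apply: hgM => //.
  by apply: holM; [exact: h0|exact: hh].
- move=> w wb; rewrite !normcM; apply: ler_pM; rewrite ?normc_ge0 ?mulr_ge0 ?normc_ge0//.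
    exact: gM.
  have -> : 2 / rho ^+ 2 = rho^-1 * (rho / 2)^-1 by field; lra.
  apply: ler_pM; rewrite ?normc_ge0//; apply: normc_inv_le; try lra.
    exact: sqbd_far.
  exact: sqbd_far2.
- rewrite le_eqVlt; apply/orP; left; apply/eqP; field; lra.
Qed.

Lemma kernel_quotients h k : h != 0 -> k != 0 -> normc h <= rho / 2 -> normc k <= rho / 2 ->
  normc ((kint g u rho (u + h) - kint g u rho u) / h -
    (kint g u rho (u + k) - kint g u rho u) / k) <= 64 / rho ^+ 2 * M * normc (h - k).
Proof.
move=> hn kn hr kr; pose H := kint g u rho; rewrite -/H; have r0 := rho0.
have hH l w : normc l <= rho / 2 -> sqbd u rho w -> hol (fun w => g w / (w - (u + l))) w.
  by move=> lr wb; apply: hgM => //; exact: hh.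
have hH0 w : sqbd u rho w -> hol (fun w => g w / (w - u)) w.
  by move=> wb; apply: hgM => //; exact: h0.
have hB l w : normc l <= rho / 2 -> sqbd u rho w ->
    hol (fun w => g w / (w - (u + l)) - g w / (w - u)) w.
  by move=> lr wb; apply: holB; [exact: hH|exact: hH0].
have cZ l w : normc l <= rho / 2 -> sqbd u rho w ->
    ccont (fun w => l^-1 * (g w / (w - (u + l)) - g w / (w - u))) w.
  move=> lr wb; apply: ccont_hol.
  apply: (@holM _ (fun=> l^-1) (fun w => g w / (w - (u + l)) - g w / (w - u))); last exact: hB.
  exact: hol_cst.
have D l : normc l <= rho / 2 -> (H (u + l) - H u) / l =
    sqint (fun w => l^-1 * (g w / (w - (u + l)) - g w / (w - u))) u rho.
  move=> lr; rewrite /H /kint /sqint rintZ//; last first.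
    by move=> w wb; apply: ccont_hol; exact: hB.
  rewrite rintB//; first by rewrite mulrC.
    by move=> w wb; apply: ccont_hol; exact: hH.
  by move=> w wb; apply: ccont_hol; exact: hH0.
rewrite !D// /sqint -rintB//; first last.
- by move=> w; exact: cZ.
- by move=> w; exact: cZ.
have E w : sqbd u rho w -> h^-1 * (g w / (w - (u + h)) - g w / (w - u)) -
    k^-1 * (g w / (w - (u + k)) - g w / (w - u)) =
    (h - k) * (g w * ((w - u)^-1 * ((w - (u + h))^-1 * (w - (u + k))^-1))).
  move=> wb; have := w0 wb; have := wh hr wb; have := wh kr wb => n1 n2 n3; field.
  by rewrite n1 n2 n3 hn kn.
have cE w : sqbd u rho w -> ccont (fun w => g w * ((w - u)^-1 * ((w - (u + h))^-1 * (w - (u + k))^-1))) w.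
  move=> wb; apply: ccont_hol; apply: hgM => //; apply: holM; first exact: h0.
  by apply: holM; exact: hh.
rewrite (eq_rint ab cd E) rintZ// normcM mulrC ler_wpM2r ?normc_ge0//.
apply: le_trans (@rint_bound _ _ _ _ _ _ _ _ (M * (4 / rho ^+ 3)) _ _) _ => //.
- move=> w wb; rewrite !normcM; apply: ler_pM; rewrite ?normc_ge0 ?mulr_ge0 ?normc_ge0//.
    exact: gM.
  have -> : 4 / rho ^+ 3 = rho^-1 * ((rho / 2)^-1 * (rho / 2)^-1) by field; lra.
  apply: ler_pM; rewrite ?normc_ge0 ?mulr_ge0 ?normc_ge0//.
    by apply: normc_inv_le => //; exact: sqbd_far.
  by apply: ler_pM; rewrite ?normc_ge0//; apply: normc_inv_le; rewrite ?divr_gt0//; exact: sqbd_far2.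
- rewrite le_eqVlt; apply/orP; left; apply/eqP; field; lra.
Qed.

End Kernel.

Lemma cauchy_sq F u rho h : 0 < rho -> normc h <= rho / 2 ->
  (forall w, insq u rho w -> hol F w) ->
  kint F u rho (u + h) = two_pi_i * F (u + h).
Proof.
move=> r0 hr hF; rewrite /kint /sqint cauchy_rect//.
  rewrite cReD; have := le_trans (normc_Re h) hr; rewrite ler_norml => /andP[? ?].
  by apply/andP; split; lra.
rewrite cImD; have := le_trans (normc_Im h) hr; rewrite ler_norml => /andP[? ?].
by apply/andP; split; lra.
Qed.

Lemma cauchy_sq0 F u rho : 0 < rho -> (forall w, insq u rho w -> hol F w) ->
  kint F u rho u = two_pi_i * F u.
Proof.
move=> r0 hF; have := @cauchy_sq F u rho 0 r0; rewrite addr0; apply => //.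
by rewrite (@normc0 R) divr_ge0// ltW.
Qed.

(** The constants of the next two estimates depend on the size of the square only; this
    uniformity is what passes them to limits, integrals and functionals. *)
Lemma hol_lip rho : 0 < rho -> exists2 A : R, 0 <= A & forall F u M h,
  (forall w, insq u rho w -> hol F w) ->
  (forall w, insq u rho w -> normc (F w) <= M) -> normc h <= rho / 2 ->
  normc (F (u + h) - F u) <= A * M * normc h.
Proof.
move=> r0; have c1 : 0 < normc (two_pi_i : C) by rewrite normc_gt0 two_pi_i_neq0.
exists (32 / rho / normc (two_pi_i : C)); first by rewrite !divr_ge0 ?(ltW r0) ?(ltW c1).
move=> F u M h hF FM hr.
have := @kernel_lip u rho M F r0 (fun w wb => hF _ (sqbd_insq wb))
  (fun w wb => FM _ (sqbd_insq wb)) h hr.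
rewrite cauchy_sq// cauchy_sq0// -mulrBr normcM.
by rewrite -ler_pdivlMl// => le; apply: (le_trans le); rewrite le_eqVlt; apply/orP; left;
  apply/eqP; field; rewrite !gt_eqF.
Qed.

Lemma hol_quotients rho : 0 < rho -> exists2 A : R, 0 <= A & forall F u M h k,
  (forall w, insq u rho w -> hol F w) ->
  (forall w, insq u rho w -> normc (F w) <= M) ->
  h != 0 -> k != 0 -> normc h <= rho / 2 -> normc k <= rho / 2 ->
  normc ((F (u + h) - F u) / h - (F (u + k) - F u) / k) <= A * M * normc (h - k).
Proof.
move=> r0; have c1 : 0 < normc (two_pi_i : C) by rewrite normc_gt0 two_pi_i_neq0.
exists (64 / rho ^+ 2 / normc (two_pi_i : C)).
  by rewrite divr_ge0 ?(ltW c1)// divr_ge0// exprn_ge0// ltW.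
move=> F u M h k hF FM h0 k0 hr kr.
have := @kernel_quotients u rho M F r0 (fun w wb => hF _ (sqbd_insq wb))
  (fun w wb => FM _ (sqbd_insq wb)) h k h0 k0 hr kr.
rewrite !cauchy_sq// cauchy_sq0//.
have -> : (two_pi_i * F (u + h) - two_pi_i * F u) / h - (two_pi_i * F (u + k) - two_pi_i * F u) / k =
  two_pi_i * ((F (u + h) - F u) / h - (F (u + k) - F u) / k) by field; rewrite h0 k0.
rewrite normcM -ler_pdivlMl// => le; apply: (le_trans le); rewrite le_eqVlt; apply/orP; left.
by apply/eqP; field; rewrite !gt_eqF.
Qed.

Lemma hol_near F G z (r : R) : 0 < r -> (forall w, normc (w - z) < r -> F w = G w) ->
  hol F z -> hol G z.
Proof.
move=> r0 FG; rewrite hol.unlock => /derivable_eps[d hd]; apply/derivable_eps.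
exists d => e e0; have [del del0 H] := hd _ e0.
exists (Num.min del r); first by rewrite lt_min del0.
move=> h h0; rewrite lt_min => /andP[h1 h2]; rewrite -!FG ?subrr ?(@normc0 R)//; first exact: H.
by rewrite addrAC subrr add0r.
Qed.

Lemma sqbd_bounded (g : C -> C) u rho : 0 < rho -> (forall w, sqbd u rho w -> ccont g w) ->
  exists M, forall w, sqbd u rho w -> normc (g w) <= M.
Proof.
move=> r0 cg.
have side (f : R -> C) (a b : R) : a <= b -> (forall x, a <= x <= b -> pcont f x) ->
    exists M, forall x, a <= x <= b -> normc (f x) <= M.
  move=> ab cf.
  have H (p : C -> R) : (forall z w, `|p z - p w| <= normc (z - w)) ->
      exists M, forall x, a <= x <= b -> p (f x) <= M.
    move=> pl; have [|c _ cmax] := @EVT_max _ (fun x => p (f x)) _ _ ab.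
      apply: continuous_in_subspaceT => x; rewrite inE/= in_itv/= => xab.
      exact: (pcont_continuous pl (cf _ xab)).
    by exists (p (f c)) => x xab; apply: cmax; rewrite in_itv.
  apply: H => z w; rewrite ler_norml; apply/andP; split.
    have := le_normcD (w - z) z; rewrite subrK [normc (w - z)]normcB; lra.
  have := le_normcD (z - w) w; rewrite subrK; lra.
have ab : Re u - rho <= Re u + rho by lra.
have cd : Im u - rho <= Im u + rho by lra.
have [M1 h1] := side _ _ _ ab (fun x xab => pcont_h (cg _ (bdry_b cd xab))).
have [M2 h2] := side _ _ _ ab (fun x xab => pcont_h (cg _ (bdry_t cd xab))).
have [M3 h3] := side _ _ _ cd (fun x xab => pcont_v (cg _ (bdry_l ab xab))).
have [M4 h4] := side _ _ _ cd (fun x xab => pcont_v (cg _ (bdry_r ab xab))).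
exists (Num.max (Num.max M1 M2) (Num.max M3 M4)) => -[x y] /andP[/andP[/= xab ycd] /or4P[]/eqP E];
  rewrite /= in xab ycd E; subst; rewrite !le_max.
- by rewrite h3 ?orbT.
- by rewrite h4 ?orbT.
- by rewrite h1 ?orbT.
- by rewrite h2 ?orbT.
Qed.

(** The value at [p] is the one of the Cauchy integral of the quotient over a square
    around [p], which is holomorphic inside and equals the quotient off [p]. *)
Lemma removable F p : (forall w, hol F w) ->
  exists d : C, forall w, hol (fun z => if z == p then d else (F z - F p) / (z - p)) w.
Proof.
move=> hF; have r1 : (0 : R) < 1 by [].
pose g w := F w / (w - p).
pose H z := two_pi_i^-1 * kint g p 1 z.
have c0 : two_pi_i != 0 :> C := two_pi_i_neq0.
exists (H p) => w; have [->|wp] := eqVneq w p; last first.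
  apply: (@hol_near (fun z => (F z - F p) / (z - p)) _ _ (normc (w - p))).
  - by rewrite normc_gt0 subr_eq0.
  - by move=> z; case: eqP => // ->; rewrite normcB ltxx.
  - apply: holM; last exact: hol_inv.
    by apply: holB => //; exact: hol_cst.
have hg z : sqbd p 1 z -> hol g z.
  move=> zb; apply: holM => //; apply: hol_inv.
  by rewrite -subr_eq0; apply: (neq_of_far r1); exact: sqbd_far.
have cg z : sqbd p 1 z -> ccont g z by move=> /hg; exact: ccont_hol.
have [M gM] : exists M, forall z, sqbd p 1 z -> normc (g z) <= M.
  exact: sqbd_bounded.
have M0 : 0 <= M.
  apply: le_trans (gM (Complex (Re p - 1) (Im p)) _); first exact: normc_ge0.
  rewrite /sqbd /bdry /inrect /= eqxx !andbT lexx/=.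
  by apply/andP; split; first lra; apply/andP; split; lra.
have nc := normc_ge0 (two_pi_i^-1 : C).
apply: (@hol_near H _ _ (1 / 2)); first lra.
  move=> z zp; case: eqP => [->//|/eqP zp0].
  have zE : z = p + (z - p) by rewrite addrC subrK.
  have zp0' : z - p != 0 by rewrite subr_eq0.
  have := @cauchy_sq F p 1 (z - p) r1 (ltW zp) (fun w _ => hF w).
  have := @cauchy_sq0 F p 1 r1 (fun w _ => hF w).
  rewrite -zE => E1 E2; rewrite /H.
  have -> : F z - F p = two_pi_i^-1 * (kint F p 1 z - kint F p 1 p).
    by rewrite E1 E2 -mulrBr mulrA mulVf ?mul1r.
  rewrite -mulrA; congr (_ * _).
  have ab : Re p - 1 <= Re p + 1 by lra.
  have cd : Im p - 1 <= Im p + 1 by lra.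
  have n1 v : sqbd p 1 v -> v - p != 0.
    by move=> vb; apply: (neq_of_far r1); exact: sqbd_far.
  have n2 v : sqbd p 1 v -> v - z != 0.
    move=> vb; apply: (@neq_of_far _ (1 / 2)); first lra.
    by rewrite zE; apply: sqbd_far2 => //; exact: ltW.
  rewrite /kint /sqint -rintB//; last first.
    move=> v vb; apply: ccont_hol; apply: holM => //; apply: hol_inv.
    by rewrite -subr_eq0; exact: n2.
  rewrite mulrC -rintZ//; last first.
    move=> v vb; apply: ccont_hol; apply: holB; apply: holM => //; apply: hol_inv.
      by rewrite -subr_eq0; exact: n2.
    by rewrite -subr_eq0; exact: n1.
  apply: eq_rint => // v vb; rewrite /g; have := n1 _ vb; have := n2 _ vb => m1 m2.
  by field; rewrite m1 m2 zp0'.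
apply: (@hol_of_quotients _ _ _ (1 / 2) (normc (two_pi_i^-1 : C) * (64 / 1 ^+ 2 * M))).
- lra.
- by rewrite mulr_ge0// mulr_ge0// divr_ge0.
- move=> h k h0 k0 hr kr.
  have := @kernel_quotients p 1 M g r1 hg gM h k h0 k0 (ltW hr) (ltW kr).
  rewrite /H; move: (kint g p 1 (p + h)) (kint g p 1 (p + k)) (kint g p 1 p) => x y t le.
  have -> : (two_pi_i^-1 * x - two_pi_i^-1 * t) / h - (two_pi_i^-1 * y - two_pi_i^-1 * t) / k =
    two_pi_i^-1 * ((x - t) / h - (y - t) / k) by ring.
  rewrite normcM -[leRHS]mulrA; apply: ler_wpM2l => //; apply: (le_trans le); apply: ler_wpM2l.
    by rewrite mulr_ge0// divr_ge0.
  exact: ler_normcB.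
Qed.

End DividedDifferences.

(** * Integrals along horizontal lines *)

Section Strips.
Context {R : realType}.
Local Notation C := (cplx R).
Implicit Types (F G : C -> C) (B y n x : R).

(** The common majorant of the integrands on horizontal lines; the second power of
    1/(1 + x^2) gives rates for the tails. *)
Definition decay x : R := ((1 + x ^+ 2)^-1) ^+ 2.

Lemma decay_gt0 x : 0 < decay x.
Proof. by rewrite exprn_gt0// invr_gt0 ltr_pwDl ?sqr_ge0. Qed.

Lemma decay_le1 x : decay x <= 1.
Proof.
rewrite exprn_ile1// ?invr_ge0 ?addr_ge0 ?sqr_ge0//.
by rewrite invf_le1 ?lerDl ?sqr_ge0// ltr_pwDl ?sqr_ge0.
Qed.

Lemma decay_le_inv x : decay x <= (1 + x ^+ 2)^-1.
Proof.
have p : 0 < 1 + x ^+ 2 by rewrite ltr_pwDl ?sqr_ge0.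
rewrite /decay expr2 -[leRHS]mulr1 ler_wpM2l ?invr_ge0 ?(ltW p)//.
by rewrite invf_le1// lerDl sqr_ge0.
Qed.

Definition lint F y : C := cint setT (fun x => F (Complex x y)).

Lemma strip_contourE k F : strip_contour k F = lint F (- k) - lint F k.
Proof. by []. Qed.

Lemma lint_integrable F y B : (forall x, ccont F (Complex x y)) ->
  (forall x, normc (F (Complex x y)) <= B * decay x) ->
  cintegrable setT (fun x => F (Complex x y)).
Proof.
move=> cF FB; apply: (cintegrable_dominated (B := B)).
  by move=> x; apply: pcont_h.
have B0 : 0 <= B.
  have := le_trans (normc_ge0 _) (FB 0); rewrite pmulr_lge0//; exact: decay_gt0.
by move=> x; apply: le_trans (FB x) _; rewrite ler_wpM2l// decay_le_inv.
Qed.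

Lemma inv_sqr_int_ge0 : 0 <= inv_sqr_int :> R.
Proof. by apply: Rintegral_ge0 => x _; rewrite invr_ge0 addr_ge0 ?sqr_ge0. Qed.

Lemma small_inv (K e : R) : 0 < e -> exists2 N : nat, (0 < N)%N &
  forall n, N%:R <= n -> K / n < e.
Proof.
move=> e0; have q0 : 0 <= `|K| / e by rewrite divr_ge0// ltW.
exists (Num.bound (`|K| / e)).+1 => // n nN.
have n0 : 0 < n by apply: lt_le_trans nN; rewrite ltr0n.
rewrite ltr_pdivrMr// mulrC -ltr_pdivrMr//.
apply: (@le_lt_trans _ _ (`|K| / e)); first by rewrite ler_pM2r ?invr_gt0// ler_norm.
apply: lt_le_trans (archi_boundP q0) _; apply: le_trans nN.
by rewrite ler_nat.
Qed.

(** Rectangles of half-length [n] exhaust the strip; their vertical sides and the tails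
    of the two lines contribute O(1/n). *)
Lemma strip_limit F y1 y2 B (N : R) (v : C) : y1 <= y2 -> 0 <= N ->
  (forall z : C, y1 <= Im z <= y2 -> [|| Im z == y1, Im z == y2 | N <= `|Re z|] ->
     ccont F z /\ normc (F z) <= B * decay (Re z)) ->
  (forall n, N <= n -> rint F (- n) n y1 y2 = v) ->
  lint F y1 - lint F y2 = v.
Proof.
move=> y12 N0 hF hr.
have c1 x : ccont F (Complex x y1) /\ normc (F (Complex x y1)) <= B * decay x.
  by apply: hF; rewrite /= ?lexx ?y12 ?eqxx.
have c2 x : ccont F (Complex x y2) /\ normc (F (Complex x y2)) <= B * decay x.
  by apply: hF; rewrite /= ?lexx ?y12 ?eqxx ?orbT.
have B0 : 0 <= B.
  have := le_trans (normc_ge0 _) (c1 0).2; rewrite pmulr_lge0//; exact: decay_gt0.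
apply/eqP; rewrite -subr_eq0 -[_ == _]negbK -normc_gt0 -leNgt.
apply/ler_addgt0Pr => e e0; rewrite add0r.
pose K := 4 * (B * inv_sqr_int) + 4 * B * (y2 - y1).
have [M _ hM] := small_inv K e0.
pose n := Num.max 1 (Num.max N M%:R).
have [n1 nN nM] : [/\ 1 <= n, N <= n & M%:R <= n].
  by rewrite /n !le_max !lexx ?orbT.
have n0 : 0 <= n by lra.
rewrite -(hr n nN) /rint.
have t1 := @cint_tail _ (fun x => F (Complex x y1)) B n n0 (fun x => pcont_h (c1 x).1) (fun x => (c1 x).2).
have t2 := @cint_tail _ (fun x => F (Complex x y2)) B n n0 (fun x => pcont_h (c2 x).1) (fun x => (c2 x).2).
have v1 s : `|s| = n -> normc (cint `[y1, y2] (fun t => F (Complex s t))) <= 2 * (B * decay n * (y2 - y1)).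
  move=> sn; have wE : decay s = decay n by rewrite /decay -(real_normK (num_real s)) sn.
  have h t : y1 <= t <= y2 -> ccont F (Complex s t) /\ normc (F (Complex s t)) <= B * decay n.
    by move=> ty; rewrite -wE; apply: hF => //=; rewrite sn nN !orbT.
  by apply: cint_bound => // t /h[h1 h2] //; exact: pcont_v.
have v2 := v1 n (ger0_norm n0).
have v3 : `|- n| = n by rewrite normrN ger0_norm.
have v4 := v1 (- n) v3.
rewrite /lint.
set a := cint setT _ in t1 *; set b := cint setT _ in t2 *.
set a' := cint _ _ in t1 *; set b' := cint _ _ in t2 *.
set r := cint _ _ in v2 *; set l := cint _ _ in v4 *.
have -> : a - b - (a' - b' + 'i%C * (r - l)) = (a - a') - (b - b') - 'i%C * (r - l) by ring.
have ni : normc ('i%C : C) = 1 by rewrite /= expr0n/= expr1n add0r sqrtr1.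
apply: (@le_trans _ _ (K / n)); last exact: ltW (hM _ nM).
apply: le_trans (ler_normcB _ _) _; rewrite normcM ni mul1r.
have := ler_normcB (a - a') (b - b'); have := ler_normcB r l.
have den : (1 + n ^+ 2)^-1 <= n^-1.
  by rewrite lef_pV2 ?posrE ?ltr_pwDl ?sqr_ge0//; nra.
have wn : decay n <= n^-1 := le_trans (decay_le_inv n) den.
have BI : 0 <= B * inv_sqr_int by rewrite mulr_ge0 ?inv_sqr_int_ge0.
have h1 : B * inv_sqr_int / (1 + n ^+ 2) <= B * inv_sqr_int / n by rewrite ler_wpM2l.
have h2 : B * decay n * (y2 - y1) <= B * n^-1 * (y2 - y1).
  by apply: ler_wpM2r; [lra|rewrite ler_wpM2l].
have -> : K / n = 4 * (B * inv_sqr_int / n) + 4 * (B * n^-1 * (y2 - y1)) by rewrite /K; ring.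
lra.
Qed.

Lemma strip_shift F y1 y2 B : y1 <= y2 ->
  (forall z : C, y1 <= Im z <= y2 -> hol F z /\ normc (F z) <= B * decay (Re z)) ->
  lint F y1 = lint F y2.
Proof.
move=> y12 hF; apply/eqP; rewrite -subr_eq0; apply/eqP.
apply: (@strip_limit F y1 y2 B 0) => //.
  by move=> z /hF[h1 h2] _; split => //; exact: ccont_hol.
move=> n n0; apply: goursat => //; first lra.
by move=> z /andP[_ /hF[]].
Qed.

Lemma strip_cauchy F y1 y2 B (z : C) : y1 < Im z < y2 ->
  (forall w : C, y1 <= Im w <= y2 -> hol F w /\ normc (F w) <= B * decay (Re w)) ->
  lint (fun w => F w / (w - z)) y1 - lint (fun w => F w / (w - z)) y2 = two_pi_i * F z.
Proof.
move=> /andP[z1 z2] hF; have y12 : y1 <= y2 by lra.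
pose del := Num.min 1 (Num.min (Im z - y1) (y2 - Im z)).
have d0 : 0 < del by rewrite !lt_min ltr01 !subr_gt0 z1 z2.
have [d1 d2 d3] : [/\ del <= 1, del <= Im z - y1 & del <= y2 - Im z].
  by rewrite /del !ge_min !lexx ?orbT.
have nz := normr_ge0 (Re z).
apply: (@strip_limit _ y1 y2 (B / del) (`|Re z| + 1)); rewrite ?addr_ge0//.
  move=> w wy wb; have [h1 h2] := hF _ wy.
  have far : del <= normc (w - z).
    case/or3P: wb => [/eqP|/eqP|] E.
    - apply: le_trans (normc_Im _); rewrite cImD cImN E.
      by rewrite distrC; apply: le_trans d2 _; exact: ler_norm.
    - apply: le_trans (normc_Im _); rewrite cImD cImN E; apply: le_trans d3 _; exact: ler_norm.
    - apply: le_trans (normc_Re _); rewrite cReD cReN.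
      have := lerB_dist (Re w) (Re z); lra.
  have wz : w != z by rewrite -subr_eq0; exact: neq_of_far far.
  split; first by apply: ccont_hol; apply: holM => //; exact: hol_inv.
  rewrite normcM mulrAC; apply: ler_pM; rewrite ?normc_ge0//.
  exact: normc_inv_le.
move=> n nN; have := ler_norm (Re z); have := ler_norm (- Re z); rewrite normrN => u1 u2.
apply: cauchy_rect; try (apply/andP; split); try lra.
by move=> w /andP[_ /hF[]].
Qed.

(** Riemann sums of mesh 1/n^2 over [-n, n]. *)
Definition rsum (n : nat) (g : R -> C) : C :=
  \sum_(i < (2 * n ^ 3)%N) Complex ((n%:R ^+ 2)^-1) 0 * g (- n%:R + i%:R / n%:R ^+ 2).

(** On [-n, n] there are 2 n^3 intervals of length n^-2, on each of which a Lipschitz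
    function makes an error of order n^-4. *)
Lemma riemann (g : R -> C) B (n : nat) : (0 < n)%N -> (forall x, pcont g x) ->
  (forall x, normc (g x) <= B * decay x) ->
  (forall x t, normc (g x - g t) <= B * `|x - t|) ->
  normc (cint setT g - rsum n g) <= (2 * inv_sqr_int + 4) * B / n%:R.
Proof.
move=> n0 cg gB gL.
have N1 : 1 <= n%:R :> R by rewrite ler1n.
have N0 : 0 < n%:R :> R by lra.
have B0 : 0 <= B.
  have := le_trans (normc_ge0 _) (gB 0); rewrite pmulr_lge0//; exact: decay_gt0.
set N : R := n%:R in N1 N0 *.
pose d := (N ^+ 2)^-1; have d0 : 0 < d by rewrite invr_gt0 exprn_gt0.
pose x_ (i : nat) := - N + i%:R * d.
have xS i : x_ i.+1 = x_ i + d by rewrite /x_ -natr1; ring.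
have xle i : - N <= x_ i by rewrite /x_ lerDl mulr_ge0 ?(ltW d0).
have ig a b : cintegrable `[a, b] g by apply: pcont_integrable => x _.
have step k : normc (cint `[- N, x_ k] g - \sum_(i < k) Complex d 0 * g (x_ i)) <= k%:R * (2 * (B * d * d)).
  elim: k => [|k IH].
    by rewrite big_ord0 subr0 /x_ mul0r addr0 cint_point (@normc0 R) mul0r.
  rewrite big_ord_recr/= (@cint_split _ (- N) (x_ k) (x_ k.+1))//; last by rewrite xS; lra.
  set S := \sum_(i < k) _; set A := cint _ _; set D := cint _ _.
  have -> : A + D - (S + Complex d 0 * g (x_ k)) = (A - S) + (D - g (x_ k) * Complex d 0) by ring.
  apply: le_trans (le_normcD _ _) _; rewrite -natr1 mulrDl mul1r; apply: lerD => //.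
  have xk : x_ k <= x_ k.+1 by rewrite xS; lra.
  have -> : g (x_ k) * Complex d 0 = cint `[x_ k, x_ k.+1] (fun=> g (x_ k)).
    by rewrite cint_cst//; congr (_ * Complex _ _); rewrite xS; lra.
  have mI := @measurable_itv R (Interval (BLeft (x_ k)) (BRight (x_ k.+1))).
  have pc : forall x, pcont (fun=> g (x_ k)) x.
    by move=> x e e0; exists 1 => // y _; rewrite subrr (@normc0 R).
  rewrite /D -cintB//; last by apply: pcont_integrable => x _.
  have E : B * d * d = B * d * (x_ k.+1 - x_ k) by rewrite xS; ring.
  rewrite E; apply: cint_bound => // x.
  + move=> _ e e0; have [del del0 h] := cg x _ e0; exists del => // y /h.
    by rewrite opprB addrA subrK.
  + rewrite xS => /andP[x1 x2]; apply: le_trans (gL _ _) _; rewrite ler_wpM2l//.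
    by rewrite ger0_norm; lra.
have nE : x_ (2 * n ^ 3)%N = N.
  rewrite /x_ natrM natrX /d -/N; field; lra.
have := step (2 * n ^ 3)%N; rewrite nE => s1.
have := @cint_tail _ g B N (ltW N0) cg gB => s2.
rewrite /rsum -/N -/d.
set S := \sum_(i < _) _ in s1 *.
have -> : cint setT g - S = (cint setT g - cint `[- N, N] g) + (cint `[- N, N] g - S) by ring.
apply: le_trans (le_normcD _ _) _; apply: le_trans (lerD s2 s1) _.
have -> : (2 * n ^ 3)%N%:R * (2 * (B * d * d)) = 4 * B / N.
  rewrite natrM natrX /d -/N; field; lra.
have BI : 0 <= B * inv_sqr_int by rewrite mulr_ge0 ?inv_sqr_int_ge0.
have den : (1 + N ^+ 2)^-1 <= N^-1.
  by rewrite lef_pV2 ?posrE ?ltr_pwDl ?sqr_ge0//; nra.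
have : B * inv_sqr_int / (1 + N ^+ 2) <= B * inv_sqr_int / N by rewrite ler_wpM2l.
have -> : (2 * inv_sqr_int + 4) * B / N = 2 * (B * inv_sqr_int / N) + 4 * B / N by ring.
lra.
Qed.

(** The Lipschitz bound comes from the Cauchy estimates, so that the error depends on
    [F] through its majorant on a neighbourhood of the line only. *)
Lemma riemann_strip (rho : R) : 0 < rho -> exists2 K : R, 0 <= K & forall F y B (n : nat),
  (0 < n)%N ->
  (forall w : C, `|Im w - y| <= rho -> hol F w /\ normc (F w) <= B * decay (Re w)) ->
  normc (lint F y - rsum n (fun x => F (Complex x y))) <= K * B / n%:R.
Proof.
move=> r0; have [A A0 hA] := @hol_lip R _ r0.
have D0 : 1 <= 1 + A + 4 / rho by have := divr_ge0 (ler0n R 4) (ltW r0); lra.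
exists ((2 * inv_sqr_int + 4) * (1 + A + 4 / rho)); first by rewrite mulr_ge0//; [have := inv_sqr_int_ge0; lra|lra].
move=> F y B n n0 hF.
have onl x : hol F (Complex x y) /\ normc (F (Complex x y)) <= B * decay x.
  by apply: (hF (Complex x y)); rewrite /= subrr normr0 ltW.
have B0 : 0 <= B.
  have := le_trans (normc_ge0 _) (onl 0).2; rewrite pmulr_lge0//; exact: decay_gt0.
have Bw x : B * decay x <= B by rewrite -[leRHS]mulr1 ler_wpM2l// decay_le1.
rewrite -[_ * _ * B]mulrA; apply: riemann => //.
- by move=> x; apply: pcont_h; apply: ccont_hol; have [] := onl x.
- move=> x; apply: le_trans (onl x).2 _; rewrite ler_wpM2r ?(ltW (decay_gt0 _))//.
  by rewrite -[leLHS]mul1r ler_wpM2r.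
- move=> x t; have q4 := divr_ge0 (ler0n R 4) (ltW r0).
  have [h|h] := lerP `|x - t| (rho / 2).
    have Ex : Complex x y = Complex t y + Complex (x - t) 0 :> C.
      by apply/eqP; rewrite eq_complex /=; apply/andP; split; apply/eqP; ring.
    have nh : normc (Complex (x - t) 0) = `|x - t| := normc_real _.
    have sqIm (w : C) : insq (Complex t y) rho w -> `|Im w - y| <= rho.
      by case/insqP => _; rewrite cImD cImN.
    have := hA F (Complex t y) B (Complex (x - t) 0).
    rewrite -Ex nh => H; apply: le_trans (H _ _ h) _.
    + by move=> w /sqIm/hF[].
    + by move=> w /sqIm/hF[_ wB]; exact: le_trans wB (Bw _).
    + by apply: ler_wpM2r => //; apply: ler_wpM2r => //; lra.
  apply: le_trans (ler_normcB _ _) _.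
  have b1 := le_trans (onl x).2 (Bw x); have b2 := le_trans (onl t).2 (Bw t).
  apply: (@le_trans _ _ (4 / rho * B * (rho / 2))).
    have -> : 4 / rho * B * (rho / 2) = 2 * B by field; lra.
    lra.
  apply: ler_pM; rewrite ?mulr_ge0 ?invr_ge0 ?(ltW r0) ?(ltW h)//.
  by apply: ler_wpM2r => //; lra.
Qed.

End Strips.

(** * Inequalities for weight functions *)

Section Weights.
Context {R : realType} (w : weight R).
Local Notation mu := (@lebesgue_measure R).
Implicit Types (l m t x xi : R).

Lemma w_ge0 t : 0 <= w t. Proof. exact: weight_ge0. Qed.

Lemma w_mono s t : `|s| <= `|t| -> w s <= w t.
Proof. by move=> st; apply: weight_homo. Qed.

(** The substitute for subadditivity: one of [xi - x] and [x] is at least half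
    as large as [xi]. *)
Lemma weight_split l xi x : 0 <= l -> w (l * xi) <= w (2 * l * (xi - x)) + w (2 * l * x).
Proof.
move=> l0; have h : `|xi| <= `|xi - x| + `|x|.
  by rewrite -{1}(subrK x xi) ler_normD.
have l2 : 0 <= 2 * l by lra.
have nx := normr_ge0 x; have nxx := normr_ge0 (xi - x).
have [le|/ltW le] := leP `|x| `|xi - x|.
  apply: (@le_trans _ _ (w (2 * l * (xi - x)))); last by rewrite lerDl w_ge0.
  by apply: w_mono; rewrite !normrM normr_nat (ger0_norm l0); nra.
apply: (@le_trans _ _ (w (2 * l * x))); last by rewrite lerDr w_ge0.
by apply: w_mono; rewrite !normrM normr_nat (ger0_norm l0); nra.
Qed.

Lemma exp_weight_split l xi x : 0 <= l ->
  expR (w (l * xi)) <= expR (w (2 * l * (xi - x))) * expR (w (2 * l * x)).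
Proof. by move=> l0; rewrite -expRD ler_expR; exact: weight_split. Qed.

(** The weight eventually exceeds 4 log t. *)
Lemma weight_poly : exists2 K : R, 0 <= K & forall t, (1 + t ^+ 2) ^+ 2 <= K * expR (w t).
Proof.
have /cvgryPge/(_ 4)[T [_ hT]] := weight_log w.
pose T1 := Num.max 2 (T + 1).
have [T2 TT] : 2 <= T1 /\ T + 1 <= T1 by rewrite /T1 !le_max !lexx orbT.
exists (4 + (1 + T1 ^+ 2) ^+ 2) => [|t]; first by rewrite addr_ge0// sqr_ge0.
have e1 : 1 <= expR (w t) by rewrite -expR0 ler_expR w_ge0.
have p0 : 0 <= (1 + T1 ^+ 2) ^+ 2 by rewrite sqr_ge0.
have [tT|Tt] := leP `|t| T1.
  apply: (@le_trans _ _ ((1 + T1 ^+ 2) ^+ 2)); last by nra.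
  rewrite ler_sqr ?nnegrE ?addr_ge0 ?sqr_ge0// lerD2l -(real_normK (num_real t)).
  by rewrite ler_sqr ?nnegrE//; lra.
have t1 : 1 < `|t| by lra.
have ln0 : 0 < ln `|t| by apply: ln_gt0.
have := hT `|t|; rewrite /= ler_pdivlMr// => /(_ _) h.
have {}h : 4 * ln `|t| <= w t by apply: h; lra.
have : `|t| ^+ 4 <= expR (w t).
  have -> : `|t| ^+ 4 = expR (4 * ln `|t|).
    by rewrite -[4]/(4%:R) expRM_natl lnK// posrE; lra.
  by rewrite ler_expR.
have -> : `|t| ^+ 4 = (t ^+ 2) ^+ 2 by rewrite -[in RHS](real_normK (num_real t)) -exprM.
have t2 : 1 <= t ^+ 2 by rewrite -(real_normK (num_real t)) expr_ge1//; lra.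
move=> h4; nra.
Qed.

Lemma weight_decay l : 0 < l -> exists2 K : R, 0 <= K & forall x, 1 <= K * (decay x * expR (w (l * x))).
Proof.
move=> l0; have [K K0 hK] := weight_poly.
pose q := 1 + l^-1 ^+ 2; have q1 : 1 <= q by rewrite /q lerDl sqr_ge0.
exists (q ^+ 2 * K) => [|x]; first by rewrite mulr_ge0// sqr_ge0.
have p : 0 < 1 + x ^+ 2 by rewrite ltr_pwDl ?sqr_ge0.
rewrite /decay exprVn mulrCA mulrC ler_pdivlMr ?exprn_gt0// mul1r.
have h := hK (l * x).
have le : 1 + x ^+ 2 <= q * (1 + (l * x) ^+ 2).
  have -> : q * (1 + (l * x) ^+ 2) = 1 + x ^+ 2 + (l^-1 ^+ 2 + (l * x) ^+ 2).
    by rewrite /q; field; lra.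
  by rewrite lerDl addr_ge0// sqr_ge0.
apply: (@le_trans _ _ ((q * (1 + (l * x) ^+ 2)) ^+ 2)).
  by rewrite ler_sqr ?nnegrE//; [exact: ltW|exact: le_trans (ltW p) le].
rewrite exprMn; have := ler_wpM2l (sqr_ge0 q) h; lra.
Qed.

(** By (delta), doubling [w] costs a dilation and a constant; one of the two copies of
    e^{w(l x)} pays for the factor [decay]. *)
Lemma weight_gain (wd : cond_delta w) l : 0 < l -> exists2 m : R, l <= m & exists2 K : R, 0 <= K &
  forall x, expR (w (l * x)) <= K * (decay x * expR (w (m * x))).
Proof.
move=> l0; have [A [H [A1 H1 hd]]] := wd.
have [K K0 hK] := weight_decay l0.
exists (H * l); first by rewrite ler_peMl// ltW.
exists (A * K) => [|x]; first by rewrite mulr_ge0//; lra.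
have A0 : 0 < A by lra.
have h : expR (w (l * x)) * expR (w (l * x)) <= A * expR (w (H * l * x)).
  rewrite -expRD -[A in leRHS](lnK (x := A)) ?posrE// -expRD ler_expR.
  have := hd `|l * x| (normr_ge0 _).
  have -> : w `|l * x| = w (l * x) by rewrite /weight_ext normr_id.
  have -> : w (H * `|l * x|) = w (H * l * x) by rewrite /weight_ext !normrM !normr_id !mulrA.
  lra.
have := hK x; set u := expR (w (l * x)) in h *; set v := expR _ in h *.
have u0 : 0 < u := expR_gt0 _.
move=> h2; rewrite -(ler_pM2l u0); apply: (le_trans h).
have Av : 0 <= A * v by rewrite mulr_ge0 ?expR_ge0// ltW.
have := ler_wpM2r Av h2; lra.
Qed.

(** As [w] is non-decreasing, the integrand of (epsilon)_0 is at least
    w(t) e^{- l (t + 1)} on [t, t + 1]. *)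
Lemma weight_exp_growth (we : cond_epsilon0 w) l : 0 < l -> exists2 K : R, 0 <= K &
  forall t, 0 <= t -> w t <= K * expR (l * t).
Proof.
move=> l0; have := we l l0.
set f := fun t : R => (w t * expR (- (l * t)))%:E => If.
have f0 t : (0 <= f t)%E by rewrite lee_fin mulr_ge0 ?w_ge0 ?expR_ge0.
have mf : measurable_fun (`[0, +oo[%classic : set (measurableTypeR R)) f.
  apply/measurable_EFinP; apply: measurable_funM.
    apply: (eq_measurable_fun (fun t => w (Num.max 0 t))).
      by move=> t; rewrite inE/= in_itv/= andbT => t0; rewrite max_r.
    apply: nondecreasing_measurable; first exact: measurable_itv.
    move=> s t st; apply: w_mono; rewrite !ger0_norm ?le_max ?lexx//.
    by case: (lerP 0 s); case: (lerP 0 t); lra.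
  apply: measurableT_comp; first exact: measurable_expR.
  apply: measurable_funTS; apply: continuous_measurable_fun.
  move=> t; apply: cvgN; apply: cvgZl_tmp; exact: cvg_id.
have [I IE] : exists I : R, (\int[mu]_(t in `[0%R, +oo[) f t)%E = I%:E.
  have := @integral_ge0 _ _ _ mu `[0%R, +oo[ f (fun t _ => f0 t).
  by move: If; case: (\int[mu]_(t in _) f t)%E => [I _ _|//|//]; exists I.
have Ige0 : 0 <= I by rewrite -lee_fin -IE integral_ge0.
exists (I * expR l) => [|t t0]; first by rewrite mulr_ge0// expR_ge0.
have mt : measurable (`[t, t + 1]%classic : set (measurableTypeR R)) by exact: measurable_itv.
have sub : `[t, t + 1] `<=` `[0%R, +oo[.
  by move=> s /=; rewrite !in_itv/= andbT => /andP[ts _]; lra.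
have : ((w t * expR (- (l * (t + 1))))%:E <= I%:E)%E.
  rewrite -IE; apply: (@le_trans _ _ (\int[mu]_(s in `[t, (t + 1)%R]) f s)%E); last first.
    by apply: ge0_subset_integral.
  have -> : (w t * expR (- (l * (t + 1))))%:E =
     (\int[mu]_(s in `[t, (t + 1)%R]) (w t * expR (- (l * (t + 1))))%:E)%E.
    have mE : mu `[t, (t + 1)%R] = 1%E.
      by rewrite lebesgue_measure_itv/= lte_fin ltrDl ltr01 -EFinB addrAC subrr add0r.
    rewrite -[LHS]mule1 -mE; apply/esym.
    exact: (@integral_cst _ _ _ mu _ mt (w t * expR (- (l * (t + 1))))%:E).
  apply: ge0_le_integral => //.
  - by move=> s _; rewrite lee_fin mulr_ge0 ?w_ge0 ?expR_ge0.
  - by apply: measurable_funS mf => //; exact: measurable_itv.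
  - move=> s /=; rewrite in_itv/= => /andP[ts st]; rewrite lee_fin.
    apply: ler_pM; rewrite ?w_ge0 ?expR_ge0//.
      by apply: w_mono; rewrite !ger0_norm//; lra.
    by rewrite ler_expR lerN2 ler_pM2l.
rewrite lee_fin => h.
have e : expR (- (l * (t + 1))) = (expR l * expR (l * t))^-1.
  by rewrite -expRD -expRN; congr expR; ring.
move: h; rewrite e ler_pdivrMr ?mulr_gt0 ?expR_gt0//; lra.
Qed.

End Weights.

(** * A test function that does not vanish at the origin *)

Section ComplexExponential.
Context {R : realType}.
Local Notation C := (cplx R).
Implicit Types (z h u : C).

Definition cexp z : C := Complex (expR (Re z) * cos (Im z)) (expR (Re z) * sin (Im z)).

Lemma normc_cexp z : normc (cexp z) = expR (Re z).
Proof.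
by rewrite /cexp /normc !exprMn -mulrDr cos2Dsin2 mulr1 sqrtr_sqr ger0_norm ?expR_ge0.
Qed.

Lemma cexpD z u : cexp (z + u) = cexp z * cexp u.
Proof.
rewrite /cexp cReD cImD expRD cosD sinD -[RHS]/(Complex (_ - _) (_ + _)).
by congr Complex; ring.
Qed.

Lemma cexp0 : cexp 0 = 1.
Proof. by rewrite /cexp /= expR0 cos0 sin0 mulr0 mulr1. Qed.

Lemma is_derive_approx (f : R -> R) (d : R) : is_derive (0 : R) (1 : R) f d ->
  forall e : R, 0 < e -> exists2 del : R, 0 < del &
    forall x : R, `|x| < del -> `|f x - f 0 - d * x| <= e * `|x|.
Proof.
move=> [df fd] e e0; move: df; rewrite /derivable => /cvg_ex[l hl].
have ld : l = d by rewrite -fd; apply/esym/cvg_lim.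
subst l; move/cvgrPdist_lt : hl => /(_ _ e0)[/= del del0 H].
exists del => // x xd; have [->|x0] := eqVneq x 0.
  by rewrite !subrr mulr0 subrr normr0 mulr0.
have := H x; rewrite /ball_/= sub0r normrN => /(_ xd x0) h.
rewrite addr0 in h; rewrite [x%:A]mulr1 in h.
have -> : f x - f 0 - d * x = - (d - x^-1 *: (f x - f 0)) * x.
  by rewrite /GRing.scale/=; field.
by rewrite normrM normrN ler_wpM2r// ltW.
Qed.

Lemma cexp_approx (e : R) : 0 < e -> exists2 del : R, 0 < del &
  forall h, normc h < del -> normc (cexp h - 1 - h) <= e * normc h.
Proof.
move=> e0; have [e1 [e10 e11 e1e]] : exists e1 : R, [/\ 0 < e1, e1 <= 1 & e1 <= e / 9].
  by exists (Num.min 1 (e / 9)); rewrite lt_min ltr01 divr_gt0// !ge_min !lexx orbT.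
have [d1 d10 h1] := is_derive_approx (@is_derive_expR R 0) e10.
have [d2 d20 h2] := is_derive_approx (@is_derive_cos R 0) e10.
have [d3 d30 h3] := is_derive_approx (@is_derive_sin R 0) e10.
exists (Num.min e1 (Num.min d1 (Num.min d2 d3))).
  by rewrite !lt_min e10 d10 d20 d30.
move=> h; rewrite !lt_min => /and4P[k1 k2 k3 k4].
have [nx ny] := conj (normc_Re h) (normc_Im h).
set r := normc h in nx ny k1 k2 k3 k4 *.
set x := Re h in nx *; set y := Im h in ny *.
have {}h1 := h1 x (le_lt_trans nx k2).
have {}h2 := h2 y (le_lt_trans ny k3).
have {}h3 := h3 y (le_lt_trans ny k4).
move: h1 h2 h3; rewrite ?expR0 ?cos0 ?sin0 ?mul1r ?oppr0 ?mul0r ?subr0 ?addr0 => h1 h2 h3.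
have r0 : 0 <= r := normc_ge0 _.
set E := expR x in h1 *; set c := cos y in h2 *; set s := sin y in h3 *.
have E0 : 0 < E := expR_gt0 x.
have E3 : E <= 3.
  move: h1; rewrite ler_norml => /andP[_]; have := ler_norm x.
  have : e1 * `|x| <= 1 * 1 by apply: ler_pM => //; [exact: ltW|lra].
  lra.
have Ea : `|E - 1| <= 2 * r.
  have -> : E - 1 = (E - 1 - x) + x by ring.
  apply: le_trans (ler_normD _ _) _.
  have : e1 * `|x| <= 1 * r by apply: ler_pM => //; exact: ltW.
  lra.
apply: le_trans (normc_ReIm _) _.
rewrite /cexp !cReD !cImD !cReN !cImN /= -/x -/y -/E -/c -/s subr0.
have -> : E * c - 1 - x = (E - 1 - x) + E * (c - 1) by ring.
have -> : E * s - y = E * (s - y) + (E - 1) * y by ring.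
apply: (@le_trans _ _ (e1 * r + 3 * (e1 * r) + (3 * (e1 * r) + 2 * r * e1))); last first.
  have : e1 * r <= e / 9 * r by rewrite ler_wpM2r.
  lra.
apply: lerD; apply: le_trans (ler_normD _ _) _; apply: lerD.
- by apply: le_trans h1 _; rewrite ler_wpM2l// ltW.
- rewrite normrM (gtr0_norm E0); apply: ler_pM => //; first exact: ltW.
  by apply: le_trans h2 _; rewrite ler_wpM2l// ltW.
- rewrite normrM (gtr0_norm E0); apply: ler_pM => //; first exact: ltW.
  by apply: le_trans h3 _; rewrite ler_wpM2l// ltW.
- by rewrite normrM; apply: ler_pM => //; apply: le_trans ny (ltW k1).
Qed.

Lemma hol_cexp z : hol cexp z.
Proof.
rewrite hol.unlock; apply/derivable_eps; exists (cexp z) => e e0.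
have p : 0 < e / (2 * expR (Re z)) by rewrite divr_gt0// mulr_gt0// expR_gt0.
have [del del0 H] := cexp_approx p; exists del => // h h0 /H le.
have -> : (cexp (z + h) - cexp z) / h - cexp z = cexp z * ((cexp h - 1 - h) / h).
  by rewrite cexpD; field.
rewrite normcM normcM normcV normc_cexp.
have nh : 0 < normc h by rewrite normc_gt0.
apply: (@le_lt_trans _ _ (expR (Re z) * (e / (2 * expR (Re z))))).
  by rewrite ler_wpM2l ?expR_ge0// ler_pdivrMr.
have -> : expR (Re z) * (e / (2 * expR (Re z))) = e / 2.
  by field; rewrite gt_eqF ?expR_gt0.
lra.
Qed.

End ComplexExponential.

Section Construction.
Context {R : realType}.
Local Notation C := (cplx R).
Implicit Types (z h u : C).

(** The Cauchy estimate for difference quotients passes to the limit, so that local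
    boundedness and pointwise convergence suffice. *)
Lemma hol_limit (Fn : nat -> C -> C) F z (rho M : R) (N : nat) : 0 < rho -> 0 <= M ->
  (forall n u, hol (Fn n) u) ->
  (forall n u, (N <= n)%N -> insq z rho u -> normc (Fn n u) <= M) ->
  (forall u e, 0 < e -> exists K, forall n, (K <= n)%N -> normc (F u - Fn n u) <= e) ->
  hol F z.
Proof.
move=> r0 M0 hF FM lim; have [A A0 hA] := @hol_quotients R _ r0.
apply: (@hol_of_quotients _ _ _ (rho / 2) (A * M)); [lra|by rewrite mulr_ge0|].
move=> h k h0 k0 hr kr; apply/ler_addgt0Pr => e e0.
have [nh nk] : 0 < normc h /\ 0 < normc k by rewrite !normc_gt0.
pose d := e / (2 * ((normc h)^-1 + (normc k)^-1)).
have d0 : 0 < d by rewrite divr_gt0// mulr_gt0// addr_gt0// invr_gt0.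
have [K1 hK1] := lim (z + h) d d0; have [K2 hK2] := lim (z + k) d d0.
have [K3 hK3] := lim z d d0.
pose n := maxn N (maxn K1 (maxn K2 K3)).
have nN : (N <= n)%N by rewrite leq_max leqnn.
have {}hK1 := hK1 n _; have {}hK2 := hK2 n _; have {}hK3 := hK3 n _.
have {}hK1 : normc (F (z + h) - Fn n (z + h)) <= d by apply: hK1; rewrite !leq_max leqnn ?orbT.
have {}hK2 : normc (F (z + k) - Fn n (z + k)) <= d by apply: hK2; rewrite !leq_max leqnn ?orbT.
have {}hK3 : normc (F z - Fn n z) <= d by apply: hK3; rewrite !leq_max leqnn ?orbT.
have := hA (Fn n) z M h k (fun u _ => hF n u) (fun u us => FM n u nN us) h0 k0 (ltW hr) (ltW kr).
set a := F (z + h) in hK1 *; set b := F (z + k) in hK2 *; set c := F z in hK3 *.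
set a' := Fn n (z + h) in hK1 *; set b' := Fn n (z + k) in hK2 *; set c' := Fn n z in hK3 *.
move=> q.
have -> : (a - c) / h - (b - c) / k =
   ((a' - c') / h - (b' - c') / k) + (((a - a') - (c - c')) / h - ((b - b') - (c - c')) / k) by ring.
apply: le_trans (le_normcD _ _) _; apply: lerD.
  apply: le_trans q _; apply: ler_wpM2l; [by rewrite mulr_ge0|exact: ler_normcB].
apply: le_trans (ler_normcB _ _) _; rewrite !normcM !normcV.
have E : e = (2 * d) / normc h + (2 * d) / normc k.
  by rewrite /d; field; rewrite ?gt_eqF ?addr_gt0.
rewrite E; apply: lerD; apply: ler_wpM2r; rewrite ?invr_ge0 ?normc_ge0//;
  apply: le_trans (ler_normcB _ _) _; lra.
Qed.

(** After division by [a] the number is 1 + it with m |t| at most 1/4, and by induction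
    its k-th power is within 2 k |t| of 1. *)
Lemma Re_exprn (a b : R) (m : nat) : 0 < a -> m%:R * `|b| <= a / 4 ->
  a ^+ m / 2 <= Re ((Complex a b : C) ^+ m).
Proof.
move=> a0 mb; pose t := b / a; pose u : C := Complex 1 t.
have tm : m%:R * `|t| <= 1 / 4.
  rewrite /t normrM normfV (gtr0_norm a0) mulrA ler_pdivrMr//; lra.
have H k : (k <= m)%N -> normc (u ^+ k - 1) <= 2 * (k%:R * `|t|).
  elim: k => [|k IH] km; first by rewrite expr0 subrr (@normc0 R) mul0r mulr0.
  have {}IH := IH (ltnW km).
  have kt : k%:R * `|t| <= 1 / 4.
    by apply: le_trans tm; rewrite ler_wpM2r// ler_nat ltnW.
  have nt := normr_ge0 t.
  have -> : u ^+ k.+1 - 1 = (u ^+ k - 1) * u + Complex 0 t.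
    have uE : u = 1 + Complex 0 t.
      by apply/eqP; rewrite eq_complex /=; apply/andP; split; apply/eqP; ring.
    by rewrite exprSr; set v := u ^+ k; rewrite uE; ring.
  apply: le_trans (le_normcD _ _) _.
  have n1 : normc (Complex 0 t) = `|t| by rewrite /= expr0n/= add0r sqrtr_sqr.
  have n2 : normc u <= 1 + `|t|.
    by apply: le_trans (normc_ReIm _) _; rewrite /= normr1.
  rewrite n1 normcM -natr1.
  apply: (@le_trans _ _ (2 * (k%:R * `|t|) * (1 + `|t|) + `|t|)).
    by rewrite lerD2r; apply: ler_pM; rewrite ?normc_ge0.
  nra.
have -> : (Complex a b : C) = Complex a 0 * u.
  by apply/eqP; rewrite eq_complex /= /t; apply/andP; split; apply/eqP; field; lra.
have -> : (Complex a 0 * u) ^+ m = Complex (a ^+ m) 0 * u ^+ m.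
  rewrite exprMn; congr (_ * _); elim: m {mb tm H} => [|k IH]; first by rewrite !expr0.
  rewrite !exprS IH; apply/eqP; rewrite eq_complex /=; apply/andP; split; apply/eqP; ring.
rewrite cReM /= mul0r subr0 ler_wpM2l ?exprn_ge0 ?(ltW a0)//.
have := H m (leqnn m); have := normc_Re (u ^+ m - 1).
rewrite cReD cReN /= ler_norml => /andP[h1 _] h2; lra.
Qed.

Lemma lin_le_exp2 (c e : R) : 0 < e ->
  exists J : nat, forall j, (J <= j)%N -> j%:R + c <= e * 2 ^+ j.
Proof.
move=> e0; have sq j : (j * j <= 2 ^ j.+1)%N.
  case: j => // -[//|] -[//|j]; elim: j => // j IH.
  rewrite expnS; apply: (@leq_trans (2 * (j.+3 * j.+3))); last by rewrite leq_mul2l.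
  by rewrite !mulSn !mulnS; lia.
have q0 : 0 <= `|c| + 4 / e by rewrite addr_ge0// divr_ge0// ltW.
exists (Num.bound (`|c| + 4 / e)) => j jJ.
have jc : `|c| + 4 / e <= j%:R by apply: le_trans (ltW (archi_boundP q0)) _; rewrite ler_nat.
have h1 : c <= j%:R.
  have := ler_norm c; have : 0 <= 4 / e by rewrite divr_ge0// ltW.
  lra.
have h2 : 4 <= e * j%:R.
  rewrite mulrC -ler_pdivrMr//; have := normr_ge0 c; lra.
have h3 : j%:R * j%:R <= 2 * 2 ^+ j :> R by rewrite -exprS -natrM -natrX ler_nat.
have j0 : 0 <= j%:R :> R by [].
have : e * (j%:R * j%:R) <= e * (2 * 2 ^+ j) by rewrite ler_pM2l.
nra.
Qed.

(** The n-th sequence enters the maximum from the index on from which it is below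
    2^j/(n + 1). *)
Lemma diagonal (a : nat -> nat -> nat) :
  (forall n (e : R), 0 < e -> exists J : nat, forall j, (J <= j)%N -> (a n j)%:R <= e * 2 ^+ j) ->
  exists m : nat -> nat,
    (forall e : R, 0 < e -> exists J : nat, forall j, (J <= j)%N -> (m j)%:R <= e * 2 ^+ j) /\
    (forall n, exists J : nat, forall j, (J <= j)%N -> (a n j <= m j)%N).
Proof.
move=> ha; have inv0 n : 0 < (n.+1%:R : R)^-1 by rewrite invr_gt0 ltr0n.
have /choice[J hJ] : forall n, exists J : nat, forall j, (J <= j)%N ->
    (a n j)%:R <= (n.+1%:R : R)^-1 * 2 ^+ j by move=> n; exact: ha.
pose m j := (\max_(n < j.+1 | (J n <= j)%N) a n j)%N.
exists m; split=> [e e0|n]; last first.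
  exists (maxn n (J n)) => j; rewrite geq_max => /andP[nj Jj].
  have nj' : (n < j.+1)%N by [].
  exact: (@leq_bigmax_cond _ (fun i : 'I_j.+1 => (J i <= j)%N) (fun i => a i j) (Ordinal nj')).
have q0 : 0 <= e^-1 by rewrite invr_ge0 ltW.
pose N := Num.bound e^-1.
have /choice[L hL] : forall n, exists L : nat, forall j, (L <= j)%N -> (a n j)%:R <= e * 2 ^+ j.
  by move=> n; exact: ha.
exists (\max_(n < N) L n)%N => j jL.
have e2 : 0 <= e * 2 ^+ j by rewrite mulr_ge0 ?exprn_ge0// ltW.
apply: (big_ind (fun x : nat => x%:R <= e * 2 ^+ j)) => //= [x y hx hy|i Ji].
  by rewrite /maxn; case: ifP.
have [iN|Ni] := ltnP i N.
  by apply: hL; apply: leq_trans jL; exact: (@leq_bigmax _ (fun i : 'I_N => L i) (Ordinal iN)).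
apply: le_trans (hJ _ _ Ji) _; rewrite ler_wpM2r ?exprn_ge0//.
rewrite -[e in leRHS]invrK lef_pV2 ?posrE ?invr_gt0 ?ltr0n//.
apply: le_trans (ltW (archi_boundP q0)) _; rewrite ler_nat.
exact: leq_trans Ni (leqnSn _).
Qed.

(** By (epsilon)_0 the weight grows more slowly than every exponential, so for each n the
    logarithm of w(n 2^{j+3}) is o(2^j); one diagonal sequence serves all n. *)
Lemma exponents (w : weight R) : cond_epsilon0 w -> exists m : nat -> nat,
  (forall e : R, 0 < e -> exists J : nat, forall j, (J <= j)%N -> (m j)%:R <= e * 2 ^+ j) /\
  (forall n, exists J : nat, forall j, (J <= j)%N ->
    2 ^+ j.+1 * w (n%:R * 2 ^+ j.+3) <= expR (m j)%:R).
Proof.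
move=> we; pose W n j := 1 + w (n%:R * 2 ^+ j.+3) : R.
have W1 n j : 1 <= W n j by rewrite lerDl w_ge0.
pose a n j := (j + 2 + Num.truncn (ln (W n j)))%N.
have ln0 n j : 0 <= ln (W n j) by rewrite ln_ge0.
have [|m [m1 m2]] := @diagonal a.
  move=> n e e0; have n1 : 0 < n.+1%:R :> R by rewrite ltr0n.
  have l0 : 0 < e / (16 * n.+1%:R) by rewrite divr_gt0// mulr_gt0.
  have [K K0 hK] := weight_exp_growth we l0.
  have [|J hJ] := @lin_le_exp2 (2 + ln (K + 1)) (e / 2); first lra.
  exists J => j /hJ h; rewrite /a !natrD.
  have [t1 _] := andP (truncn_itv (ln0 n j)).
  have W2 : ln (W n j) <= ln (K + 1) + e / (16 * n.+1%:R) * (n%:R * 2 ^+ j.+3).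
    have p : 0 <= n%:R * 2 ^+ j.+3 :> R by rewrite mulr_ge0// exprn_ge0.
    rewrite -[leRHS]expRK ler_ln ?posrE ?expR_gt0//; last by have := W1 n j; lra.
    rewrite expRD lnK ?posrE; last lra.
    have := hK _ p; have : 1 <= expR (e / (16 * n.+1%:R) * (n%:R * 2 ^+ j.+3)).
      by rewrite -[leLHS]expR0 ler_expR; exact: mulr_ge0 (ltW l0) p.
    rewrite /W; lra.
  have q : e / (16 * n.+1%:R) * (n%:R * 2 ^+ j.+3) <= e / 2 * 2 ^+ j.
    rewrite !exprS.
    have -> : e / (16 * n.+1%:R) * (n%:R * (2 * (2 * (2 * 2 ^+ j)))) =
       (n%:R / n.+1%:R) * (e / 2 * 2 ^+ j) by field; lra.
    rewrite -[leRHS]mul1r ler_wpM2r//; first by rewrite mulr_ge0 ?exprn_ge0//; lra.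
    by rewrite ler_pdivrMr// mul1r ler_nat.
  move: q W2 t1; set u := e / _ * (n%:R * _); set t := (Num.truncn _)%:R.
  by move=> q W2 t1; lra.
exists m; split=> // n; have [J hJ] := m2 n; exists J => j /hJ aj.
have [_ t2] := andP (truncn_itv (ln0 n j)).
apply: (@le_trans _ _ (expR (a n j)%:R)); last by rewrite ler_expR ler_nat.
have e2 : 2 <= expR 1 :> R by have := expR_ge1Dx (1 : R); lra.
have h1 : 2 ^+ j.+1 <= expR j.+1%:R :> R.
  by rewrite -[j.+1%:R]mulr1 expRM_natl lerXn2r ?nnegrE ?expR_ge0.
have h2 : w (n%:R * 2 ^+ j.+3) <= expR (Num.truncn (ln (W n j))).+1%:R.
  apply: (@le_trans _ _ (W n j)); first by rewrite /W lerDr.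
  rewrite -[leLHS](lnK (x := W n j)) ?ler_expR ?ltW// posrE.
  by have := W1 n j; lra.
apply: le_trans (ler_pM _ _ h1 h2) _; rewrite ?exprn_ge0 ?w_ge0//.
by rewrite -expRD ler_expR -natrD ler_nat /a; lia.
Qed.

Section Gauge.
Variable m : nat -> nat.
Hypothesis m_small : forall e : R, 0 < e ->
  exists J : nat, forall j, (J <= j)%N -> (m j)%:R <= e * 2 ^+ j.

Let cj j : R := (2 ^+ j * 2 ^+ m j)^-1.
(** The terms of the series G. For |z| at most 2^j the j-th one is at most 2^-j. Far out in a
    strip 1 + z^2/4^j has small argument, even after taking the m_j-th power since m_j = o(2^j). *)
Let T j z : C := Complex (cj j) 0 * (1 + z ^+ 2 * Complex ((2 ^+ j * 2 ^+ j)^-1) 0) ^+ m j.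
Let Gn n z : C := \sum_(j < n) T j z.

Let p2 k : 0 < 2 ^+ k :> R. Proof. by rewrite exprn_gt0. Qed.

Let cj0 j : 0 < cj j. Proof. by rewrite invr_gt0 mulr_gt0. Qed.

Let holT j z : hol (T j) z.
Proof.
apply: holM; first exact: hol_cst.
apply: (@holX _ (fun z => 1 + z ^+ 2 * Complex ((2 ^+ j * 2 ^+ j)^-1) 0)).
apply: holD; first exact: hol_cst.
apply: holM; last exact: hol_cst.
by apply: (@holX _ (fun z => z)); exact: hol_id.
Qed.

Let holGn n z : hol (Gn n) z.
Proof. exact: hol_sum. Qed.

Lemma normcX z k : normc (z ^+ k) = normc z ^+ k.
Proof.
elim: k => [|k IH]; first by rewrite !expr0 (@normc1 R).
by rewrite !exprS normcM IH.
Qed.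

Let normT j z : normc (T j z) <= cj j * (1 + normc z ^+ 2 / (2 ^+ j * 2 ^+ j)) ^+ m j.
Proof.
rewrite normcM normc_real gtr0_norm// ler_wpM2l ?(ltW (cj0 _))// normcX.
rewrite lerXn2r ?nnegrE ?normc_ge0 ?addr_ge0 ?divr_ge0 ?exprn_ge0 ?normc_ge0 ?mulr_ge0 ?(ltW (p2 _))//.
apply: le_trans (le_normcD _ _) _; rewrite (@normc1 R) normcM normcX normc_real.
by rewrite ger0_norm// invr_ge0 mulr_ge0// ltW.
Qed.

Let normT_small j z : normc z <= 2 ^+ j -> normc (T j z) <= (2 ^+ j)^-1.
Proof.
move=> zj; apply: le_trans (normT _ _) _.
have -> : (2 ^+ j)^-1 = cj j * 2 ^+ m j by rewrite /cj invfM mulfVK// gt_eqF.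
rewrite ler_wpM2l ?(ltW (cj0 _))// lerXn2r ?nnegrE//.
  by rewrite addr_ge0// divr_ge0 ?sqr_ge0// mulr_ge0// ltW.
have : normc z ^+ 2 / (2 ^+ j * 2 ^+ j) <= 1.
  by rewrite ler_pdivrMr ?mulr_gt0// mul1r expr2 ler_pM ?normc_ge0.
lra.
Qed.

Let Gn_cauchy n k z : normc z <= 2 ^+ n -> (n <= k)%N ->
  normc (Gn k z - Gn n z) <= 2 * (2 ^+ n)^-1 - 2 * (2 ^+ k)^-1.
Proof.
move=> zn /subnK <-; elim: (k - n)%N => [|i IH]; first by rewrite add0n !subrr (@normc0 R).
rewrite addSn /Gn big_ord_recr/= -/(Gn (i + n) z).
have -> : Gn (i + n) z + T (i + n) z - \sum_(j < n) T j z =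
   (Gn (i + n) z - Gn n z) + T (i + n) z by rewrite /Gn; ring.
apply: le_trans (le_normcD _ _) _.
have : normc (T (i + n) z) <= (2 ^+ (i + n))^-1.
  apply: normT_small; apply: le_trans zn _.
  by apply: ler_weXn2l; [rewrite ler1n|exact: leq_addl].
have -> : 2 * (2 ^+ (i + n).+1)^-1 = (2 ^+ (i + n))^-1 :> R.
  by rewrite exprS invfM mulrA divff ?mul1r.
lra.
Qed.

Let Gn_bounded (r : R) : exists2 M : R, 0 <= M & forall n z, normc z <= r -> normc (Gn n z) <= M.
Proof.
have r0 : 0 <= `|r| by [].
pose n0 := Num.bound `|r|.
have hr : r <= 2 ^+ n0.
  apply: le_trans (ler_norm _) _; apply: le_trans (ltW (archi_boundP r0)) _.
  by rewrite -natrX ler_nat ltnW// ltn_expl.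
pose S n := \sum_(j < n) cj j * (1 + `|r| ^+ 2 / (2 ^+ j * 2 ^+ j)) ^+ m j.
have S1 j : 0 <= cj j * (1 + `|r| ^+ 2 / (2 ^+ j * 2 ^+ j)) ^+ m j.
  by rewrite mulr_ge0 ?(ltW (cj0 _))// exprn_ge0// addr_ge0// divr_ge0 ?sqr_ge0// mulr_ge0// ltW.
have q2 (u : R) j : 0 <= 1 + u ^+ 2 / (2 ^+ j * 2 ^+ j).
  by rewrite addr_ge0// divr_ge0 ?sqr_ge0// mulr_ge0// ltW.
have S0 n : 0 <= S n by apply: sumr_ge0.
have GS n z : normc z <= r -> normc (Gn n z) <= S n.
  move=> zr; elim: n => [|n IH]; first by rewrite /Gn /S !big_ord0 (@normc0 R).
  rewrite /Gn /S !big_ord_recr/=; apply: le_trans (le_normcD _ _) _; apply: lerD => //.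
  apply: le_trans (normT _ _) _; rewrite ler_wpM2l ?(ltW (cj0 _))// lerXn2r ?nnegrE ?q2//.
    rewrite lerD2l ler_wpM2r ?invr_ge0 ?mulr_ge0 ?(ltW (p2 _))//.
    by rewrite lerXn2r ?nnegrE ?normc_ge0//; apply: le_trans zr (ler_norm _).
have Smono a b : (a <= b)%N -> S a <= S b.
  by move=> /subnK <-; elim: (b - a)%N => // k IH; rewrite addSn /S big_ord_recr/= -/(S _) ler_wpDr.
exists (S n0 + 2) => [|n z zr]; first by have := S0 n0; lra.
have [nn|nn] := leqP n n0.
  by apply: le_trans (GS n z zr) _; have := Smono _ _ nn; lra.
have -> : Gn n z = (Gn n z - Gn n0 z) + Gn n0 z by rewrite subrK.
apply: le_trans (le_normcD _ _) _; rewrite addrC; apply: lerD; first exact: GS.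
apply: le_trans (Gn_cauchy (le_trans zr hr) (ltnW nn)) _.
have : (2 ^+ n0)^-1 <= 1 :> R by rewrite invf_le1// exprn_ege1// ler1n.
have : 0 < (2 ^+ n)^-1 :> R by rewrite invr_gt0.
lra.
Qed.

Let G_ex z : exists g : C, forall n, normc z <= 2 ^+ n -> normc (Gn n z - g) <= 4 * (2 ^+ n)^-1.
Proof.
have [|s t As At|d hd] := @approx_limit R nat [set n | normc z <= 2 ^+ n] (Gn^~ z)
    (fun n => 2 * (2 ^+ n)^-1).
- exists (Num.bound (normc z)) => /=; apply: le_trans (ltW (archi_boundP (normc_ge0 z))) _.
  by rewrite -natrX ler_nat ltnW// ltn_expl.
- have [q1 q2] : 0 < (2 ^+ s)^-1 :> R /\ 0 < (2 ^+ t)^-1 :> R by rewrite !invr_gt0.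
  have [st|/ltnW ts] := leqP s t.
    by rewrite normcB; have := Gn_cauchy As st; lra.
  by have := Gn_cauchy At ts; lra.
- by exists d => n /hd; lra.
Qed.

Let small_pow (e : R) : 0 < e -> exists K : nat, forall n, (K <= n)%N -> 4 * (2 ^+ n)^-1 <= e.
Proof.
move=> e0; have [J hJ] := @lin_le_exp2 4 e e0; exists J => n /hJ h.
by rewrite ler_pdivrMr//; have : 0 <= n%:R :> R by []; lra.
Qed.

(** Far out in a strip all terms have nonnegative real part, and where |Re z| is at least
    4 * 2^j the j-th term alone makes the real part of G as large as e^{m_j} 2^{-j-1}. *)
Lemma gauge_function : exists G : C -> C, [/\ (forall z, hol G z),
  (forall r : R, exists M : R, forall z, normc z <= r -> normc (G z) <= M) &
  forall h : R, 0 < h -> exists X : R, forall z j, `|Im z| <= h -> X <= `|Re z| ->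
    4 * 2 ^+ j <= `|Re z| -> expR (m j)%:R <= 2 ^+ j.+1 * Re (G z)].
Proof.
have [G hG] := choice G_ex; exists G.
have lim z e : 0 < e -> exists K : nat, forall n, (K <= n)%N -> normc (G z - Gn n z) <= e.
  move=> e0; have [K hK] := small_pow e0.
  exists (maxn K (Num.bound (normc z))) => n; rewrite geq_max => /andP[Kn zn].
  rewrite normcB; apply: le_trans (hG z n _) (hK _ Kn).
  apply: le_trans (ltW (archi_boundP (normc_ge0 z))) _.
  by rewrite -natrX ler_nat (leq_trans zn)// ltnW// ltn_expl.
split.
- move=> z; have [M M0 hM] := Gn_bounded (normc z + 2).
  apply: (@hol_limit Gn G z 1 M 0) => // n u _ /insqP[h1 h2]; apply: hM.
  have -> : u = z + (u - z) by rewrite addrC subrK.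
  apply: le_trans (le_normcD _ _) _; rewrite lerD2l.
  by apply: le_trans (normc_ReIm _) _; lra.
- move=> r; have [M M0 hM] := Gn_bounded r; exists (M + 1) => z zr.
  have [K hK] := lim z 1 ltr01; have := hK K (leqnn K).
  have := le_normcD (G z - Gn K z) (Gn K z); rewrite subrK.
  have := hM K z zr; lra.
- move=> h h0; have h8 : 0 < (8 * h)^-1 by rewrite invr_gt0; lra.
  have [J hJ] := m_small h8.
  (* The finitely many j for which m_j is not yet small compared with 2^j are absorbed by
     the lower bound on |Re z|. *)
  pose Mx : R := \sum_(j < J) (m j)%:R.
  have Mx0 : 0 <= Mx by apply: sumr_ge0.
  have mM j : (j < J)%N -> (m j)%:R <= Mx.
    move=> jJ; rewrite /Mx (bigD1 (Ordinal jJ))//= lerDl; exact: sumr_ge0.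
  exists (1 + 2 * h + 16 * Mx * h) => z j zh zX zj.
  case: z zh zX zj => x y /= zh zX zj.
  have p : 0 <= 16 * Mx * h by rewrite mulr_ge0 ?mulr_ge0// ltW.
  have x1 : 1 <= `|x| by lra.
  have y0 : 0 <= `|y| by [].
  have xx : x ^+ 2 = `|x| ^+ 2 by rewrite real_normK ?num_real.
  have yy : y ^+ 2 = `|y| ^+ 2 by rewrite real_normK ?num_real.
  have yx : y ^+ 2 <= x ^+ 2 / 2 by rewrite xx yy; nra.
  pose a i : R := 1 + (x ^+ 2 - y ^+ 2) / (2 ^+ i * 2 ^+ i).
  pose b i : R := 2 * x * y / (2 ^+ i * 2 ^+ i).
  have TE i : T i (Complex x y) = Complex (cj i) 0 * (Complex (a i) (b i)) ^+ m i.
    rewrite /T; congr (_ * _ ^+ _); apply/eqP; rewrite eq_complex /= /a /b; apply/andP.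
    by split; apply/eqP; ring.
  have a1 i : 1 <= a i.
    rewrite lerDl; apply: divr_ge0; last exact: mulr_ge0 (ltW (p2 _)) (ltW (p2 _)).
    by have := sqr_ge0 x; lra.
  have ReT i : cj i * (a i ^+ m i / 2) <= Re (T i (Complex x y)).
    rewrite TE cReM /= mul0r subr0 ler_wpM2l ?(ltW (cj0 _))//; apply: Re_exprn.
      by have := a1 i; lra.
    rewrite /a /b; set Q := 2 ^+ i; have Q0 : 0 < Q by rewrite /Q.
    have -> : (1 + (x ^+ 2 - y ^+ 2) / (Q * Q)) / 4 = (Q * Q + x ^+ 2 - y ^+ 2) / 4 / (Q * Q).
      by field; lra.
    rewrite normrM normfV [ `|Q * Q|]gtr0_norm ?mulr_gt0// mulrA ler_wpM2r//.
      by rewrite invr_ge0 mulr_ge0// ltW.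
    rewrite !normrM normr_nat.
    have mm0 : 0 <= (m i)%:R :> R by [].
    apply: (@le_trans _ _ ((m i)%:R * (2 * `|x| * h))).
      by rewrite ler_wpM2l// ler_wpM2l// mulr_ge0.
    have [iJ|/hJ] := ltnP i J.
      have := mM i iJ => mi; have : (m i)%:R * (2 * `|x| * h) <= Mx * (2 * `|x| * h).
        by rewrite ler_wpM2r// mulr_ge0 ?mulr_ge0// ltW.
      have : 0 <= Q * Q by rewrite mulr_ge0// ltW.
      have : 16 * Mx * h * `|x| <= `|x| * `|x| by rewrite ler_wpM2r//; lra.
      rewrite xx in yx *; nra.
    rewrite -/Q => mi; have : (m i)%:R * (2 * `|x| * h) <= (8 * h)^-1 * Q * (2 * `|x| * h).
      by rewrite ler_wpM2r// mulr_ge0 ?mulr_ge0// ltW.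
    have -> : (8 * h)^-1 * Q * (2 * `|x| * h) = Q * `|x| / 4 by field; lra.
    have := sqr_ge0 (Q - `|x|); rewrite xx in yx *; nra.
  have ReT0 i : 0 <= Re (T i (Complex x y)).
    apply: le_trans (ReT i); rewrite mulr_ge0 ?(ltW (cj0 _))// divr_ge0// exprn_ge0//.
    by have := a1 i; lra.
  have ReGn n : (j < n)%N -> cj j * (a j ^+ m j / 2) <= Re (Gn n (Complex x y)).
    move=> jn; apply: le_trans (ReT j) _; rewrite /Gn (bigD1 (Ordinal jn))//= cReD lerDl.
    by apply: (big_ind (fun u : C => 0 <= Re u)) => // u v; rewrite cReD; exact: addr_ge0.
  have ReG : cj j * (a j ^+ m j / 2) <= Re (G (Complex x y)).
    apply/ler_addgt0Pr => e e0; have [K hK] := lim (Complex x y) e e0.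
    have := hK (maxn K j.+1) (leq_maxl _ _) => hn.
    have := ReGn (maxn K j.+1) (leq_maxr _ _).
    have := le_trans (normc_Re _) hn; rewrite cReD cReN ler_norml => /andP[+ _]; lra.
  rewrite -ler_pdivrMl//; apply: le_trans ReG.
  (* At 4 * 2^j <= |x| with y^2 at most half of x^2, a_j is at least 9, and e is at most 4. *)
  have a9 : 2 * expR 1 <= a j.
    have e4 : expR 1 <= 4 :> R.
      have h2 : 2^-1 <= expR (- 2^-1) :> R by apply: le_trans (expR_ge1Dx _); lra.
      have : expR (2^-1) <= 2 :> R.
        by rewrite -[leRHS]invrK -[expR _]invrK -expRN lef_pV2 ?posrE ?expR_gt0 ?invr_gt0.
      move=> h3; have -> : (1 : R) = 2^-1 + 2^-1 by lra.
      rewrite expRD; have := expR_ge0 (2^-1 : R); nra.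
    apply: (@le_trans _ _ 9); first lra.
    rewrite /a -lerBlDl ler_pdivlMr ?mulr_gt0//; have := p2 j; rewrite xx in yx *; nra.
  have -> : (2 ^+ j.+1)^-1 * expR (m j)%:R = cj j * ((2 * expR 1) ^+ m j / 2).
    rewrite exprMn -expRM_natl mulr1 /cj exprS; field.
    by rewrite !gt_eqF.
  rewrite ler_wpM2l ?(ltW (cj0 _))// ler_wpM2r// lerXn2r ?nnegrE//.
  by have := a1 j; lra.
Qed.

End Gauge.

Lemma dyadic (t : R) : 4 <= t -> exists j : nat, 4 * 2 ^+ j <= t < 2 ^+ j.+3.
Proof.
move=> t4; have t0 : 0 <= t by lra.
have ex : exists n, t < 2 ^+ n.+3.
  exists (Num.bound t); apply: lt_le_trans (archi_boundP t0) _.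
  by rewrite -natrX ler_nat; apply: leq_trans (ltnW (ltn_expl _ (ltnSn 1))) _; rewrite leq_exp2l// -addn3 leq_addr.
have [n nP nmin] := ex_minnP ex; exists n; rewrite nP andbT.
case: n nP nmin => [|n] nP nmin; first by rewrite expr0 mulr1.
have -> : 4 * 2 ^+ n.+1 = 2 ^+ n.+3 :> R by rewrite !exprS; ring.
by rewrite leNgt; apply/negP => /nmin; rewrite ltnn.
Qed.

(** With G the gauge of the exponents found above, exp (G(0) - G) is a test function: at
    |Re z| between 4 * 2^j and 8 * 2^j the real part of G is at least w(n 2^{j+3}), hence
    at least w(l Re z) as soon as n is at least l. *)
Lemma test_function (w : weight R) : cond_epsilon0 w -> exists phi : C -> C,
  [/\ (forall z, hol phi z), phi 0 = 1 & forall h l : R, 0 < h -> 0 < l ->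
    exists2 K : R, 0 <= K & forall z, `|Im z| <= h -> normc (phi z) * expR (w (l * Re z)) <= K].
Proof.
move=> we; have [m [m1 m2]] := exponents we.
have [G [hG bG gG]] := gauge_function m1.
exists (fun z => cexp (G 0 - G z)); split.
- move=> z; apply: (@hol_comp _ (fun z => G 0 - G z)); last exact: hol_cexp.
  by apply: holB => //; exact: hol_cst.
- by rewrite subrr cexp0.
- move=> h l h0 l0; have [X hX] := gG h h0.
  pose n := Num.bound l; have ln : l <= n%:R := ltW (archi_boundP (ltW l0)).
  have [J hJ] := m2 n.
  pose r := Num.max X (2 ^+ J.+3); have [Xr Jr] : X <= r /\ 2 ^+ J.+3 <= r.
    by rewrite /r !le_max !lexx orbT.
  have r8 : 8 <= r.
    apply: le_trans Jr; rewrite -[8]/(8%:R) (_ : 8 = 2 ^ 3)%N// natrX.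
    by rewrite ler_eXn2l// ?ltr1n.
  have [M hM] := bG (r + h).
  exists (expR (Re (G 0)) * Num.max 1 (expR (M + w (l * r)))) => [|z zh].
    by rewrite mulr_ge0 ?expR_ge0// le_max ler01.
  rewrite normc_cexp cReD cReN expRD -mulrA ler_wpM2l ?expR_ge0// -expRD.
  have [zr|rz] := lerP `|Re z| r.
    rewrite le_max; apply/orP; right; rewrite ler_expR; apply: lerD.
      have := normc_Re (- G z); rewrite cReN normcN => /(le_trans (ler_norm _)).
      move=> /le_trans; apply; apply: hM; apply: le_trans (normc_ReIm _) _; lra.
    by apply: w_mono; rewrite !normrM; apply: ler_wpM2l => //; apply: le_trans zr (ler_norm _).
  rewrite le_max; apply/orP; left; rewrite -[leRHS]expR0 ler_expR.
  have [|j /andP[j1 j2]] := @dyadic `|Re z|; first lra.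
  have Jj : (J <= j)%N.
    have : 2 ^+ J.+3 < 2 ^+ j.+3 :> R by lra.
    by rewrite ltr_eXn2l ?ltr1n// !ltnS; exact: ltnW.
  have k1 := hX z j zh (le_trans Xr (ltW rz)) j1.
  have k2 := hJ j Jj.
  have k3 : w (l * Re z) <= w (n%:R * 2 ^+ j.+3).
    apply: w_mono; rewrite normrM [leRHS]normrM; apply: ler_pM => //.
      by rewrite normr_nat ger0_norm// ltW.
    by rewrite [leRHS]ger0_norm ?exprn_ge0// ltW.
  have := le_trans k2 k1; rewrite ler_pM2l ?exprn_gt0//; lra.
Qed.

End Construction.

(** * Bounds in place of seminorms *)

Section TestTopology.
Context {R : realType} (w : weight R).
Local Notation C := (cplx R).
Local Notation U := (test_space w).
Implicit Types (h l e M b r : R) (z : C).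

Lemma stripE h z : strip h z <-> `|Im z| < h.
Proof. by rewrite ltr_norml. Qed.

(** An upper bound for the norm of [psi] on the strip of half-width [h]; bounds, rather than
    suprema, keep the extended reals away. *)
Definition test_bound (psi : C -> C) h l M :=
  forall z, `|Im z| < h -> normc (psi z) * expR (w (l * Re z)) <= M.

Lemma test_bound_ge0 psi h l M : 0 < h -> test_bound psi h l M -> 0 <= M.
Proof.
move=> h0 /(_ 0); rewrite normr0 => /(_ h0); apply: le_trans.
by rewrite mulr_ge0 ?normc_ge0 ?expR_ge0.
Qed.

Lemma test_boundS psi h h' l l' M M' : h' <= h -> 0 <= l' -> l' <= l -> M <= M' ->
  test_bound psi h l M -> test_bound psi h' l' M'.
Proof.
move=> hh l0 ll MM H z zh; apply: le_trans (le_trans (H z (lt_le_trans zh hh)) MM).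
by apply: ler_wpM2l; [exact: normc_ge0|rewrite ler_expR; exact: le_weight_ext].
Qed.

Lemma test_norm_bound psi h l e : (test_norm w h l psi < e%:E)%E ->
  exists2 M, M < e & test_bound psi h l M.
Proof.
have ub z : `|Im z| < h -> ((normc (psi z) * expR (w (l * Re z)))%:E <= test_norm w h l psi)%E.
  by move=> zh; apply: ereal_sup_ubound; exists z => //; apply/stripE.
case: (test_norm w h l psi) ub => [M| |] ub.
- rewrite lte_fin => Me; exists M => // z /ub; by rewrite lee_fin.
- by rewrite ltNge leey.
- by move=> _; exists (e - 1); [lra|move=> z /ub; rewrite leeNy_eq].
Qed.

Lemma test_bound_norm psi h l M e : test_bound psi h l M -> M < e -> (test_norm w h l psi < e%:E)%E.
Proof.
move=> H Me; apply: (@le_lt_trans _ _ M%:E); last by rewrite lte_fin.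
by apply: ge_ereal_sup => _ [z /stripE zh <-]; rewrite lee_fin; exact: H.
Qed.

Lemma is_testP psi : is_test w psi <-> (forall z, hol psi z) /\
  forall h l, 0 < h -> 0 < l -> exists M, test_bound psi h l M.
Proof.
split=> [[/analytic_onE h1 h2]|[h1 h2]]; split.
- by move=> z; apply: h1.
- move=> h l h0 l0; have /wsup_ltyP[M hM] := h2 h l h0 l0.
  by exists M => z /stripE; exact: hM.
- by apply/analytic_onE => z _; exact: h1.
- move=> h l h0 l0; have [M hM] := h2 h l h0 l0.
  by apply/wsup_ltyP; exists M => z /stripE; exact: hM.
Qed.

Lemma testP (psi : U) : (forall z, hol (\val psi) z) /\
  forall h l, 0 < h -> 0 < l -> exists M, test_bound (\val psi) h l M.
Proof. by apply/is_testP; case: psi => psi /= /asboolP. Qed.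

Lemma test_exists (psi : C -> C) : (forall z, hol psi z) ->
  (forall h l, 0 < h -> 0 < l -> exists M, test_bound psi h l M) ->
  exists u : U, \val u = psi.
Proof.
move=> h1 h2; have p : psi \in test_pred w by apply/asboolP/is_testP.
by exists (exist _ psi p).
Qed.

(** The subbasic balls have arbitrary centres; if 0 belongs to one, the slack between the
    distance to its centre and its radius leaves room for a ball around 0. *)
Lemma nbhs0_test_bound (A : set U) : nbhs (0 : U) A -> exists h l e,
  [/\ 0 < h, 0 < l, 0 < e & forall psi : U, test_bound (\val psi) h l e -> A psi].
Proof.
rewrite nbhsE /= => -[B [[D sD <-] [V DV V0]] BA].
have [Is sIs VE] := sD _ DV.
have Is0 i : [set` Is] i -> test_ball i (0 : U).
  by move=> iI; move: V0; rewrite -VE => /(_ i); apply.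
have IsD i : [set` Is] i -> test_ball_index i.
  by move=> /sIs; rewrite inE.
have [h [l [e [h0 l0 e0 H]]]] : exists h l e, [/\ 0 < h, 0 < l, 0 < e &
    forall psi : U, test_bound (\val psi) h l e -> forall i, i \in enum_fset Is -> test_ball i psi].
  have {VE sIs} : forall i : U * (R * R * R), i \in enum_fset Is -> test_ball i (0 : U) /\ test_ball_index i.
    by move=> i iI; split; [exact: Is0|exact: IsD].
  elim: (enum_fset Is) => [_|i s IH H].
    by exists 1, 1, 1; split => //.
  have [j js|h [l [e [h0 l0 e0 K]]]] := IH; first by apply: H; rewrite inE js orbT.
  have [] := H i (mem_head _ _).
  case: i {H} => phi [[h1 l1] e1] /= /test_norm_bound[M Me HM] [/= h10 l10 e10].
  exists (Num.max h h1), (Num.max l l1), (Num.min e ((e1 - M) / 2)).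
  split; rewrite ?lt_max ?h0 ?l0// ?lt_min ?e0 ?divr_gt0 ?subr_gt0//.
  move=> psi T i; rewrite inE => /orP[/eqP->|]; last first.
    apply: K; apply: test_boundS T; rewrite ?le_max ?ge_min ?lexx ?(ltW l0)//.
  rewrite /test_ball; apply: (@test_bound_norm _ _ _ ((e1 - M) / 2 + M)); last by lra.
  move=> z zh; apply: (@le_trans _ _ (normc (\val psi z) * expR (w (l1 * Re z)) +
     normc ((\val (0 : U) - \val phi) z) * expR (w (l1 * Re z)))).
    rewrite -mulrDl ler_wpM2r ?expR_ge0//.
    have -> : (\val psi - \val phi) z = \val psi z + (\val (0 : U) - \val phi) z.
      by rewrite -[(\val (0 : U) - \val phi) z]/(0 - \val phi z) sub0r.
    exact: le_normcD.
  apply: lerD; last exact: HM.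
  have T1 : test_bound (\val psi) h1 l1 ((e1 - M) / 2).
    by apply: test_boundS T; rewrite ?le_max ?ge_min ?lexx ?orbT ?(ltW l10).
  exact: T1.
exists h, l, e; split => // psi T; apply: BA; exists V => //.
have Vp : (V : set U) psi by rewrite -VE => i iI; exact: H.
exact: Vp.
Qed.

Section LinearForm.
Variable f : U -> C.
Hypothesis lf : linear f.

Lemma linform0 : f 0 = 0.
Proof.
have := lf (-1) 0 0; rewrite scaler0 addr0 => E.
by rewrite E scaleN1r addNr.
Qed.

Lemma linformZ a u : f (a *: u) = a * f u.
Proof. by have := lf a u 0; rewrite addr0 linform0 addr0. Qed.

Lemma linformD u v : f (u + v) = f u + f v.
Proof. by have := lf 1 u v; rewrite !scale1r. Qed.

Lemma linformB u v : f (u - v) = f u - f v.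
Proof. by rewrite linformD -scaleN1r linformZ mulN1r. Qed.

Lemma dual_bound : continuous f -> exists h l K, [/\ 0 < h, 0 < l, 0 <= K &
  forall (psi : U) M, test_bound (\val psi) h l M -> normc (f psi) <= K * M].
Proof.
move=> cf; have : nbhs (0 : U) (fun psi => normc (f psi) < 1).
  have /cvgrPdist_lt/(_ 1 ltr01) := cf (0 : U).
  apply: filterS => psi; rewrite linform0 sub0r normrN normE.
  by rewrite -[1 in X in X -> _]/(real_complex R 1) ltcR.
move=> /nbhs0_test_bound[h [l [e [h0 l0 e0 H]]]]; exists h, l, e^-1.
split=> //; first by rewrite invr_ge0 ltW.
move=> psi M T; have M0 := test_bound_ge0 h0 T.
apply/ler_addgt0Pr => d d0.
have q : 0 < M + d * e by rewrite ltr_wpDl// mulr_gt0.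
have c0 : 0 < e / (M + d * e) by rewrite divr_gt0.
have : normc (f (Complex (e / (M + d * e)) 0 *: psi)) < 1.
  apply: H => z zh.
  have -> : \val (Complex (e / (M + d * e)) 0 *: psi) z = Complex (e / (M + d * e)) 0 * \val psi z by [].
  rewrite normcM normc_real gtr0_norm// -mulrA mulrAC -[leRHS]mulr1 -mulrA ler_pM2l//.
  rewrite ler_pdivrMr// mul1r; apply: le_trans (T z zh) _.
  by rewrite lerDl mulr_ge0// ltW.
rewrite linformZ normcM normc_real gtr0_norm// => lt.
have := ltW lt; rewrite mulrC -ler_pdivlMr// mul1r invf_div => /le_trans; apply.
by rewrite le_eqVlt; apply/orP; left; apply/eqP; field; lra.
Qed.

Lemma open_test_ball (phi : U) h l e : 0 < h -> 0 < l -> 0 < e ->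
  open (test_ball (phi, (h, l, e))).
Proof.
move=> h0 l0 e0; exists [set test_ball (phi, (h, l, e))]; last by rewrite bigcup_set1.
move=> _ ->; exists [fset (phi, (h, l, e))]%fset.
  by move=> i /fset1P->; rewrite inE.
by rewrite set_fset1 bigcap_set1.
Qed.

Lemma bound_continuous h l K : 0 < h -> 0 < l -> 0 <= K ->
  (forall (psi : U) M, test_bound (\val psi) h l M -> normc (f psi) <= K * M) -> continuous f.
Proof.
move=> h0 l0 K0 H phi; have cphi := nbhs_filter phi.
apply/(cvgrPdist_lt (F := nbhs phi)) => e e0.
have [er er0] : exists er : R, e = real_complex R er :> R[i].
  by apply/complex_realP; rewrite realE ltW.
subst e; rewrite /= ltcR in e0.
have d0 : 0 < er / (K + 1) by rewrite divr_gt0//; lra.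
rewrite nbhsE; exists (test_ball (phi, (h, l, er / (K + 1)))).
  split; first exact: open_test_ball.
  apply: (@test_bound_norm _ _ _ 0) => // z _.
  have -> : (\val phi - \val phi) z = \val phi z - \val phi z by [].
  by rewrite subrr (@normc0 R) mul0r.
move=> psi /test_norm_bound[M Me T]; rewrite /= normE ltcR normcB -linformB.
have T' : test_bound (\val (psi - phi)) h l M by [].
have M0 := test_bound_ge0 h0 T; apply: le_lt_trans (H _ _ T') _.
by move: Me; rewrite ltr_pdivlMr; lra.
Qed.

End LinearForm.

Lemma closure_strip b z : 0 < b -> closure (strip b) z <-> `|Im z| <= b.
Proof.
move=> b0; split=> [cz|zb].
  rewrite leNgt; apply/negP => bz.
  have : nbhs z [set u : C | normc (u - z) < `|Im z| - b].
    apply/(@nbhs_normP R[i] C z); exists (real_complex R (`|Im z| - b)).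
      by rewrite /= ltcR subr_gt0.
    by move=> u /=; rewrite distrC normE ltcR.
  move=> /cz[u [/stripE ub /= uz]].
  have := le_lt_trans (normc_Im _) uz; rewrite cImD cImN.
  have := lerB_dist (Im z) (Im u); rewrite distrC; lra.
move=> A /(@nbhs_normP R[i] C z)[e /= e0].
have [er er0] : exists er : R, e = real_complex R er :> R[i].
  by apply/complex_realP; rewrite realE ltW.
subst e; rewrite ltcR in e0 => H.
(* A point of height at most [b] is approached by points of the open strip on its vertical. *)
pose t := Num.min 1 (er / (2 * b)).
have [t0 t1 te] : [/\ 0 < t, t <= 1 & t <= er / (2 * b)].
  rewrite /t lt_min ltr01 divr_gt0 ?mulr_gt0//; split => //.
    by rewrite ge_min lexx.
  by rewrite ge_min lexx orbT.
exists (Complex (Re z) ((1 - t) * Im z)); split.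
  apply/stripE; rewrite /= normrM ger0_norm; last lra.
  have := normr_ge0 (Im z); nra.
apply: H => /=; rewrite normE ltcR; apply: le_lt_trans (normc_ReIm _) _.
rewrite cReD cReN cImD cImN /= subrr normr0 add0r.
have -> : Im z - (1 - t) * Im z = t * Im z by ring.
rewrite normrM (gtr0_norm t0).
have tb' : t * b <= er / 2.
  by move: te; rewrite ler_pdivlMr ?mulr_gt0//; lra.
have : t * `|Im z| <= t * b by rewrite ler_pM2l.
lra.
Qed.

Lemma growth_supP l (A : set C) F : (growth_sup w l A F < +oo)%E <->
  exists2 M, 0 <= M & forall z, A z -> normc (F z) <= M * expR (w (l * Re z)).
Proof.
have ep x : expR (- w x) * expR (w x) = 1 by rewrite -expRD addNr expR0.
split=> [/wsup_ltyP[M hM]|[M M0 hM]].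
  exists (Num.max 0 M) => [|z Az]; first by rewrite le_max lexx.
  rewrite -[leLHS]mulr1 -(ep (l * Re z)) mulrA; apply: ler_wpM2r; first exact: expR_ge0.
  by rewrite le_max hM ?orbT.
apply/wsup_ltyP; exists M => z Az.
have := ler_wpM2r (expR_ge0 (- w (l * Re z))) (hM z Az).
by rewrite -mulrA [expR (w _) * _]mulrC ep mulr1.
Qed.

Lemma analytic_offP b l F : analytic_off w b l F <-> [/\ 0 < b, 0 < l,
  (forall z, b < `|Im z| -> hol F z) &
  forall r, b < r -> exists2 M, 0 <= M & forall z, b < `|Im z| -> `|Im z| < r ->
    normc (F z) <= M * expR (w (l * Re z))].
Proof.
split=> [[b0 l0 /analytic_onE hF gF]|[b0 l0 hF gF]]; split => //.
- by move=> z bz; apply: hF => /closure_strip -/(_ b0); rewrite leNgt bz.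
- move=> r br; have /growth_supP[M M0 hM] := gF r br; exists M => // z bz zr.
  by apply: hM; split; [exact/stripE|move=> /closure_strip -/(_ b0); rewrite leNgt bz].
- apply/analytic_onE => z nz; apply: hF; rewrite ltNge; apply/negP => zb; apply: nz.
  exact/closure_strip.
- move=> r br; have [M M0 hM] := gF r br; apply/growth_supP; exists M => // z [/stripE zr nz].
  by apply: hM => //; rewrite ltNge; apply/negP => zb; apply: nz; exact/closure_strip.
Qed.

Lemma is_entireP P : is_entire w P <-> (forall z, hol P z) /\ exists2 l, 0 < l &
  forall r, 0 < r -> exists2 M, 0 <= M & forall z, `|Im z| < r ->
    normc (P z) <= M * expR (w (l * Re z)).
Proof.
split=> [[/analytic_onE hF [l l0 gF]]|[hF [l l0 gF]]]; split.
- by move=> z; exact: hF.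
- exists l => // r /gF/growth_supP[M M0 hM]; exists M => // z zr.
  by apply: hM; exact/stripE.
- by apply/analytic_onE => z _.
- exists l => // r /gF[M M0 hM]; apply/growth_supP; exists M => // z /stripE.
  exact: hM.
Qed.

End TestTopology.

(** * The Cauchy kernel cut off by a test function *)

Section CauchyKernel.
Context {R : realType} (w : weight R).
Local Notation C := (cplx R).
Local Notation U := (test_space w).
Implicit Types (h l e M b r s : R) (z u zeta : C).

(** For s Im u large and positive, [E] is an entire approximation of the Cauchy kernel 1/u:
    the difference has modulus e^{- s Im u}/|u|. *)
Lemma entire_quotient s : exists2 E : C -> C, (forall u, hol E u) &
  forall u, u != 0 -> E u = (1 - cexp (Complex 0 s * u)) / u.
Proof.
have hE u : hol (fun u : C => 1 - cexp (Complex 0 s * u)) u.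
  apply: holB; first exact: hol_cst.
  apply: (@hol_comp _ (fun u => Complex 0 s * u)); last exact: hol_cexp.
  by apply: holM; [exact: hol_cst|exact: hol_id].
have [d hd] := removable 0 hE.
exists (fun z => if z == 0 then d else
   ((1 - cexp (Complex 0 s * z)) - (1 - cexp (Complex 0 s * 0))) / (z - 0)) => //.
by move=> u u0; rewrite (negPf u0) mulr0 cexp0 subrr !subr0.
Qed.

Lemma normc_cexp_i s u : normc (cexp (Complex 0 s * u)) = expR (- (s * Im u)).
Proof. by rewrite normc_cexp cReM /= mul0r sub0r. Qed.

Lemma quotient_bound s (E : C -> C) h : (forall u, hol E u) ->
  (forall u, u != 0 -> E u = (1 - cexp (Complex 0 s * u)) / u) ->
  exists2 M, 0 <= M & forall u, `|Im u| <= h -> normc (E u) <= M.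
Proof.
move=> hE EE; have [del del0 H] := hol_continuous (hE 0) ltr01.
pose M1 := normc (E 0) + 1; pose M2 := (1 + expR (`|s| * `|h|)) / del.
have M10 : 0 <= M1 by rewrite addr_ge0 ?normc_ge0.
have M20 : 0 <= M2 by rewrite divr_ge0 ?(ltW del0)// addr_ge0 ?expR_ge0.
exists (M1 + M2) => [|u uh]; first by rewrite addr_ge0.
have [ud|du] := ltP (normc u) del.
  have := H u; rewrite subr0 => /(_ ud) /ltW le.
  have := le_normcD (E u - E 0) (E 0); rewrite subrK /M1; lra.
have u0 : u != 0 by rewrite -normc_gt0; lra.
apply: (@le_trans _ _ M2); last by lra.
rewrite EE// normcM; apply: ler_pM; rewrite ?normc_ge0//; last exact: normc_inv_le.
apply: le_trans (ler_normcB _ _) _; rewrite (@normc1 R) lerD2l normc_cexp_i ler_expR.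
apply: le_trans (ler_norm _) _; rewrite normrN normrM ler_wpM2l//.
by apply: le_trans uh (ler_norm _).
Qed.

Section WithPhi.
Variable phi : C -> C.
Hypothesis hphi : forall z, hol phi z.
Hypothesis bphi : forall h l, 0 < h -> 0 < l ->
  exists2 K, 0 <= K & forall z, `|Im z| <= h -> normc (phi z) * expR (w (l * Re z)) <= K.

(** The Cauchy kernel with pole [z], made to decay in [zeta] by [phi]. It has residue
    [phi 0] at [z]. *)
Definition cut_kernel z zeta := phi (zeta - z) / (zeta - z).

(** The decay of [phi] at zeta - z is turned into decay at [zeta] at the price of growth in
    [z], by [weight_split]. *)
Lemma shift_bound h l : 0 < h -> 0 < l -> exists2 K, 0 <= K &
  forall zeta z, `|Im (zeta - z)| <= h ->
    normc (phi (zeta - z)) * expR (w (l * Re zeta)) <= K * expR (w (2 * l * Re z)).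
Proof.
move=> h0 l0; have l20 : 0 < 2 * l by lra.
have [K K0 hK] := bphi h0 l20.
exists K => // zeta z zh; have := hK _ zh; rewrite cReD cReN => H.
apply: le_trans (ler_wpM2l (normc_ge0 _) (exp_weight_split w (Re zeta) (Re z) (ltW l0))) _.
by rewrite mulrA ler_wpM2r ?expR_ge0.
Qed.

Lemma Im_far z zeta (del : R) : 0 < del -> del <= `|Im zeta - Im z| ->
  del <= normc (zeta - z).
Proof. by move=> d0 dz; apply: le_trans (normc_Im _); rewrite cImD cImN. Qed.

Lemma cut_kernel_bound h l : 0 < h -> 0 < l -> exists2 K, 0 <= K &
  forall zeta z (del : R), 0 < del -> del <= `|Im zeta - Im z| -> `|Im (zeta - z)| <= h ->
    normc (cut_kernel z zeta) * expR (w (l * Re zeta)) <= K / del * expR (w (2 * l * Re z)).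
Proof.
move=> h0 l0; have [K K0 hK] := shift_bound h0 l0; exists K => // zeta z del d0 dz zh.
have := normc_inv_le d0 (Im_far d0 dz) => i1.
rewrite normcM mulrAC [leRHS]mulrAC; apply: ler_pM; rewrite ?normc_ge0//.
  by rewrite mulr_ge0 ?normc_ge0 ?expR_ge0.
exact: hK.
Qed.

Lemma hol_phi_shift z zeta : hol (fun zeta => phi (zeta - z)) zeta.
Proof.
apply: (@hol_comp _ (fun zeta => zeta - z)) => //.
by apply: holB; [exact: hol_id|exact: hol_cst].
Qed.

Lemma hol_phi_shift' z zeta : hol (fun z => phi (zeta - z)) z.
Proof.
apply: (@hol_comp _ (fun z => zeta - z)) => //.
by apply: holB; [exact: hol_cst|exact: hol_id].
Qed.

Lemma hol_cut_kernel z zeta : zeta != z -> hol (cut_kernel z) zeta.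
Proof. by move=> zz; apply: holM; [exact: hol_phi_shift|exact: hol_inv]. Qed.

Lemma hol_cut_kernel' z zeta : zeta != z -> hol (fun z => cut_kernel z zeta) z.
Proof.
move=> zz; apply: holM; first exact: hol_phi_shift'.
apply: (@holV _ (fun z => zeta - z)); first by rewrite subr_eq0.
by apply: holB; [exact: hol_cst|exact: hol_id].
Qed.

(** A Cauchy estimate in [z], the norms being taken in [zeta]. *)
Lemma cut_kernel_quotients z (rho H l : R) : 0 < rho -> 0 < H -> 0 < l ->
  exists2 A, 0 <= A & forall zeta eta k, 2 * rho <= `|Im zeta - Im z| ->
   `|Im zeta| + `|Im z| + rho <= H -> eta != 0 -> k != 0 ->
   normc eta <= rho / 2 -> normc k <= rho / 2 ->
   normc ((cut_kernel (z + eta) zeta - cut_kernel z zeta) / eta - (cut_kernel (z + k) zeta - cut_kernel z zeta) / k)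
     * expR (w (l * Re zeta)) <= A * normc (eta - k).
Proof.
move=> r0 H0 l0; have [A A0 hA] := @hol_quotients R _ r0.
have [K K0 hK] := cut_kernel_bound H0 l0.
pose B := K / rho * expR (w (2 * l * (`|Re z| + rho))).
have B0 : 0 <= B by rewrite mulr_ge0 ?expR_ge0// divr_ge0// ltW.
exists (A * B); first by rewrite mulr_ge0.
move=> zeta eta k far zH eta0 k0 etar kr.
have near v : insq z rho v -> [/\ rho <= `|Im zeta - Im v|, `|Im (zeta - v)| <= H & `|Re v| <= `|Re z| + rho].
  case/insqP; rewrite cReD cReN cImD cImN => v1 v2; split.
  - have : `|Im zeta - Im z| <= `|Im zeta - Im v| + `|Im v - Im z|.
      by rewrite -[Im zeta - Im z](subrKA (Im v)) ler_normD.
    lra.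
  - rewrite cImD cImN; apply: le_trans zH.
    have : `|Im v| <= `|Im z| + `|Im v - Im z|.
      by rewrite -{1}(subrK (Im z) (Im v)) addrC ler_normD.
    have := ler_normB (Im zeta) (Im v); lra.
  - have : `|Re v| <= `|Re z| + `|Re v - Re z|.
      by rewrite -{1}(subrK (Re z) (Re v)) addrC ler_normD.
    lra.
have E0 := expR_gt0 (w (l * Re zeta)).
rewrite -ler_pdivlMr// -mulrAC -[A * B / _]mulrA.
apply: (hA (fun z => cut_kernel z zeta)) => //.
- move=> v /near[v1 _ _]; apply: hol_cut_kernel'; rewrite -subr_eq0.
  by apply: (neq_of_far r0); exact: Im_far.
- move=> v /near[v1 v2 v3]; rewrite ler_pdivlMr//.
  apply: le_trans (hK _ _ _ r0 v1 v2) _; apply: ler_wpM2l.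
    by rewrite divr_ge0// ltW.
  rewrite ler_expR; apply: w_mono; rewrite !normrM; apply: ler_wpM2l => //.
  by apply: le_trans v3 (ler_norm _).
Qed.

(** Off a closed strip the kernel is a limit of test functions in every seminorm of that
    strip: the sign of [s] is chosen such that s Im (zeta - z) is positive there. *)
Lemma cut_kernel_approx h l z e : 0 < h -> 0 < l -> h < `|Im z| -> 0 < e ->
  exists u : U, test_bound w (fun zeta => \val u zeta - cut_kernel z zeta) h l e.
Proof.
move=> h0 l0 hz e0; pose H := h + `|Im z|.
have H0 : 0 < H by rewrite /H; have := normr_ge0 (Im z); lra.
have [K K0 hK] := cut_kernel_bound H0 l0.
pose del := `|Im z| - h; have d0 : 0 < del by rewrite /del; lra.
pose B := K / del * expR (w (2 * l * Re z)).
have B0 : 0 <= B by rewrite mulr_ge0 ?expR_ge0// divr_ge0// ltW.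
pose N := B / (e * del) + 1.
have N0 : 0 < N by have := divr_ge0 B0 (mulr_ge0 (ltW e0) (ltW d0)); rewrite /N; lra.
pose s := if 0 < Im z then - N else N.
have [E hE EE] := entire_quotient s.
have [u uE] : exists u : U, \val u = fun zeta => phi (zeta - z) * E (zeta - z).
  apply: test_exists.
    move=> zeta; apply: holM; first exact: hol_phi_shift.
    apply: (@hol_comp _ (fun zeta => zeta - z)) => //.
    by apply: holB; [exact: hol_id|exact: hol_cst].
  move=> h' l' h'0 l'0; have p : 0 < h' + `|Im z| by have := normr_ge0 (Im z); lra.
  have [K' K'0 hK'] := shift_bound p l'0.
  have [M' M'0 hM'] := quotient_bound (h' + `|Im z|) hE EE.
  exists (K' * expR (w (2 * l' * Re z)) * M') => zeta zh.
  have im : `|Im (zeta - z)| <= h' + `|Im z|.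
    by rewrite cImD cImN; have := ler_normB (Im zeta) (Im z); lra.
  rewrite normcM mulrAC; apply: ler_pM; rewrite ?normc_ge0 ?hK' ?hM'//.
  by rewrite mulr_ge0 ?normc_ge0 ?expR_ge0.
exists u => zeta zh; rewrite uE.
have far : del <= `|Im zeta - Im z|.
  by have := lerB_dist (Im z) (Im zeta); rewrite distrC /del; lra.
have im : `|Im (zeta - z)| <= H.
  by rewrite cImD cImN; have := ler_normB (Im zeta) (Im z); rewrite /H; lra.
have zz : zeta - z != 0 by apply: (neq_of_far d0); exact: Im_far.
have -> : phi (zeta - z) * E (zeta - z) - cut_kernel z zeta =
   - (cexp (Complex 0 s * (zeta - z)) * cut_kernel z zeta) by rewrite EE// /cut_kernel; ring.
rewrite normcN normcM normc_cexp_i -mulrA.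
have kb := hK zeta z del d0 far im.
have ex : expR (- (s * Im (zeta - z))) <= (N * del)^-1.
  have sI : N * del <= s * Im (zeta - z).
    move: zh hz far; rewrite cImD cImN /s /del; case: (ltrP 0 (Im z)) => z0.
      rewrite (gtr0_norm z0) ltr_norml => /andP[? ?] ? _; nra.
    rewrite (ler0_norm z0) ltr_norml => /andP[? ?] ? _; nra.
  rewrite expRN lef_pV2 ?posrE ?expR_gt0 ?mulr_gt0//.
  by apply: le_trans sI _; apply: le_trans (expR_ge1Dx _); lra.
apply: (@le_trans _ _ ((N * del)^-1 * B)).
  by apply: ler_pM => //; rewrite ?expR_ge0 ?mulr_ge0 ?normc_ge0 ?expR_ge0.
rewrite mulrC ler_pdivrMr ?mulr_gt0//.
have -> : e * (N * del) = B + e * del by rewrite /N; field; lra.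
by rewrite lerDl; exact: mulr_ge0 (ltW e0) (ltW d0).
Qed.

Section Extension.
Variable f : U -> C.
Hypotheses (lf : linear f) (cf : continuous f).

(** Two test functions close to the same kernel have close images under [f]; [F] is the limit of
    these images. An approximation of each kernel of the combination then gives the estimate. *)
Lemma represent : exists h l K (F : C -> C), [/\ 0 < h, 0 < l, 0 <= K &
  forall (s : seq (C * C)) (psi : U) M, (forall p, p \in s -> h < `|Im p.2|) ->
    test_bound w (fun zeta => \sum_(p <- s) p.1 * cut_kernel p.2 zeta - \val psi zeta) h l M ->
    normc (\sum_(p <- s) p.1 * F p.2 - f psi) <= K * M].
Proof.
have [h [l [K [h0 l0 K0 hf]]]] := dual_bound lf cf.
have boundD g1 g2 M1 M2 : test_bound w g1 h l M1 -> test_bound w g2 h l M2 ->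
    test_bound w (fun zeta => g1 zeta + g2 zeta) h l (M1 + M2).
  move=> H1 H2 z zh; apply: le_trans (lerD (H1 z zh) (H2 z zh)).
  by rewrite -mulrDl ler_wpM2r ?expR_ge0// le_normcD.
have boundN g M : test_bound w g h l M -> test_bound w (fun zeta => - g zeta) h l M.
  by move=> H z zh; rewrite normcN; exact: H.
have boundE g1 g2 M : (forall zeta, g1 zeta = g2 zeta) -> test_bound w g1 h l M -> test_bound w g2 h l M.
  by move=> E H z zh; rewrite -E; exact: H.
have /choice[F hF] : forall z, exists v : C, h < `|Im z| -> forall (u : U) e, 0 < e ->
    test_bound w (fun zeta => \val u zeta - cut_kernel z zeta) h l e -> normc (f u - v) <= 2 * (K * e).
  move=> z; have [hz|] := boolP (h < `|Im z|); last by exists 0.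
  have [||v hv] := @approx_limit R (U * R)%type
     [set p | 0 < p.2 /\ test_bound w (fun zeta => \val p.1 zeta - cut_kernel z zeta) h l p.2]
     (fun p => f p.1) (fun p => K * p.2).
  - by have [u hu] := cut_kernel_approx h0 l0 hz ltr01; exists (u, 1).
  - move=> [u e] [u' e'] /= [e0 hu] [e0' hu'].
    rewrite -(linformB lf) -mulrDr; apply: hf.
    apply: boundE (boundD _ _ _ _ hu (boundN _ _ hu')) => zeta.
    have -> : \val (u - u') zeta = \val u zeta - \val u' zeta by [].
    by rewrite /=; ring.
  - by exists v => _ u e e0 hu; exact: (hv (u, e)).
exists h, l, K, F; split => // s psi M hs T.
have approx e : 0 < e -> exists u : U,
   test_bound w (fun zeta => \val u zeta - \sum_(p <- s) p.1 * cut_kernel p.2 zeta) h l e /\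
   normc (\sum_(p <- s) p.1 * F p.2 - f u) <= e.
  elim: s hs {T} e => [_ e e0|[a z] s IH hs e e0].
    exists 0; rewrite big_nil (linform0 lf) subrr (@normc0 R); split; last exact: ltW.
    move=> zeta _; rewrite big_nil.
    have -> : \val (0 : U) zeta = 0 by [].
    by rewrite subrr (@normc0 R) mul0r ltW.
  have e2 : 0 < e / 2 by lra.
  have [|u [hu1 hu2]] := IH _ _ e2; first by move=> p ps; apply: hs; rewrite inE ps orbT.
  have hz : h < `|Im z| by apply: (hs (a, z)); rewrite inE eqxx.
  pose q := 2 * (normc a + 1) * (2 * K + 1).
  have na := normc_ge0 a.
  have q0 : 0 < q by rewrite !mulr_gt0//; lra.
  have e3 : 0 < e / q by rewrite divr_gt0.
  have [v hv] := cut_kernel_approx h0 l0 hz e3.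
  have b1 : normc a * (e / q) <= e / 2.
    rewrite mulrCA ler_wpM2l ?(ltW e0)// ler_pdivrMr// /q; nra.
  have b2 : normc a * (2 * (K * (e / q))) <= e / 2.
    have -> : normc a * (2 * (K * (e / q))) = e * (normc a * (2 * K) / q) by ring.
    rewrite ler_wpM2l ?(ltW e0)// ler_pdivrMr// /q; nra.
  exists (a *: v + u); split.
    have T1 : test_bound w (fun zeta => a * (\val v zeta - cut_kernel z zeta)) h l (e / 2).
      move=> zeta zh; rewrite normcM -mulrA; apply: le_trans b1.
      by rewrite ler_wpM2l//; exact: hv.
    have -> : e = e / 2 + e / 2 by lra.
    apply: boundE (boundD _ _ _ _ T1 hu1) => zeta; rewrite big_cons /=.
    have -> : (a *: sval v + sval u) zeta = a * sval v zeta + sval u zeta by [].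
    ring.
  rewrite big_cons /= (linformD lf) (linformZ lf).
  have -> : a * F z + \sum_(p <- s) p.1 * F p.2 - (a * f v + f u) =
    (\sum_(p <- s) p.1 * F p.2 - f u) - a * (f v - F z) by ring.
  apply: le_trans (ler_normcB _ _) _; rewrite normcM.
  have := hF z hz v _ e3 hv => le.
  have := ler_wpM2l na le; lra.
apply/ler_addgt0Pr => e e0.
have e1 : 0 < e / (K + 1) by rewrite divr_gt0//; lra.
have [u [hu1 hu2]] := approx _ e1.
have -> : \sum_(p <- s) p.1 * F p.2 - f psi = (\sum_(p <- s) p.1 * F p.2 - f u) + f (u - psi).
  by rewrite (linformB lf); ring.
apply: le_trans (le_normcD _ _) _.
have : normc (f (u - psi)) <= K * (e / (K + 1) + M).
  apply: hf; apply: boundE (boundD _ _ _ _ hu1 T) => zeta.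
  have -> : \val (u - psi) zeta = \val u zeta - \val psi zeta by [].
  ring.
have -> : K * (e / (K + 1) + M) = K * M + (e - e / (K + 1)) by field; lra.
lra.
Qed.

End Extension.

End WithPhi.
End CauchyKernel.

(** * The boundary value map *)

Section TameFunctions.
Context {R : realType}.
Local Notation C := (cplx R).
Implicit Types (F G : C -> C) (B y : R).

Definition tame_by B F y := forall z : C, Im z = y -> hol F z /\ normc (F z) <= B * decay (Re z).
Definition tame F y := exists B, tame_by B F y.

Lemma tame_integrable F y : tame F y -> cintegrable setT (fun x => F (Complex x y)).
Proof.
move=> [B H]; apply: (lint_integrable (B := B)) => x; have [] := H (Complex x y) erefl => //.
by move=> h _; exact: ccont_hol.
Qed.

Lemma tame_lin F G (a : C) y : tame F y -> tame G y -> tame (fun z => a * F z + G z) y.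
Proof.
move=> [A hA] [B hB]; exists (normc a * A + B) => z zy; have [F1 F2] := hA z zy; have [G1 G2] := hB z zy.
split.
  by apply: (@holD _ (fun z => a * F z) G) => //; apply: (@holM _ (fun=> a) F) => //; exact: hol_cst.
apply: le_trans (le_normcD _ _) _; rewrite mulrDl normcM -mulrA; apply: lerD => //.
by rewrite ler_wpM2l// normc_ge0.
Qed.

Lemma lint_lin F G (a : C) y : tame F y -> tame G y ->
  lint (fun z => a * F z + G z) y = a * lint F y + lint G y.
Proof.
move=> /tame_integrable iF /tame_integrable iG; rewrite /lint.
by rewrite (cintD _ (cintegrableZ a _ iF) iG)// (cintZ _ _ iF).
Qed.

Lemma lintZ F (a : C) y : tame F y -> lint (fun z => a * F z) y = a * lint F y.
Proof. by move=> /tame_integrable iF; rewrite /lint (cintZ _ _ iF). Qed.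

Lemma lintB F G y : tame F y -> tame G y ->
  lint (fun z => F z - G z) y = lint F y - lint G y.
Proof.
by move=> /tame_integrable iF /tame_integrable iG; rewrite /lint (cintB _ iF iG).
Qed.

Lemma normc_lint F y B : tame_by B F y -> normc (lint F y) <= 2 * (B * inv_sqr_int).
Proof.
move=> H; have FB x : normc (F (Complex x y)) <= B * decay x by have [] := H (Complex x y) erefl.
have B0 : 0 <= B.
  have := le_trans (normc_ge0 _) (FB 0); rewrite pmulr_lge0//; exact: decay_gt0.
have := @normc_cint R setT (fun x => F (Complex x y)) (fun x => B * (1 + x ^+ 2)^-1).
move=> n; apply: le_trans (n _ _ _ _) _ => //.
- by apply: tame_integrable; exists B.
- have mT := @measurableT _ (measurableTypeR R).
  have := @integrableZl _ _ _ lebesgue_measure _ mT B _ integrable_oneDsqrV.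
  by apply: eq_integrable.
- by move=> x _; apply: le_trans (FB x) _; rewrite ler_wpM2l// decay_le_inv.
- by rewrite RintegralZl//; exact: integrable_oneDsqrV.
Qed.

Lemma eq_lint F G y : (forall z : C, Im z = y -> F z = G z) -> lint F y = lint G y.
Proof. by move=> FG; apply: eq_cint => x _; exact: FG. Qed.

End TameFunctions.

Section BoundaryValue.
Context {R : realType} (w : weight R).
Hypothesis wd : cond_delta w.
Local Notation C := (cplx R).
Local Notation U := (test_space w).
Implicit Types (h l M b c r k y : R) (z : C) (F G : C -> C).

(** The decay needed of the second factor depends on the growth of the first one only. *)
Lemma growth_prod l : 0 < l -> exists m K, [/\ 0 < m, 0 <= K &
  forall z (f g : C) A M, 0 <= A -> normc f <= A * expR (w (l * Re z)) ->
    normc g * expR (w (m * Re z)) <= M -> normc (f * g) <= A * K * M * decay (Re z)].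
Proof.
move=> l0; have [m lm [K K0 hK]] := weight_gain wd l0.
exists m, K; split => //; first lra.
move=> z f g A M A0 fA gM; rewrite normcM.
apply: le_trans (ler_wpM2r (normc_ge0 _) fA) _.
apply: (@le_trans _ _ (A * (K * (decay (Re z) * expR (w (m * Re z)))) * normc g)).
  by rewrite ler_wpM2r ?normc_ge0// ler_wpM2l.
have -> : A * (K * (decay (Re z) * expR (w (m * Re z)))) * normc g =
  A * K * decay (Re z) * (normc g * expR (w (m * Re z))) by ring.
have -> : A * K * M * decay (Re z) = A * K * decay (Re z) * M by ring.
by apply: ler_wpM2l gM; apply: mulr_ge0; [exact: mulr_ge0|exact: ltW (decay_gt0 _)].
Qed.

Lemma prod_bound b l F r : analytic_off w b l F -> b < r ->
  exists m K, [/\ 0 < m, 0 <= K & forall z (g : C) M, b < `|Im z| -> `|Im z| < r ->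
    normc g * expR (w (m * Re z)) <= M -> normc (F z * g) <= K * M * decay (Re z)].
Proof.
move=> /analytic_offP[b0 l0 _ gF] br; have [A A0 hA] := gF r br.
have [m [K [m0 K0 hK]]] := growth_prod l0.
exists m, (A * K); split=> [//||z g M bz zr]; first by rewrite mulr_ge0.
by apply: hK => //; exact: hA.
Qed.

Lemma prod_test b l F r : analytic_off w b l F -> b < r -> forall psi : U,
  exists B, forall z, b < `|Im z| -> `|Im z| < r ->
   hol (fun z => F z * \val psi z) z /\ normc (F z * \val psi z) <= B * decay (Re z).
Proof.
move=> aF br psi; have [m [K [m0 K0 H]]] := prod_bound aF br.
have /analytic_offP[b0 l0 hF _] := aF.
have [hp bp] := testP psi; have [M hM] := bp r m (lt_trans b0 br) m0.
exists (K * M) => z bz zr; split; last by apply: H => //; exact: hM.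
by apply: (@holM _ F (\val psi)); [exact: hF|].
Qed.

Lemma prod_tame b l F y : analytic_off w b l F -> b < `|y| -> forall psi : U,
  tame (fun z => F z * \val psi z) y.
Proof.
move=> aF bY psi; have br : b < `|y| + 1 by lra.
have [B H] := prod_test aF br psi; exists B => z zy.
by apply: H; rewrite zy//; lra.
Qed.

Lemma contour_indep b l F k k' : analytic_off w b l F -> b < k -> b < k' -> forall psi : U,
  strip_contour k (fun z => F z * \val psi z) = strip_contour k' (fun z => F z * \val psi z).
Proof.
move=> aF; have /analytic_offP[b0 _ _ _] := aF.
wlog kk : k k' / k <= k' => [H bk bk' psi|bk bk' psi].
  have [/H|/ltW/H] := leP k k'; first by apply.
  by move=> H'; symmetry; apply: H'.
have br : b < k' + 1 by lra.
have [B H] := prod_test aF br psi; rewrite !strip_contourE; congr (_ - _).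
  symmetry; apply: (strip_shift (B := B)); first lra.
  by move=> z /andP[z1 z2]; apply: H; rewrite ler0_norm; lra.
apply: (strip_shift (B := B)) => //.
by move=> z /andP[z1 z2]; apply: H; rewrite ger0_norm; lra.
Qed.

(** Both contours may be moved to a common one, so far out that the two functions agree on it. *)
Lemma contour_agree b l F b' l' F' c k k' : analytic_off w b l F -> analytic_off w b' l' F' ->
  0 < c -> (forall z, ~ closure (strip c) z -> F z = F' z) -> b < k -> b' < k' -> forall psi : U,
  strip_contour k (fun z => F z * \val psi z) = strip_contour k' (fun z => F' z * \val psi z).
Proof.
move=> aF aF' c0 FF bk bk' psi; pose q := Num.max (Num.max k k') (c + 1).
have [kq kq' cq] : [/\ k <= q, k' <= q & c + 1 <= q] by rewrite /q !le_max !lexx ?orbT.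
have [bq bq'] : b < q /\ b' < q by split; lra.
rewrite (contour_indep aF bk bq) (contour_indep aF' bk' bq') !strip_contourE.
have far z : `|Im z| = q -> F z * \val psi z = F' z * \val psi z.
  by move=> zq; rewrite FF// => /closure_strip -/(_ c0); rewrite zq; lra.
by congr (_ - _); apply: eq_lint => z zE; apply: far; rewrite zE ?normrN ger0_norm; lra.
Qed.

Lemma contour_dual b l F k : analytic_off w b l F -> b < k ->
  exists d : dual_space w, forall psi : U, \val d psi = - strip_contour k (fun z => F z * \val psi z).
Proof.
move=> aF bk; have /analytic_offP[b0 _ hF _] := aF.
have k0 : 0 < k by lra.
have [kk kk'] : `|k| = k /\ `|- k| = k by rewrite normrN gtr0_norm.
pose f (psi : U) := - strip_contour k (fun z => F z * \val psi z).
have tm y : `|y| = k -> forall psi : U, tame (fun z => F z * \val psi z) y.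
  by move=> yk psi; apply: prod_tame aF _ _; rewrite yk.
have lf : linear f.
  move=> a u v; rewrite /f !strip_contourE.
  have E y : `|y| = k -> lint (fun z => F z * \val (a *: u + v) z) y =
      a * lint (fun z => F z * \val u z) y + lint (fun z => F z * \val v z) y.
    move=> yk; rewrite -lint_lin; [|exact: tm..].
    apply: eq_lint => z _.
    have -> : \val (a *: u + v) z = a * \val u z + \val v z by [].
    ring.
  rewrite !E//; set p := lint _ _; set q := lint _ _; set p' := lint _ _; set q' := lint _ _.
  have -> : a *: - (p - p') = a * - (p - p') by [].
  ring.
suff cf : continuous f.
  by have p : f \in @dual_pred R w; [apply/asboolP|exists (exist _ f p)].
have br : b < k + 1 by lra.
have [m [K [m0 K0 H]]] := prod_bound aF br.
apply: (bound_continuous lf (h := k + 1) (l := m) (K := 4 * K * inv_sqr_int)) => //; first lra.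
  by rewrite !mulr_ge0// inv_sqr_int_ge0.
move=> psi M T; rewrite /f strip_contourE normcN.
have B y : `|y| = k -> normc (lint (fun z => F z * \val psi z) y) <= 2 * (K * M * inv_sqr_int).
  move=> yk; apply: normc_lint => z zy; split; first by have [B /(_ z zy)[]] := tm y yk psi.
  by apply: H; rewrite /= ?zy ?yk//; [lra|apply: T; rewrite /= zy yk; lra].
apply: le_trans (ler_normcB _ _) _; have := B _ kk; have := B _ kk'; lra.
Qed.

(** The functional of a germ does not depend on the representative or the contour, by
    [contour_agree]; linearity is read off on representatives with common [b] and [l]. *)
Lemma boundary_value_exists : exists bv : {linear germ_space w -> dual_space w},
  is_boundary_value bv.
Proof.
have /choice[bv hbv] : forall x : germ_space w, exists d : dual_space w,
    forall (F : prerep w) b l k, germ F = x -> analytic_off w b l (\val F) -> b < k ->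
    forall phi : U, \val d phi = - strip_contour k (fun z => \val F z * \val phi z).
  move=> x; have [F <-] := germ_surj x; have /asboolP[b [l aF]] := valP F.
  have bb : b < b + 1 by lra.
  have [d hd] := contour_dual aF bb; exists d => G b' l' k /germ_eqP[c c0 FG] aG bk phi.
  rewrite hd; congr (- _); apply: (contour_agree aF aG c0) => //.
  by move=> z /FG.
have bvP : is_boundary_value bv by move=> F b l k aF bk phi; exact: (hbv _ F b l).
have lin : linear bv.
  move=> a x y; have [F <-] := germ_surj x; have [G <-] := germ_surj y.
  have /asboolP[b [l aF]] := valP F; have /asboolP[b' [l' aG]] := valP G.
  pose q := Num.max b b'; pose m := Num.max l l'.
  have {}aF : analytic_off w q m (\val F) by apply: analytic_offW aF; rewrite le_max lexx.
  have {}aG : analytic_off w q m (\val G) by apply: analytic_offW aG; rewrite le_max lexx orbT.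
  have aH : analytic_off w q m (\val (a *: F + G)) by exact: analytic_off_lin.
  have qk : q < q + 1 by lra.
  have q0 : 0 < q by have /analytic_offP[] := aF.
  rewrite -germZ -germD; apply: val_inj; apply/funext => psi.
  rewrite (bvP _ _ _ _ aH qk).
  have -> : \val (a *: bv (germ F) + bv (germ G)) psi =
    a * \val (bv (germ F)) psi + \val (bv (germ G)) psi by [].
  rewrite (bvP _ _ _ _ aF qk) (bvP _ _ _ _ aG qk) !strip_contourE.
  have E t : `|t| = q + 1 -> lint (fun z => \val (a *: F + G) z * \val psi z) t =
      a * lint (fun z => \val F z * \val psi z) t + lint (fun z => \val G z * \val psi z) t.
    move=> tk; rewrite -lint_lin; [|by apply: prod_tame; [exact: aF|rewrite tk]|
       by apply: prod_tame; [exact: aG|rewrite tk]].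
    apply: eq_lint => z _.
    have -> : \val (a *: F + G) z = a * \val F z + \val G z by [].
    ring.
  rewrite !E ?normrN; [ring|by rewrite ger0_norm; lra..].
pose bvl := HB.pack bv (GRing.isLinear.Build R[i] (germ_space w) (dual_space w) *:%R bv lin) :
  {linear germ_space w -> dual_space w}.
by exists bvl.
Qed.

End BoundaryValue.

(** * Entire functions and vanishing boundary values *)

Section Kernel.
Context {R : realType} (w : weight R).
Hypothesis wd : cond_delta w.
Local Notation C := (cplx R).
Local Notation U := (test_space w).
Implicit Types (h l M b c r k y : R) (z u zeta : C) (P : C -> C).
Variable phi : C -> C.
Hypothesis hphi : forall z, hol phi z.
Hypothesis phi0 : phi 0 = 1.
Hypothesis bphi : forall h l, 0 < h -> 0 < l ->
  exists2 K, 0 <= K & forall z, `|Im z| <= h -> normc (phi z) * expR (w (l * Re z)) <= K.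

Lemma entire_cauchy P z k : is_entire w P -> `|Im z| < k ->
  lint (fun u => P u * cut_kernel phi z u) (- k) - lint (fun u => P u * cut_kernel phi z u) k = two_pi_i * P z.
Proof.
move=> /is_entireP[hP [l l0 gP]]; rewrite ltr_norml => /andP[z1 z2].
have k0 : 0 < k by lra.
have [|A A0 hA] := gP (k + 1); first lra.
have [m [K [m0 K0 hK]]] := growth_prod wd l0.
have h0 : 0 < k + `|Im z| by have := normr_ge0 (Im z); lra.
have [K' K'0 hK'] := shift_bound bphi h0 m0.
have zk : - k < Im z < k by apply/andP.
have := @strip_cauchy R (fun u => P u * phi (u - z)) (- k) k
  (A * K * (K' * expR (w (2 * m * Re z)))) z zk.
rewrite subrr phi0 mulr1 => <-.
  by congr (_ - _); apply: eq_lint => u _; rewrite /cut_kernel mulrA.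
move=> u /andP[u1 u2]; have uk : `|Im u| <= k by rewrite ler_norml u1.
split; first by apply: (@holM _ P (fun u => phi (u - z))); [exact: hP|exact: hol_phi_shift].
apply: hK => //; first by apply: hA; lra.
by apply: hK'; rewrite cImD cImN; have := ler_normB (Im u) (Im z); lra.
Qed.

(** The difference of the two functions vanishes off a strip; [entire_cauchy] on a larger strip,
    where the contour integrals are zero, shows that it vanishes everywhere. *)
Lemma restriction_inj : injective (@restriction R w).
Proof.
move=> P Q /germ_eqP[c c0 PQ].
apply/eqP; rewrite -subr_eq0; apply/eqP; apply: val_inj; apply/funext => z.
have eD : is_entire w (\val (P - Q)) by case: (P - Q) => D /= /asboolP.
pose k := Num.max c `|Im z| + 1.
have [ck zk] : c < k /\ `|Im z| < k.
  by have := le_max c c `|Im z|; have := le_max `|Im z| c `|Im z|; rewrite !lexx orbT /k; lra.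
have := entire_cauchy eD zk.
have vanish y : c < `|y| -> lint (fun u => \val (P - Q) u * cut_kernel phi z u) y = 0.
  move=> cy; rewrite (@eq_lint _ _ (fun=> 0 * 0)); last first.
    move=> u uy; have /= PQu : \val P u = \val Q u.
      by apply: PQ => /closure_strip -/(_ c0); rewrite uy; lra.
    have -> : (sval P - sval Q) u = sval P u - sval Q u by [].
    by rewrite PQu subrr !mul0r.
  rewrite lintZ ?mul0r//; exists 0 => u _; split; first exact: hol_cst.
  by rewrite (@normc0 R) mul0r.
rewrite !vanish ?normrN ?ger0_norm; [|lra..].
by rewrite subrr => /esym/eqP; rewrite mulf_eq0 (negPf two_pi_i_neq0) => /eqP.
Qed.

Lemma entire_contour P (psi : U) k : is_entire w P -> 0 < k ->
  strip_contour k (fun z => P z * \val psi z) = 0.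
Proof.
move=> /is_entireP[hP [l l0 gP]] k0.
have [|A A0 hA] := gP (k + 1); first lra.
have [m [K [m0 K0 hK]]] := growth_prod wd l0.
have [hp bp] := testP psi; have [|M hM] := bp (k + 1) m _ m0; first lra.
rewrite strip_contourE (@strip_shift _ _ (- k) k (A * K * M)) ?subrr//; first lra.
move=> u /andP[u1 u2]; have uk : `|Im u| < k + 1 by rewrite ltr_norml; apply/andP; split; lra.
split; first by apply: (@holM _ P (\val psi)); [exact: hP|].
by apply: hK => //; [exact: hA|exact: hM].
Qed.

Section Continuation.
Variables (b l : R) (F : C -> C).
Hypothesis aF : analytic_off w b l F.

Definition cauchy_line y z : C := lint (fun u => F u * cut_kernel phi z u) y.

Lemma cut_kernel_tame y z : b < `|y| -> Im z != y -> tame (fun u => F u * cut_kernel phi z u) y.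
Proof.
move=> bY zy; have br : b < `|y| + 1 by lra.
have [m [K [m0 K0 H]]] := prod_bound wd aF br.
have /analytic_offP[b0 _ hF _] := aF.
have h0 : 0 < `|y| + `|Im z| by have := normr_ge0 (Im z); lra.
have [A A0 hA] := cut_kernel_bound bphi h0 m0.
have d0 : 0 < `|y - Im z| by rewrite normr_gt0 subr_eq0 eq_sym.
exists (K * (A / `|y - Im z| * expR (w (2 * m * Re z)))) => u uy.
have uz : u != z by apply: contraNneq zy => <-; rewrite uy.
split; first by apply: (@holM _ F (cut_kernel phi z)); [apply: hF; rewrite uy|exact: hol_cut_kernel].
apply: H; rewrite ?uy//; first lra.
apply: hA => //; rewrite ?uy//.
by rewrite cImD cImN uy ler_normB.
Qed.

(** The second divided differences of the kernel are bounded uniformly on the line, and the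
    integral over the line preserves the bound. *)
Lemma hol_cauchy_line y z : b < `|y| -> Im z != y -> hol (cauchy_line y) z.
Proof.
move=> bY zy; have br : b < `|y| + 1 by lra.
have [m [K [m0 K0 H]]] := prod_bound wd aF br.
have d0 : 0 < `|y - Im z| by rewrite normr_gt0 subr_eq0 eq_sym.
pose rho := `|y - Im z| / 2; have r0 : 0 < rho by rewrite /rho; lra.
pose h := `|y| + `|Im z| + rho.
have h0 : 0 < h by rewrite /h; have := normr_ge0 (Im z); have := normr_ge0 y; lra.
have [A A0 hA] := cut_kernel_quotients hphi bphi z r0 h0 m0.
have far v : normc v <= rho / 2 -> Im (z + v) != y.
  move=> vr; apply/eqP => E; have := le_trans (normc_Im v) vr.
  have -> : Im v = y - Im z by rewrite -E cImD; ring.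
  move: d0; rewrite /rho; lra.
apply: (@hol_of_quotients _ _ _ (rho / 2) (2 * (K * A * inv_sqr_int))); first lra.
  by rewrite !mulr_ge0// inv_sqr_int_ge0.
move=> eta k eta0 k0 /ltW er /ltW kr.
have t0 := cut_kernel_tame bY zy.
have t1 := cut_kernel_tame bY (far _ er).
have t2 := cut_kernel_tame bY (far _ kr).
have E : (cauchy_line y (z + eta) - cauchy_line y z) / eta -
   (cauchy_line y (z + k) - cauchy_line y z) / k =
  lint (fun u => F u * ((cut_kernel phi (z + eta) u - cut_kernel phi z u) / eta -
     (cut_kernel phi (z + k) u - cut_kernel phi z u) / k)) y.
  rewrite (@eq_lint _ _ (fun u => eta^-1 * (F u * cut_kernel phi (z + eta) u) +
     (- k^-1 * (F u * cut_kernel phi (z + k) u) + (k^-1 - eta^-1) * (F u * cut_kernel phi z u)))); last first.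
    by move=> u _; ring.
  have tz : tame (fun u => (k^-1 - eta^-1) * (F u * cut_kernel phi z u)) y.
    have [B H'] := t0; exists (normc (k^-1 - eta^-1) * B) => u uy; have [h1 h2] := H' u uy.
    split; first by apply: (@holM _ (fun=> k^-1 - eta^-1)) => //; exact: hol_cst.
    by rewrite normcM -mulrA ler_wpM2l// normc_ge0.
  rewrite lint_lin//; last exact: tame_lin.
  by rewrite lint_lin// lintZ// /cauchy_line; ring.
rewrite E -mulrA; apply: le_trans (normc_lint (B := K * (A * normc (eta - k))) _) _; last first.
  have := ler_wpM2l (mulr_ge0 (mulr_ge0 K0 A0) (inv_sqr_int_ge0 (R := R))) (ler_normcB eta k).
  lra.
move=> u uy; split; last first.
  apply: H; rewrite ?uy//; first lra.
  apply: hA => //; rewrite ?uy// /rho; lra.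
have hk v : normc v <= rho / 2 -> hol (cut_kernel phi (z + v)) u.
  by move=> /far; rewrite -uy => uv; apply: hol_cut_kernel => //; apply: contraNneq uv => ->.
have hk0 : hol (cut_kernel phi z) u.
  by apply: hol_cut_kernel => //; apply: contraNneq zy => <-; rewrite uy.
have /analytic_offP[_ _ hF _] := aF.
apply: (@holM _ F); first by apply: hF; rewrite uy.
apply: holB; (apply: holM; last exact: hol_cst); apply: holB => //; exact: hk.
Qed.

Lemma cauchy_line_bound y : b < `|y| -> exists2 m, 0 < m & exists2 B, 0 <= B &
  forall z, 1 <= `|y - Im z| -> `|Im z| <= `|y| ->
    normc (cauchy_line y z) <= B * expR (w (m * Re z)).
Proof.
move=> bY; have br : b < `|y| + 1 by lra.
have /analytic_offP[b0 _ hF _] := aF.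
have [m [K [m0 K0 H]]] := prod_bound wd aF br.
have [|A A0 hA] := @cut_kernel_bound _ w phi bphi (2 * `|y|) m _ m0; first lra.
exists (2 * m); first lra.
exists (2 * (K * A * inv_sqr_int)); first by rewrite !mulr_ge0// inv_sqr_int_ge0.
move=> z yz zy.
apply: le_trans (normc_lint (B := K * (A * expR (w (2 * m * Re z)))) _) _; last lra.
have yz' : Im z != y by rewrite -subr_eq0 -normr_gt0 distrC; lra.
move=> u uy; split; first by have [B /(_ u uy)[]] := cut_kernel_tame bY yz'.
apply: H; rewrite ?uy//; first lra.
have := hA u z 1 ltr01; rewrite uy divr1; apply => //.
by rewrite cImD cImN uy; have := ler_normB y (Im z); lra.
Qed.

Section Annihilated.
Hypothesis nullF : forall (psi : U) k, b < k -> strip_contour k (fun z => F z * \val psi z) = 0.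

(** The kernel of a point outside the contour is a limit of test functions on
    the contour, so [F] is orthogonal to it as well. *)
Lemma null_cut_kernel k z : b < k -> k < `|Im z| -> strip_contour k (fun u => F u * cut_kernel phi z u) = 0.
Proof.
move=> bk kz; have /analytic_offP[b0 _ hF _] := aF.
pose r := (k + `|Im z|) / 2.
have [kr rz] : k < r /\ r < `|Im z| by rewrite /r; split; lra.
have br : b < r by lra.
have r0 : 0 < r by lra.
have [m [K [m0 K0 H]]] := prod_bound wd aF br.
apply/eqP; rewrite -[_ == _]negbK -normc_gt0 -leNgt.
apply/ler_addgt0Pr => e e0; rewrite add0r.
pose q := 4 * K * inv_sqr_int + 1.
have q0 : 0 < q by have := mulr_ge0 K0 (inv_sqr_int_ge0 (R := R)); rewrite /q; lra.
have [u hu] := cut_kernel_approx hphi bphi r0 m0 rz (divr_gt0 e0 q0).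
have ak : `|k| = k by rewrite ger0_norm//; lra.
have est y : `|y| = k -> tame (fun v => F v * \val u v) y /\ tame (fun v => F v * cut_kernel phi z v) y /\
    normc (lint (fun v => F v * \val u v) y - lint (fun v => F v * cut_kernel phi z v) y) <= 2 * (K * (e / q) * inv_sqr_int).
  move=> yk; have bY : b < `|y| by rewrite yk.
  have t1 := prod_tame wd aF bY u.
  have t2 : tame (fun v => F v * cut_kernel phi z v) y.
    by apply: cut_kernel_tame => //; apply/eqP => E; move: kz; rewrite E yk ltxx.
  do 2 split => //; rewrite -lintB//; apply: normc_lint => v vy; split.
    have [B1 /(_ v vy)[h1 _]] := t1; have [B2 /(_ v vy)[h2 _]] := t2.
    exact: (@holB _ (fun v => F v * \val u v) (fun v => F v * cut_kernel phi z v)).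
  by rewrite -mulrBr; apply: H; rewrite ?vy ?yk//; apply: hu; rewrite vy yk.
have [_ [_ e1]] := est _ ak; have [|_ [_ e2]] := est (- k); first by rewrite normrN.
have := nullF u bk; rewrite !strip_contourE.
set p := lint _ _ in e2 *; set q1 := lint _ _ in e1 *; set p' := lint _ _ in e2 *; set q' := lint _ _ in e1 *.
move=> pq; have -> : p' - q' = (q1 - q') - (p - p') by have /eqP := pq; rewrite subr_eq0 => /eqP->; ring.
apply: le_trans (ler_normcB _ _) _; apply: le_trans (lerD e1 e2) _.
have -> : 2 * (K * (e / q) * inv_sqr_int) + 2 * (K * (e / q) * inv_sqr_int) = e * ((4 * K * inv_sqr_int) / q) by ring.
by rewrite ler_piMr ?(ltW e0)// ler_pdivrMr// mul1r /q; lra.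
Qed.

(** Of the two strips between the contours, the one that contains [z] gives F(z) by Cauchy's
    formula and over the other one the line can be moved; the inner contour contributes
    nothing by [null_cut_kernel]. *)
Lemma cauchy_off k z : b < `|Im z| -> `|Im z| < k ->
  cauchy_line (- k) z - cauchy_line k z = two_pi_i * F z.
Proof.
move=> bz zk; have /analytic_offP[b0 _ hF _] := aF.
pose c := (b + `|Im z|) / 2; have [bc cz] : b < c /\ c < `|Im z| by rewrite /c; split; lra.
have br : b < k + 1 by lra.
have [m [K [m0 K0 H]]] := prod_bound wd aF br.
have h0 : 0 < k + `|Im z| by have := normr_ge0 (Im z); lra.
have [A A0 hA] := shift_bound bphi h0 m0.
pose B := K * (A * expR (w (2 * m * Re z))).
pose G u := F u * phi (u - z).
have hG u : b < `|Im u| -> `|Im u| <= k -> hol G u /\ normc (G u) <= B * decay (Re u).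
  move=> bu uk; split.
    by apply: (@holM _ F (fun u => phi (u - z))); [exact: hF|exact: hol_phi_shift].
  apply: H => //; first lra.
  by apply: hA; rewrite cImD cImN; have := ler_normB (Im u) (Im z); lra.
have Gz : G z = F z by rewrite /G subrr phi0 mulr1.
have GE y : lint (fun u => G u / (u - z)) y = cauchy_line y z.
  by apply: eq_lint => u _; rewrite /G /cut_kernel mulrA.
have [A' A'0 hA'] := cut_kernel_bound bphi h0 m0.
have shift y1 y2 : y1 <= y2 ->
    (forall y, y1 <= y <= y2 -> [/\ b < `|y|, `|y| <= k & `|Im z| - b <= `|y - Im z|]) ->
    cauchy_line y1 z = cauchy_line y2 z.
  move=> y12 yy; have d0 : 0 < `|Im z| - b by lra.
  apply: (strip_shift (B := K * (A' / (`|Im z| - b) * expR (w (2 * m * Re z))))) => // u /yy[u1 u2 u3].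
  split; last first.
    apply: H => //; first lra.
    by apply: hA' => //; rewrite cImD cImN; have := ler_normB (Im u) (Im z); lra.
  apply: (@holM _ F (cut_kernel phi z)); first exact: hF.
  by apply: hol_cut_kernel => //; apply/eqP => uz; move: u3; rewrite uz subrr normr0; lra.
have := null_cut_kernel bc cz; rewrite strip_contourE -/(cauchy_line _ _) -/(cauchy_line _ _) => N.
have [z0|z0] := lerP 0 (Im z).
  rewrite (ger0_norm z0) in bz zk cz shift; rewrite -Gz.
  have ck : c < Im z < k by apply/andP.
  rewrite -(strip_cauchy (B := B) ck) ?GE.
    rewrite (shift (- k) (- c)); last first.
    - move=> y /andP[y1 y2]; clear H hA hA' hG GE shift N.
      have [Y1 Y2] : y <= 0 /\ y - Im z <= 0 by split; lra.
      rewrite (ler0_norm Y1) (ler0_norm Y2); split; lra.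
    - lra.
    by move/eqP : N; rewrite subr_eq0 => /eqP->.
  move=> u /andP[u1 u2]; have u0 : 0 <= Im u by apply: le_trans u1; exact: ltW (lt_trans b0 bc).
  by apply: hG; rewrite (ger0_norm u0)//; exact: lt_le_trans bc u1.
rewrite (ltr0_norm z0) in bz zk cz shift; rewrite -Gz.
have ck : - k < Im z < - c by apply/andP; split; lra.
rewrite -(strip_cauchy (B := B) ck) ?GE.
  rewrite -(shift c k); last first.
  - move=> y /andP[y1 y2]; clear H hA hA' hG GE shift N.
    have [Y1 Y2] : 0 <= y /\ 0 <= y - Im z by split; lra.
    rewrite (ger0_norm Y1) (ger0_norm Y2); split; lra.
  - lra.
  by move/eqP : N; rewrite subr_eq0 => /eqP->.
move=> u /andP[u1 u2]; have u0 : Im u <= 0 by clear H hA hA' hG GE shift N; lra.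
apply: hG; rewrite (ler0_norm u0); clear H hA hA' GE shift N; lra.
Qed.

(** Inside the contour at height b + 3 the Cauchy integral extends [F]; the growth of the
    extension comes from this integral near the real axis and from [F] elsewhere. *)
Lemma null_extends : exists2 P, is_entire w P &
  exists2 c, 0 < c & forall z, ~ closure (strip c) z -> P z = F z.
Proof.
have /analytic_offP[b0 l0 hF gF] := aF.
pose k := b + 3; have [kk kk'] : `|k| = k /\ `|- k| = k by rewrite normrN /k ger0_norm; lra.
have [bk bk'] : b < `|k| /\ b < `|- k| by rewrite kk kk' /k; split; lra.
pose Q z := two_pi_i^-1 * (cauchy_line (- k) z - cauchy_line k z).
have QF z : b < `|Im z| -> `|Im z| < k -> Q z = F z.
  by move=> bz zk; rewrite /Q cauchy_off// mulKf// two_pi_i_neq0.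
have hQ z : `|Im z| < k -> hol Q z.
  move=> zk; apply: (@holM _ (fun=> two_pi_i^-1) (fun z => cauchy_line (- k) z - cauchy_line k z)).
    exact: hol_cst.
  apply: (@holB _ (cauchy_line (- k)) (cauchy_line k)); apply: hol_cauchy_line => //.
    by apply: contraTneq zk => ->; rewrite kk' ltxx.
  by apply: contraTneq zk => ->; rewrite kk ltxx.
(* [Q] and [F] agree at heights between b and b + 3; where [P] is given by [Q], the distance to
   the contour is at least 2. *)
pose P z := if `|Im z| <= b + 1 then Q z else F z.
exists P; last first.
  exists (b + 1); first lra.
  by move=> z nz; rewrite /P; case: ifP => // zb; case: nz; apply/closure_strip; rewrite //; lra.
have [m1 m10 [B1 B10 hB1]] := cauchy_line_bound bk.
have [m2 m20 [B2 B20 hB2]] := cauchy_line_bound bk'.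
apply/is_entireP; split=> [z|].
  have imd v : normc (v - z) < 1 -> `|Im v - Im z| < 1.
    by move=> vz; rewrite -cImN -cImD; apply: le_lt_trans vz; exact: normc_Im.
  have [zb|zb] := ltP `|Im z| (b + 2).
    apply: (@hol_near _ Q P z (b + 2 - `|Im z|)); [lra| |by apply: hQ; rewrite /k; lra].
    move=> v vz; rewrite /P; case: ifP => // /negbT; rewrite -ltNge => bv.
    apply: QF; first lra.
    have := le_lt_trans (normc_Im _) vz; rewrite cImD cImN.
    have : `|Im v| <= `|Im z| + `|Im v - Im z|.
      by rewrite -{1}(subrK (Im z) (Im v)) addrC ler_normD.
    rewrite /k; lra.
  apply: (@hol_near _ F P z 1) => //; last by apply: hF; lra.
  move=> v /imd vz; rewrite /P ifN// -ltNge.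
  have := lerB_dist (Im z) (Im v); rewrite distrC; lra.
pose m := Num.max l (Num.max m1 m2).
have [ml mm1 mm2] : [/\ l <= m, m1 <= m & m2 <= m] by rewrite /m !le_max !lexx ?orbT.
exists m; first lra.
move=> r r0; have [|M M0 hM] := gF (b + r); first lra.
have nc := normc_ge0 (two_pi_i^-1 : C).
exists (normc (two_pi_i^-1 : C) * (B1 + B2) + M); first by rewrite addr_ge0// mulr_ge0// addr_ge0.
move=> z zr; have ex (m' : R) : 0 < m' -> m' <= m -> expR (w (m' * Re z)) <= expR (w (m * Re z)).
  by move=> m'0 m'm; rewrite ler_expR; apply: le_weight_ext => //; exact: ltW.
have E0 := expR_ge0 (w (m * Re z)).
rewrite /P; case: ifP => [zb|/negbT]; last first.
  rewrite -ltNge => zb; apply: (@le_trans _ _ (M * expR (w (l * Re z)))).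
    by apply: hM; lra.
  apply: ler_pM; rewrite ?expR_ge0 ?ex//.
  by rewrite lerDr mulr_ge0// addr_ge0.
apply: (@le_trans _ _ (normc (two_pi_i^-1 : C) * (B1 + B2) * expR (w (m * Re z)))); last first.
  by rewrite ler_wpM2r// lerDl.
rewrite /Q normcM -mulrA ler_wpM2l//; apply: le_trans (ler_normcB _ _) _.
rewrite mulrDl [leRHS]addrC; apply: lerD.
  apply: le_trans (hB2 _ _ _) _; rewrite ?kk'; last by rewrite ler_wpM2l// ex.
    by have := lerB_dist (- k) (Im z); rewrite kk' /k; lra.
  by rewrite /k; lra.
apply: le_trans (hB1 _ _ _) _; rewrite ?kk; last by rewrite ler_wpM2l// ex.
  by have := lerB_dist k (Im z); rewrite kk /k; lra.
by rewrite /k; lra.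
Qed.

End Annihilated.
End Continuation.
End Kernel.

(** * Every ultrahyperfunction is a boundary value *)

Section Surjectivity.
Context {R : realType} (w : weight R).
Hypothesis wd : cond_delta w.
Local Notation C := (cplx R).
Local Notation U := (test_space w).
Implicit Types (h l M b c r k y : R) (z u zeta : C).
Variable phi : C -> C.
Hypothesis hphi : forall z, hol phi z.
Hypothesis phi0 : phi 0 = 1.
Hypothesis bphi : forall h l, 0 < h -> 0 < l ->
  exists2 K, 0 <= K & forall z, `|Im z| <= h -> normc (phi z) * expR (w (l * Re z)) <= K.

(** The points of the Riemann sums on the two lines of a contour, with the
    weights that turn a density [g] into a finite combination. *)
Definition contour_pairs k (n : nat) (g : C -> C) : seq (C * C) :=
  let x i := - n%:R + i%:R / n%:R ^+ 2 in let d := Complex ((n%:R ^+ 2)^-1) 0 in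
  [seq (d * g (Complex (x (nat_of_ord i)) (- k)), Complex (x i) (- k)) | i : 'I_(2 * n ^ 3)%N] ++
  [seq (- (d * g (Complex (x (nat_of_ord i)) k)), Complex (x i) k) | i : 'I_(2 * n ^ 3)%N].

Lemma contour_pairs_sum k n (g q : C -> C) :
  \sum_(p <- contour_pairs k n g) p.1 * q p.2 =
  rsum n (fun x => g (Complex x (- k)) * q (Complex x (- k))) -
  rsum n (fun x => g (Complex x k) * q (Complex x k)).
Proof.
rewrite /contour_pairs big_cat !big_image /= /rsum -sumrN; congr (_ + _).
  by apply: eq_bigr => i _; rewrite mulrA.
by apply: eq_bigr => i _; rewrite mulNr mulrA.
Qed.

Lemma contour_pairs_Im k n g p : p \in contour_pairs k n g -> `|Im p.2| = `|k|.
Proof. by rewrite mem_cat => /orP[]/mapP[i _ ->] /=; rewrite ?normrN. Qed.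

Lemma eq0_of_natinv_bound (v : C) (K : R) : (forall n : nat, (0 < n)%N -> normc v <= K / n%:R) -> v = 0.
Proof.
move=> H; apply/eqP; rewrite -[_ == _]negbK -normc_gt0 -leNgt.
apply/ler_addgt0Pr => e e0; rewrite add0r.
have [N N0 hN] := small_inv K e0; apply: le_trans (H N N0) (ltW (hN _ _)).
by rewrite lexx.
Qed.

(** The weight at [zeta] costs growth in [z], which [psi] absorbs with enough decay left to
    integrate in [z]. *)
Lemma pair_bound (psi : U) r H l : 0 < r -> 0 < H -> 0 < l -> exists2 A, 0 <= A &
  forall zeta z, `|Im z| < r -> `|Im (zeta - z)| <= H ->
    normc (\val psi z * phi (zeta - z)) * expR (w (l * Re zeta)) <= A * decay (Re z).
Proof.
move=> r0 H0 l0; have [K' K'0 hK'] := shift_bound bphi H0 l0.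
have l20 : 0 < 2 * l by lra.
have [m [K [m0 K0 hK]]] := growth_prod wd l20.
have [_ bp] := testP psi; have [M hM] := bp r m r0 m0.
exists (K' * K * M); first by rewrite !mulr_ge0// (test_bound_ge0 r0 hM).
move=> zeta z zr zH; have e0 := expR_ge0 (w (l * Re zeta)).
have := hK z (Complex (expR (w (l * Re zeta))) 0 * phi (zeta - z)) (\val psi z) K' M K'0.
rewrite !normcM normc_real (ger0_norm e0) => le.
have -> : normc (\val psi z) * normc (phi (zeta - z)) * expR (w (l * Re zeta)) =
  expR (w (l * Re zeta)) * normc (phi (zeta - z)) * normc (\val psi z) by ring.
by apply: le; [rewrite mulrC; exact: hK'|exact: hM].
Qed.

(** As a function of its pole the kernel is - phi(zeta - z)/(z - zeta), so that this is
    Cauchy's formula at [zeta]. *)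
Lemma contour_cut_kernel (psi : U) k zeta : `|Im zeta| < k ->
  lint (fun z => \val psi z * cut_kernel phi z zeta) (- k) - lint (fun z => \val psi z * cut_kernel phi z zeta) k =
  - two_pi_i * \val psi zeta.
Proof.
move=> zk'; move: (zk'); rewrite ltr_norml => zk; have /andP[z1 z2] := zk.
have k0 : 0 < k by lra.
have [k10 k20] : 0 < k + 1 /\ 0 < 2 * k by split; lra.
have [A A0 hA] := pair_bound psi k10 k20 ltr01.
have [hp _] := testP psi.
have H u : - k <= Im u <= k -> hol (fun z => - (\val psi z * phi (zeta - z))) u /\
    normc (- (\val psi u * phi (zeta - u))) <= A * decay (Re u).
  move=> /andP[u1 u2]; have uk : `|Im u| <= k by rewrite ler_norml u1.
  split.
    have -> : (fun z => - (\val psi z * phi (zeta - z))) = (fun z => 0 - \val psi z * phi (zeta - z)).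
      by apply/funext => z; rewrite sub0r.
    apply: (@holB _ (fun=> 0) (fun z => \val psi z * phi (zeta - z))); first exact: hol_cst.
    by apply: (@holM _ (\val psi) (fun z => phi (zeta - z))); [|exact: hol_phi_shift'].
  rewrite normcN; apply: le_trans (hA zeta u _ _); rewrite ?cImD ?cImN; last first.
  - by have := ler_normB (Im zeta) (Im u); lra.
  - lra.
  by rewrite ler_peMr ?normc_ge0// -[leLHS]expR0 ler_expR w_ge0.
have := strip_cauchy zk H; rewrite subrr phi0 mulr1 mulrN -mulNr => <-.
by congr (_ - _); apply: eq_lint => z _; rewrite /cut_kernel mulNr -mulrN -invrN opprB mulrA.
Qed.

Section Representation.
Variables (f : U -> C) (h l K : R) (F : C -> C).
Hypothesis lf : linear f.
Hypotheses (h0 : 0 < h) (l0 : 0 < l) (K0 : 0 <= K).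
Hypothesis rep : forall (s : seq (C * C)) (psi : U) M, (forall p, p \in s -> h < `|Im p.2|) ->
    test_bound w (fun zeta => \sum_(p <- s) p.1 * cut_kernel phi p.2 zeta - \val psi zeta) h l M ->
    normc (\sum_(p <- s) p.1 * F p.2 - f psi) <= K * M.

Lemma represent0 (s : seq (C * C)) M : (forall p, p \in s -> h < `|Im p.2|) ->
  test_bound w (fun zeta => \sum_(p <- s) p.1 * cut_kernel phi p.2 zeta) h l M ->
  normc (\sum_(p <- s) p.1 * F p.2) <= K * M.
Proof.
move=> hs T; have := @rep s 0 M hs; rewrite (linform0 lf) subr0; apply.
by move=> zeta zh; have -> : \val (0 : U) zeta = 0 by []; rewrite subr0; exact: T.
Qed.

(** Holomorphy from the combination of three kernels that is a difference of two difference
    quotients of [cut_kernel] in its pole. *)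
Lemma represent_hol z : h < `|Im z| -> hol F z.
Proof.
move=> hz; have h0' := h0; pose rho := (`|Im z| - h) / 2; have r0 : 0 < rho by rewrite /rho; lra.
pose H := h + `|Im z| + rho; have H0 : 0 < H by rewrite /H; lra.
have [A A0 hA] := cut_kernel_quotients hphi bphi z r0 H0 l0.
have far v : normc v < rho / 2 -> h < `|Im (z + v)|.
  move=> vr; have := le_lt_trans (normc_Im v) vr; rewrite cImD.
  by have := lerB_normD (Im z) (Im v); rewrite /rho; lra.
apply: (@hol_of_quotients _ _ _ (rho / 2) (K * A)); [lra|by rewrite mulr_ge0|].
move=> eta k eta0 k0 er kr.
pose s : seq (C * C) := [:: (eta^-1, z + eta); (- k^-1, z + k); (k^-1 - eta^-1, z)].
have sE (q : C -> C) : \sum_(p <- s) p.1 * q p.2 = (q (z + eta) - q z) / eta - (q (z + k) - q z) / k.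
  by rewrite /s !big_cons big_nil /=; ring.
rewrite -sE; apply: le_trans (represent0 (M := A * normc (eta - k)) _ _) _; last first.
  by rewrite mulrA; apply: ler_wpM2l (ler_normcB _ _); rewrite mulr_ge0.
- move=> zeta zh; rewrite (sE (fun z => cut_kernel phi z zeta)); apply: hA => //; try exact: ltW.
    by have := lerB_dist (Im z) (Im zeta); rewrite distrC /rho; lra.
  by rewrite /H; lra.
- by move=> p; rewrite !inE => /or3P[]/eqP-> //=; exact: far.
Qed.

Lemma represent_bound r : exists2 M, 0 <= M & forall z, h + 1 < `|Im z| -> `|Im z| < r ->
  normc (F z) <= M * expR (w (2 * l * Re z)).
Proof.
have [h0' l0'] := (h0, l0).
have H0 : 0 < h + `|r| by have := normr_ge0 r; lra.
have [A A0 hA] := cut_kernel_bound bphi H0 l0.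
exists (K * A) => [|z hz zr]; first exact: mulr_ge0.
have sE (q : C -> C) : \sum_(p <- [:: (1 : C, z)]) p.1 * q p.2 = q z.
  by rewrite big_seq1 mul1r.
rewrite -(sE F) -[K * A * _]mulrA; apply: represent0.
  by move=> p; rewrite inE => /eqP-> /=; lra.
move=> zeta zh; rewrite (sE (fun z => cut_kernel phi z zeta)) -[A]divr1; apply: hA => //.
  by have := lerB_dist (Im z) (Im zeta); rewrite distrC; lra.
by rewrite cImD cImN; have := ler_normB (Im zeta) (Im z); have := ler_norm r; lra.
Qed.

Lemma represent_analytic (a : C) : analytic_off w (h + 1) (2 * l) (fun z => a * F z).
Proof.
have [h0' l0'] := (h0, l0).
apply/analytic_offP; split; [lra|lra| |].
  move=> z hz; apply: (@holM _ (fun=> a) F); first exact: hol_cst.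
  by apply: represent_hol; lra.
move=> r _; have [M M0 hM] := represent_bound r.
exists (normc a * M); first by rewrite mulr_ge0// normc_ge0.
by move=> z z1 z2; rewrite normcM -[normc a * M * _]mulrA; apply: ler_wpM2l; [exact: normc_ge0|exact: hM].
Qed.

(** The Riemann sums for the contour integral of F psi are combinations of values of [F]; the
    same combinations of kernels tend to - 2 pi i psi in the seminorm that bounds [f]. *)
Lemma represent_contour (psi : U) : strip_contour (h + 2) (fun z => F z * \val psi z) = - two_pi_i * f psi.
Proof.
have [h0' l0' K0'] := And3 h0 l0 K0.
pose k := h + 2; have kk : `|k| = k by rewrite ger0_norm /k; lra.
have [r12 k10] : (0 : R) < 1 / 2 /\ 0 < k + 1 by rewrite /k; split; lra.
have [Kr Kr0 hR] := riemann_strip r12.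
have near y u : `|y| = k -> `|Im u - y| <= 1 / 2 -> h + 1 + 1 / 2 <= `|Im u| /\ `|Im u| < k + 1.
  move=> yk uy; have := lerB_dist y (Im u); have := lerB_dist (Im u) y.
  by rewrite [ `|y - _|]distrC yk /k; split; lra.
have aF : analytic_off w (h + 1) (2 * l) F.
  by have := represent_analytic 1; congr analytic_off; apply/funext => z; rewrite mul1r.
have [|B1 hB1] := @prod_test _ _ wd _ _ _ (k + 1) aF _ psi; first by rewrite /k; lra.
have e1 y n : (0 < n)%N -> `|y| = k -> normc (lint (fun z => \val psi z * F z) y -
    rsum n (fun x => \val psi (Complex x y) * F (Complex x y))) <= Kr * B1 / n%:R.
  move=> n0 yk; apply: (hR (fun z => \val psi z * F z)) => // u /(near _ _ yk)[u1 u2].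
  have [||h1 h2] := hB1 u; [lra|lra|]; rewrite mulrC; split => //.
  have -> : (fun z => \val psi z * F z) = (fun z => F z * \val psi z) by apply/funext => z; rewrite mulrC.
  exact: h1.
have H0 : 0 < h + (k + 1) by lra.
have [A A0 hA] := pair_bound psi k10 H0 l0.
have [hp _] := testP psi.
have e2 y n zeta : (0 < n)%N -> `|y| = k -> `|Im zeta| < h ->
   normc (lint (fun z => \val psi z * cut_kernel phi z zeta) y -
    rsum n (fun x => \val psi (Complex x y) * cut_kernel phi (Complex x y) zeta)) * expR (w (l * Re zeta))
   <= Kr * A / n%:R.
  move=> n0 yk zh; have E0 := expR_gt0 (w (l * Re zeta)).
  rewrite -ler_pdivlMr//.
  have -> : Kr * A / n%:R / expR (w (l * Re zeta)) = Kr * (A / expR (w (l * Re zeta))) / n%:R by ring.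
  apply: (hR (fun z => \val psi z * cut_kernel phi z zeta)) => // u /(near _ _ yk)[u1 u2].
  have far : 1 <= `|Im zeta - Im u|.
    by have := lerB_dist (Im u) (Im zeta); rewrite distrC; lra.
  have uz : zeta != u.
    by rewrite -subr_eq0; apply: (neq_of_far ltr01); exact: Im_far.
  split; first by apply: (@holM _ (\val psi) (fun z => cut_kernel phi z zeta)); [|exact: hol_cut_kernel'].
  have -> : A / expR (w (l * Re zeta)) * decay (Re u) = A * decay (Re u) / expR (w (l * Re zeta)) by ring.
  rewrite ler_pdivlMr//; apply: le_trans (hA zeta u u2 _); last first.
    by rewrite cImD cImN; have := ler_normB (Im zeta) (Im u); lra.
  rewrite ler_wpM2r ?(ltW E0)// /cut_kernel mulrA normcM ler_piMr ?normc_ge0//.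
  by rewrite -[leRHS]invr1; apply: normc_inv_le => //; exact: Im_far.
have kk' : `|- k| = k by rewrite normrN.
rewrite strip_contourE -/k (@eq_lint _ _ (fun z => \val psi z * F z)); last by move=> z _; rewrite mulrC.
rewrite (@eq_lint _ (fun z => F z * \val psi z) (fun z => \val psi z * F z)); last by move=> z _; rewrite mulrC.
apply/eqP; rewrite -subr_eq0; apply/eqP.
apply: (@eq0_of_natinv_bound _ (2 * Kr * B1 + K * (2 * (Kr * A)))) => n n0.
have := @rep (contour_pairs k n (\val psi)) (- two_pi_i *: psi) (2 * (Kr * A) / n%:R).
rewrite (linformZ lf) contour_pairs_sum => H.
have {}H := H _ _.
have e3 := e1 k n n0 kk; have e4 := e1 (- k) n n0 kk'.
set p := lint _ _ in e4 *; set q := lint _ _ in e3 *.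
set p' := rsum _ _ in e4 H; set q' := rsum _ _ in e3 H.
have -> : p - q - - two_pi_i * f psi = (p - p') - (q - q') + (p' - q' - - two_pi_i * f psi) by ring.
apply: le_trans (le_normcD _ _) _.
have -> : (2 * Kr * B1 + K * (2 * (Kr * A))) / n%:R = (Kr * B1 / n%:R + Kr * B1 / n%:R) + K * (2 * (Kr * A) / n%:R) by ring.
apply: lerD; first by apply: le_trans (ler_normcB _ _) _; exact: lerD.
apply: H => [c /contour_pairs_Im->|zeta zh]; first by rewrite kk /k; lra.
rewrite (contour_pairs_sum k n (\val psi) (fun z => cut_kernel phi z zeta)).
have -> : \val (- two_pi_i *: psi) zeta = - two_pi_i * \val psi zeta by [].
rewrite -(@contour_cut_kernel psi k); last by rewrite /k; lra.
have e5 := e2 k n zeta n0 kk zh; have e6 := e2 (- k) n zeta n0 kk' zh.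
move: e5 e6; set s1 := lint _ k; set s2 := lint _ (- k); set t1 := rsum _ _; set t2 := rsum _ _ => e5 e6.
have -> : t2 - t1 - (s2 - s1) = (s1 - t1) - (s2 - t2) by ring.
apply: le_trans (ler_wpM2r (expR_ge0 _) (ler_normcB _ _)) _.
rewrite mulrDl.
have -> : 2 * (Kr * A) / n%:R = Kr * A / n%:R + Kr * A / n%:R by ring.
exact: lerD.
Qed.

End Representation.

Lemma bv_surj (bv : germ_space w -> dual_space w) : is_boundary_value bv ->
  forall d : dual_space w, exists x, bv x = d.
Proof.
move=> bvP d; have [lf cf] : is_dual (\val d) by case: d => d /= /asboolP.
have [h [l [K [F [h0 l0 K0 rep]]]]] := represent hphi bphi lf cf.
have aF := represent_analytic lf h0 l0 K0 rep.
have pF : (fun z => two_pi_i^-1 * F z) \in prerep_pred w.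
  by apply/asboolP; exists (h + 1), (2 * l); exact: aF.
pose G : prerep w := exist (fun F : C -> C => F \in prerep_pred w) _ pF.
exists (germ G); apply: val_inj; apply/funext => psi.
have hk : h + 1 < h + 2 by lra.
rewrite (bvP G _ _ _ (aF two_pi_i^-1) hk).
have t y : `|y| = h + 2 -> tame (fun z => F z * \val psi z) y.
  move=> yh; have := aF 1; have -> : (fun z => 1 * F z) = F by apply/funext => z; rewrite mul1r.
  by move=> a1; apply: (prod_tame wd a1); rewrite yh.
have E y : `|y| = h + 2 -> lint (fun z => \val G z * \val psi z) y =
    two_pi_i^-1 * lint (fun z => F z * \val psi z) y.
  by move=> yh; rewrite -lintZ; [apply: eq_lint => z _; rewrite /= mulrA|exact: t].
have := represent_contour lf h0 l0 K0 rep psi; rewrite !strip_contourE !E ?normrN; [|rewrite ger0_norm; lra..].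
by rewrite -mulrBr => ->; rewrite mulNr mulrN opprK mulKf// two_pi_i_neq0.
Qed.

End Surjectivity.

Theorem theorem5p13 (R : realType) (w : weight R)
    (weps : cond_epsilon0 w) (wdelta : cond_delta w) :
  exists bv : {linear germ_space w -> dual_space w},
    is_boundary_value bv /\ short_exact (@restriction R w) bv.
Proof.
have [phi [hphi phi0 bphi]] := test_function weps.
have [bv bvP] := boundary_value_exists wdelta; exists bv; split => //; split.
- exact: (restriction_inj wdelta hphi phi0 bphi).
- apply/seteqP; split=> [_ [P _ <-]|x /= bx].
    have eP : is_entire w (\val P) by case: P => P /= /asboolP.
    have /is_entireP[hP [l l0 gP]] := eP.
    have aP : analytic_off w 1 l (\val P).
      apply/analytic_offP; split => // r r1; have [|M M0 hM] := gP r; first lra.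
      by exists M => // z _; exact: hM.
    pose F : prerep w := exist (fun F : cplx R -> cplx R => F \in prerep_pred w) _ (entire_prerep P).
    have bvF (psi : test_space w) := bvP F 1 l 2 aP (ltr1n _ 2) psi.
    change (bv (germ F) = 0); apply: val_inj; apply/funext => psi.
    by rewrite bvF (entire_contour wdelta psi eP)// oppr0.
  have [F xE] := germ_surj x; have /asboolP[b [l aF]] := valP F.
  have [psi k bk|P eP [c c0 PF]] := null_extends wdelta hphi phi0 bphi aF.
    have := bvP F b l k aF bk psi; rewrite xE bx => /esym/eqP.
    by rewrite oppr_eq0 => /eqP.
  have pP : P \in entire_pred w by apply/asboolP.
  by exists (exist _ P pP) => //; rewrite -xE; apply/germ_eqP; exists c.
- apply/seteqP; split=> // d _.
  by have [x <-] := bv_surj wdelta hphi phi0 bphi bvP d; exists x.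
Qed.
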